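(* Let $W$ be the dihedral group of order $2d$ ($d\ge1$) and let $c\in\mathcal{C}$ take real values, with $a=c_s$, $b=c_t\in\mathbb{R}$. Then the set of Calogero-Moser $c$-cellular characters of $W$ coincides with the set of Kazhdan-Lusztig $c$-cellular characters of $W$.
   Context: Let $\zeta$ be a primitive $d$-th root of unity, $V=\mathbb{C}^2$ with canonical basis $(x,y)$, dual basis $(X,Y)$ of $V^*$, $\mathbb{C}(V)=\mathbb{C}(X,Y)$. For $i\in\mathbb{Z}/d\mathbb{Z}$, $s_i=\begin{pmatrix}0&\zeta^i\\ \zeta^{-i}&0\end{pmatrix}$, $s=s_0$, $t=s_1$, $W=\langle s,t\rangle$; $(W,\{s,t\})$ is a Coxeter system, with set of reflections $\mathrm{Ref}(W)=\{s_i\}$. $\mathcal{C}$ is the space of functions $c:\mathrm{Ref}(W)\to\mathbb{C}$, $s_i\mapsto c_{s_i}$, constant on conjugacy classes. Calogero-Moser $c$-cellular characters: let $\mathrm{Gau}(W,c)$ be the (commutative) $\mathbb{C}(V)$-subalgebra of the group algebra $\mathbb{C}(V)[W]$ (with $\mathbb{C}(V)$ central) generated by $$D_x=-\sum_{i}\frac{c_{s_i}}{X-\zeta^iY}\,s_i,\qquad D_y=\sum_{i}\frac{c_{s_i}\zeta^i}{X-\zeta^iY}\,s_i.$$ For a simple $\mathrm{Gau}(W,c)$-module $L$, put $\gamma_L=\sum_{\chi\in\mathrm{Irr}(W)}\mathrm{mult}_{L,\chi}\chi$, where $\mathrm{mult}_{L,\chi}$ is the multiplicity of $L$ as a composition factor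 of $\mathrm{Res}_{\mathrm{Gau}(W,c)}(\mathbb{C}(V)\otimes E_\chi)$, $E_\chi$ affording $\chi$. The Calogero-Moser $c$-cellular characters are the $\gamma_L$. Kazhdan-Lusztig $c$-cellular characters: let $\mathcal{A}=\bigoplus_{\gamma\in\mathbb{R}}\mathbb{Z}v^\gamma$ be the group ring of $\mathbb{R}$, and $\mathcal{A}_{<0}=\bigoplus_{\gamma<0}\mathbb{Z}v^\gamma$. Let $\mathcal{H}$ be the Hecke algebra of $(W,\{s,t\})$ over $\mathcal{A}$ with basis $(T_w)_{w\in W}$, where $T_wT_{w'}=T_{ww'}$ if lengths add and $(T_u-v^{c_u})(T_u+v^{-c_u})=0$ for $u\in\{s,t\}$. Let $h\mapsto\overline h$ be the ring involution with $\overline{v^\gamma}=v^{-\gamma}$, $\overline{T_w}=T_{w^{-1}}^{-1}$. The Kazhdan-Lusztig basis $(C_w)_{w\in W}$ is characterized by $\overline{C_w}=C_w$ and $C_w\equiv T_w\bmod\bigoplus_{w'}\mathcal{A}_{<0}T_{w'}$. Let $\le_L$ be the preorder on $W$ generated by: $x\le_L y$ if $C_x$ appears with non-zero coefficient in $hC_y$ for some $h\in\mathcal{H}$; left cells are the equivalence classes. For a left cell $\Gamma$, $\bigoplus_{w\le_L\Gamma}\mathcal{A}C_w\big/\bigoplus_{w<_L\Gamma}\mathcal{A}C_w$ is a left $\mathcal{H}$-module; specializing $v^\gamma\mapsto1$ and extending scalars to $\mathbb{C}$ gives a $\mathbb{C}W$-module whose character is the cellular character of $\Gamma$. The Kazhdan-Lusztig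 $c$-cellular characters are the characters so obtained. *)

(* Defs.v *)
From HB Require Import structures.
From Stdlib Require Import Relation_Operators.
From mathcomp Require Import all_boot all_order all_algebra all_fingroup.
From mathcomp Require Import all_field all_character.
From mathcomp Require Import boolp classical_sets reals complex freeg mpoly.

Set Implicit Arguments.
Unset Strict Implicit.
Unset Printing Implicit Defensive.

Import Order.TTheory GRing.Theory Num.Theory.
Local Open Scope ring_scope.

Section Modules.
Variable A : nzRingType.
Implicit Types L M : lmodType A.

Definition simple_module L : Prop :=
  (exists x : L, x != 0) /\
  (forall S : {pred L}, GRing.submod_closed S ->
     (forall x, x \in S -> x = 0) \/ (forall x, x \in S)).

(* For submodules S of S' of M: the section S' / S is isomorphic to L, i.e.
   there is an A-linear surjection of S' onto L with kernel S. Only the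
   restriction of f to S' matters. *)
Definition section_iso M L (S S' : {pred M}) : Prop :=
  exists f : M -> L,
    [/\ forall a, {in S' &, forall x y, f (a *: x + y) = a *: f x + f y},
        forall z, exists2 x, x \in S' & f x = z
      & {in S', forall x, f x = 0 <-> x \in S}].

Definition maximal_submodule M (S S' : {pred M}) : Prop :=
  [/\ {subset S <= S'}, exists2 x, x \in S' & x \notin S
    & forall N : {pred M}, GRing.submod_closed N ->
        {subset S <= N} -> {subset N <= S'} -> N =i S \/ N =i S'].

Definition composition_series M (n : nat) (F : nat -> {pred M}) : Prop :=
  [/\ forall x, (x \in F 0%N) = (x == 0),
      forall x, x \in F n,
      forall i, (i <= n)%N -> GRing.submod_closed (F i)
    & forall i, (i < n)%N -> maximal_submodule (F i) (F i.+1)].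

(* [comp_mult L M k]: M has finite length, and the simple module L occurs k
   times as a composition factor of M. *)
Definition comp_mult L M (k : nat) : Prop :=
  exists n (F : nat -> {pred M}), composition_series n F /\
    k = (\sum_(i < n) `[< section_iso L (F i) (F i.+1) >])%N.

End Modules.

(* The group algebra K[G]: functions on G with the convolution product. The
   pointwise ring structure of {ffun _} is not inherited. *)
Definition grpalg (K : fieldType) (gT : finGroupType) : Type := {ffun gT -> K}.

Section GroupAlgebra.
Variables (K : fieldType) (gT : finGroupType).
Local Notation KG := (grpalg K gT).
Implicit Types f g h : KG.

HB.instance Definition _ := Vector.copy KG {ffun gT -> K^o}.

Definition grpalg_one : KG := [ffun x => (x == 1%g)%:R].
Definition grpalg_mul f g : KG := [ffun x => \sum_y f y * g (y^-1 * x)%g].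

Fact grpalg_mulA : associative grpalg_mul.
Proof.
move=> f g h; apply/ffunP=> x; rewrite !ffunE.
under eq_bigr do rewrite ffunE mulr_sumr.
rewrite exchange_big /= [RHS](reindex_inj invg_inj) /=.
rewrite [RHS](reindex_inj invg_inj) /=.
under [RHS]eq_bigr do rewrite invgK ffunE mulr_suml.
rewrite [RHS]exchange_big /= exchange_big /=; apply: eq_bigr => y _.
rewrite [RHS](reindex_inj (mulgI y)) /=.
by apply: eq_bigr => z _; rewrite mulKg invMg mulrA !mulgA.
Qed.

Fact grpalg_mul1l : left_id grpalg_one grpalg_mul.
Proof.
move=> f; apply/ffunP=> x; rewrite ffunE (bigD1 1%g) //= big1 => [|y ny1].
  by rewrite ffunE eqxx mul1r invg1 mul1g addr0.
by rewrite ffunE (negbTE ny1) mul0r.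
Qed.

Fact grpalg_mul1r : right_id grpalg_one grpalg_mul.
Proof.
move=> f; apply/ffunP=> x; rewrite ffunE (bigD1 x) //= big1 => [|y nyx].
  by rewrite ffunE mulVg eqxx mulr1 addr0.
by rewrite ffunE -eq_invg_mul invgK (negbTE nyx) mulr0.
Qed.

Fact grpalg_mulDl : left_distributive grpalg_mul +%R.
Proof.
move=> f g h; apply/ffunP=> x; rewrite !ffunE -big_split /=.
by apply: eq_bigr => y _; rewrite ffunE mulrDl.
Qed.

Fact grpalg_mulDr : right_distributive grpalg_mul +%R.
Proof.
move=> f g h; apply/ffunP=> x; rewrite !ffunE -big_split /=.
by apply: eq_bigr => y _; rewrite ffunE mulrDr.
Qed.

Fact grpalg_one_neq0 : grpalg_one != 0.
Proof. by apply/eqP=> /ffunP/(_ 1%g)/eqP; rewrite !ffunE eqxx oner_eq0. Qed.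

HB.instance Definition _ := GRing.Zmodule_isNzRing.Build KG
  grpalg_mulA grpalg_mul1l grpalg_mul1r grpalg_mulDl grpalg_mulDr
  grpalg_one_neq0.

Fact grpalg_scaleAl (k : K) f g : k *: (f * g) = (k *: f) * g.
Proof.
apply/ffunP=> x; rewrite !ffunE [LHS]mulr_sumr.
by apply: eq_bigr => y _; rewrite ffunE [in RHS]/( _ *: _ ) /= mulrA.
Qed.

HB.instance Definition _ := GRing.Lmodule_isLalgebra.Build K KG grpalg_scaleAl.

Fact grpalg_scaleAr (k : K) f g : k *: (f * g) = f * (k *: g).
Proof.
apply/ffunP=> x; rewrite !ffunE [LHS]mulr_sumr.
by apply: eq_bigr => y _; rewrite ffunE [in RHS]/( _ *: _ ) /= mulrCA.
Qed.

HB.instance Definition _ := GRing.Lalgebra_isAlgebra.Build K KG grpalg_scaleAr.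
HB.instance Definition _ := Algebra_isFalgebra.Build K KG.

Definition grpelt (g : gT) : KG := [ffun x => (x == g)%:R].

(* The left K[G]-module of column vectors afforded by a matrix representation,
   restricted to the unital subalgebra generated by ds. *)
Definition resmod (ds : seq KG) n (rho : mx_representation K [set: gT] n)
  : Type := 'cV[K]_n.

Section Restriction.
Variables (ds : seq KG) (n : nat) (rho : mx_representation K [set: gT] n).
Local Notation M := (resmod ds rho).
Local Notation B := <<1 & ds>>%AS.

HB.instance Definition _ := GRing.Zmodule.copy M 'cV[K]_n.

Definition grpalg_mx f : 'M[K]_n := \sum_g f g *: rho g.

Fact grpalg_mxD f g : grpalg_mx (f + g) = grpalg_mx f + grpalg_mx g.
Proof.
by rewrite -big_split; apply: eq_bigr => x _; rewrite ffunE scalerDl.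
Qed.

Fact grpalg_mx1 : grpalg_mx 1 = 1%:M.
Proof.
rewrite /grpalg_mx (bigD1 1%g) //= big1 => [|x nx1].
  by rewrite ffunE eqxx scale1r repr_mx1 addr0.
by rewrite ffunE (negbTE nx1) scale0r.
Qed.

Fact grpalg_mxM f g : grpalg_mx (f * g) = grpalg_mx f *m grpalg_mx g.
Proof.
rewrite mulmx_suml.
under [RHS]eq_bigr => x _.
  rewrite mulmx_sumr (reindex_inj (mulgI x^-1%g)) /=.
  over.
rewrite exchange_big /=; apply: eq_bigr => x _.
rewrite ffunE scaler_suml; apply: eq_bigr => y _.
by rewrite -scalemxAl -scalemxAr scalerA -repr_mxM ?inE // mulKVg.
Qed.

Definition resmod_scale (a : subvs_of B) (v : M) : M := grpalg_mx (vsval a) *m v.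

Fact resmod_scaleA a b v :
  resmod_scale a (resmod_scale b v) = resmod_scale (a * b) v.
Proof. by rewrite /resmod_scale /= grpalg_mxM mulmxA. Qed.

Fact resmod_scale1 : left_id 1 resmod_scale.
Proof.
move=> v; rewrite /resmod_scale /=.
have /eqP-> : algid B == 1.
  by rewrite algid_eq1 (subvP (sub_agenv _)) // (subvP (addvSl _ _)) ?memv_line.
by rewrite grpalg_mx1 mul1mx.
Qed.

Fact resmod_scaleDr : right_distributive resmod_scale +%R.
Proof. by move=> a u v; apply: mulmxDr. Qed.

Fact resmod_scaleDl v : {morph resmod_scale^~ v : a b / a + b}.
Proof. by move=> a b; rewrite /resmod_scale /= grpalg_mxD mulmxDl. Qed.

HB.instance Definition _ := GRing.Zmodule_isLmodule.Build (subvs_of B) M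
  resmod_scaleA resmod_scale1 resmod_scaleDr resmod_scaleDl.

End Restriction.
End GroupAlgebra.

(* The matrix ((0, zeta^i), (zeta^-i, 0)), indices being taken from 0 *)
Definition refl_mx (F : fieldType) (zeta : F) (i : nat) : 'M[F]_2 :=
  \matrix_(k, l) (if (k == 0) && (l == 1) then zeta ^+ i
                  else if (k == 1) && (l == 0) then zeta ^- i else 0).

Section CalogeroMoser.
Variables (R : realType) (gT : finGroupType).
Local Notation C := R[i].
Local Notation W := [set: gT].

Definition ratfun : fieldType := {fraction {mpoly C[2]}}.

Definition ratfun_const : {rmorphism C -> ratfun} := @tofrac _ \o @mpolyC 2 C.
Definition ratX : ratfun := @tofrac _ 'X_(0 : 'I_2).
Definition ratY : ratfun := @tofrac _ 'X_(1 : 'I_2).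

Variables (d : nat) (zeta : C) (s_ : nat -> gT) (c : gT -> C).

(* The index i runs over representatives of Z/dZ. *)
Definition Dunkl_x : grpalg ratfun gT :=
  - \sum_(i < d) (ratfun_const (c (s_ i)) /
                  (ratX - ratfun_const (zeta ^+ i) * ratY)) *: grpelt _ (s_ i).

Definition Dunkl_y : grpalg ratfun gT :=
  \sum_(i < d) (ratfun_const (c (s_ i) * zeta ^+ i) /
                (ratX - ratfun_const (zeta ^+ i) * ratY)) *: grpelt _ (s_ i).

Definition Gau : {aspace grpalg ratfun gT} := <<1 & [:: Dunkl_x; Dunkl_y]>>%AS.

Definition Irr : irrType C W := DecSocleType (regular_repr C W).

Definition irr_char (chi : Irr) (w : gT) : C := \tr (irr_repr chi w).

Definition Res_irr (chi : Irr) : lmodType (subvs_of Gau) :=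
  resmod [:: Dunkl_x; Dunkl_y] (map_repr ratfun_const (irr_repr chi)).

(* [Irr] indexes the irreducible representations of W over C up to isomorphism. *)
Definition CM_cellular : set (gT -> C) := fun gamma =>
  exists (L : lmodType (subvs_of Gau)) (mult : Irr -> nat),
    [/\ simple_module L,
        forall chi, comp_mult L (Res_irr chi) (mult chi)
      & gamma = fun w => \sum_chi (mult chi)%:R * irr_char chi w].

End CalogeroMoser.

(* The group ring Z[G] of an additive group G, in exponential notation: p is the
   formal sum of the (coeff g p) v^g over g in [dom p], the support of p. *)
Definition expring (G : zmodType) : Type := {freeg G / int}.

Section ExponentRing.
Variable G : zmodType.
Local Notation A := (expring G).
Implicit Types p q r : A.

HB.instance Definition _ := GRing.Zmodule.copy A {freeg G / int}.

Definition vexp (g : G) : A := << g >>.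

Definition explift (f : G -> A) p : A := fglift (f : G -> {freeg G / int}) p.

(* The biadditive product such that v^g v^h = v^(g + h) *)
Definition expring_mul p q : A :=
  explift (fun g => explift (fun h => vexp (g + h)) q) p.

Fact explift_additive f : additive (explift f).
Proof. exact: lift_is_additive. Qed.

HB.instance Definition _ f :=
  GRing.isZmodMorphism.Build A A (explift f) (explift_additive f).

Fact expliftE f g : explift f (vexp g) = f g.
Proof. by rewrite /explift liftU scale1r. Qed.

Fact expring_ind (P : A -> Prop) :
    P 0 -> (forall p q, P p -> P q -> P (p - q)) -> (forall g, P (vexp g)) ->
  forall p, P p.
Proof.
move=> P0 PB PU p.
have PN q : P q -> P (- q) by move=> Pq; rewrite -sub0r; apply: PB.
have PD q r : P q -> P r -> P (q + r).
  by move=> Pq Pr; rewrite -[r]opprK; apply/PB/PN.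
move: p; apply: freeg_ind_dom0 => // k g q _ _; apply: (PD).
have -> : << k *g g >> = vexp g *~ k by rewrite [RHS]freegU_mulz intz.
have PUn n : P (vexp g *+ n) by elim: n => // n IHn; rewrite mulrS; apply: (PD).
by case: k => n; [apply: PUn | rewrite NegzE mulrNz; apply/PN/PUn].
Qed.

Fact explift_eq (f1 f2 : A -> A) :
    additive f1 -> additive f2 -> (forall g, f1 (vexp g) = f2 (vexp g)) ->
  f1 =1 f2.
Proof.
move=> f1B f2B f12; have f0 (f : A -> A) : additive f -> f 0 = 0.
  by move=> fB; rewrite -[0 in LHS](subrr 0) fB subrr.
move=> p; elim/expring_ind: p => [|p q Ep Eq|//]; first by rewrite !f0.
by rewrite f1B f2B Ep Eq.
Qed.

Fact explift_fun_additive (F : G -> A -> A) p :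
  (forall g, additive (F g)) -> additive (fun q => explift (F^~ q) p).
Proof.
move=> FB q r; move: p; apply: explift_eq => [||g].
- exact: explift_additive.
- by move=> p p'; rewrite !raddfB addrACA.
- by rewrite !expliftE FB.
Qed.

Fact expring_mulBl : left_distributive expring_mul (fun p q => p - q).
Proof. by move=> p q r; apply: explift_additive. Qed.

Fact expring_mulBr : right_distributive expring_mul (fun p q => p - q).
Proof.
by move=> p; apply: explift_fun_additive => g; apply: explift_additive.
Qed.

Fact expring_mulU g h : expring_mul (vexp g) (vexp h) = vexp (g + h).
Proof. by rewrite /expring_mul !expliftE. Qed.

Fact expring_mulC : commutative expring_mul.
Proof.
move=> p q; move: p; apply: explift_eq => [p p'|p p'|g].
- exact: expring_mulBl.
- exact: expring_mulBr.
move: q; apply: explift_eq => [p p'|p p'|h].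
- exact: expring_mulBr.
- exact: expring_mulBl.
by rewrite !expring_mulU addrC.
Qed.

Fact expring_mulA : associative expring_mul.
Proof.
move=> p q r; move: p; apply: explift_eq => [p p'|p p'|g].
- exact: expring_mulBl.
- by rewrite !expring_mulBl.
move: q; apply: explift_eq => [p p'|p p'|h].
- by rewrite expring_mulBl expring_mulBr.
- by rewrite expring_mulBr expring_mulBl.
move: r; apply: explift_eq => [p p'|p p'|k].
- by rewrite !expring_mulBr.
- exact: expring_mulBr.
by rewrite !expring_mulU addrA.
Qed.

Fact expring_mul1 : left_id (vexp 0) expring_mul.
Proof.
apply: explift_eq => [p q|//|g]; first exact: expring_mulBr.
by rewrite expring_mulU add0r.
Qed.

Fact expring_mulDl : left_distributive expring_mul +%R.
Proof. by move=> p q r; rewrite /expring_mul raddfD. Qed.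

Fact expring_one_neq0 : vexp 0 != 0.
Proof.
by apply/eqP=> /(congr1 (coeff 0)) /eqP; rewrite coeffU coeff0 eqxx mulr1.
Qed.

HB.instance Definition _ := GRing.Zmodule_isComNzRing.Build A
  expring_mulA expring_mulC expring_mul1 expring_mulDl expring_one_neq0.

End ExponentRing.

Section KazhdanLusztig.
Variables (R : realType) (gT : finGroupType).
Local Notation A := (expring R).

(* The least number of factors in an expression of w as a product of elements
   of S. If S generates gT then this is always less than #|gT|. *)
Definition gen_length (S : {set gT}) (w : gT) : nat :=
  find (fun n => w \in (S ^+ n)%g) (iota 0 #|gT|).

Definition exp_neg (p : A) : Prop := forall g, g \in dom p -> g < 0.

Section Basis.
Variable H : lmodType A.
Implicit Type b : gT -> H.

Definition lincomb b (a : {ffun gT -> A}) : H := \sum_w a w *: b w.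

Definition is_basis b : Prop := bijective (lincomb b).

(* The coordinates of h, when b is a basis *)
Definition coords b (h : H) : {ffun gT -> A} :=
  xget 0 (fun a => lincomb b a = h).

End Basis.

Variables (S : {set gT}) (c : gT -> R) (H : algType A).
Implicit Types (T C : gT -> H) (bar : {rmorphism H -> H}).

(* H with its family T is determined up to a unique isomorphism by the following
   properties, and then so are its bar involution and Kazhdan-Lusztig basis. *)
Record is_Hecke_algebra T : Prop := IsHeckeAlgebra {
  Hecke_basis : is_basis T;
  Hecke_mul : forall w w',
    gen_length S (w * w')%g = (gen_length S w + gen_length S w')%N ->
    T w * T w' = T (w * w')%g;
  Hecke_quad : forall u, u \in S ->
    (T u - (vexp (c u))%:A) * (T u + (vexp (- c u))%:A) = 0
}.

Record is_bar_involution T bar : Prop := IsBarInvolution {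
  bar_involutive : involutive bar;
  bar_vexp : forall g : R, bar (vexp g)%:A = (vexp (- g))%:A;
  bar_T : forall w, bar (T w) * T w^-1%g = 1 /\ T w^-1%g * bar (T w) = 1
}.

(* The last condition is C_w = T_w modulo the sum of the A_{<0} T_w'. *)
Record is_KL_basis T bar C : Prop := IsKLBasis {
  KL_basis : is_basis C;
  KL_bar : forall w, bar (C w) = C w;
  KL_triangular : forall w, exists a : {ffun gT -> A},
    (forall w', exp_neg (a w')) /\ C w = T w + lincomb T a
}.

Definition KL_step C (x y : gT) : Prop :=
  exists h : H, coords C (h * C y) x <> 0.

Definition KL_le C : gT -> gT -> Prop := clos_refl_trans gT (KL_step C).

Definition is_left_cell C (Gamma : {set gT}) : Prop :=
  exists w, forall x, x \in Gamma <-> KL_le C x w /\ KL_le C w x.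

(* The classes of the C_w, for w in the left cell Gamma, form a basis of the
   cell module. This is the matrix of T_x on that basis after specialising all
   the v^g to 1; [deg] is the sum of the coefficients. *)
Definition cell_mx T C (Gamma : {set gT}) (x : gT) : 'M[R[i]]_#|Gamma| :=
  \matrix_(i, j)
    (deg (coords C (T x * C (enum_val j)) (enum_val i)))%:~R.

Definition KL_cellular T C : set (gT -> R[i]) := fun gamma =>
  exists Gamma : {set gT},
    is_left_cell C Gamma /\ gamma = fun x => \tr (cell_mx T C Gamma x).

End KazhdanLusztig.

(* Main.v *)
(* The two sets are given by the same list of characters. Put a = c_s, b = c_t,
   let e_{p,q} be the linear character with s -> (-1)^p and t -> (-1)^q, when it
   exists, let chi2 be the sum of the irreducible characters of degree 2, and put
   wt(p,q) = (-1)^p a + (-1)^q b. If a = b = 0 then the only cellular character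
   is the regular character. Otherwise the cellular characters are
   - the sum of the e_{p',q'} such that (-1)^p' a = (-1)^p a and
     (-1)^q' b = (-1)^q b, for each existing e_{p,q} with wt(p,q) <> 0;
   - e_{p,q} + chi2, for each existing e_{p,q} with wt(p,q) = 0;
   - chi2, if d > 2 and wt(p,q) <> 0 for all existing e_{p,q}.

   Kazhdan-Lusztig side: tensoring with linear characters and exchanging s and t
   reduce the problem to a >= b >= 0. If a > 0 then C_{sts..} is the product of
   C_s with T_{ts..} plus terms of shorter length with coefficients in A_{<0};
   elements of this shape are unique, so the products C_u C_w can be computed by
   recursion on the length. The left cells follow, and the character carried by
   the elements with a given last letter is a trace that can be computed in the
   basis (T_w).

   Calogero-Moser side: P_k = sum_i c_i zeta^{ki} / (X - zeta^i Y) satisfies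
   X P_k = Y P_{k+1} as soon as zeta^{2k} <> 1. Hence on every irreducible
   representation of degree 2 the operator D_x has trace 0 and square
   (Y/X) P_0 P_1, and D_y = - (X/Y) D_x; so Gau(W,c) does not distinguish these
   representations. On a linear character X D_x + Y D_y acts by a non-zero
   multiple of wt(p,q), and if wt(p,q) = 0 then again D_x^2 = (Y/X) P_0 P_1.
   Whether (Y/X) P_0 P_1 is a square, that is, whether the restrictions of the
   representations of degree 2 to Gau(W,c) are reducible, does not matter. *)

(* The representations of degree 2 are never separated: only their sum [chi2] is computed, by
   subtraction. Right multiplication by C_s maps H into the left ideal H C_s, spanned by the C_w
   with w ending in s, and acts there by v^(c_s) + v^(-c_s), which is 2 at v = 1. So the trace of h
   -> T_x h C_s is twice the character of that ideal; in the basis T it counts the w with x w s = w.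
   By column orthogonality this count is the sum of the chi(x) chi(s), where degree 2 contributes
   nothing since reflections have trace 0. Removing the small cells, which carry linear characters,
   leaves [chi2]. The obstacle for c_t < c_s is that C_s C_t C_w, for w starting with s, contains
   for c_t > 0 the multiple v^(c_s - c_t) + v^(c_t - c_s) of C_w itself; it has to be removed before
   a recursion raising the length by two can be set up. On the Calogero-Moser side, C(V) is not
   algebraically closed and a simple module is not given inside any representation. It is controlled
   through faithfulness: an element of Gau(W,c) that vanishes on all irreducible representations of
   W is 0, so relations valid there pass to every simple module. *)
From HB Require Import structures.
Require Import Defs.
From Stdlib Require Import Relation_Operators.
From mathcomp Require Import all_boot all_order all_algebra all_fingroup.
From mathcomp Require Import all_field all_character zify ring.
From mathcomp Require Import boolp classical_sets reals complex freeg mpoly.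

Set Implicit Arguments.
Unset Strict Implicit.
Unset Printing Implicit Defensive.

Import Order.TTheory GRing.Theory Num.Theory.
Local Open Scope ring_scope.

(** * Words in dihedral groups *)

Section Dihedral.

Variable gT : finGroupType.
Implicit Types x y s t w : gT.

Fixpoint alt x y n : gT := if n is m.+1 then (x * alt y x m)%g else 1%g.

(* The Coxeter system of order 2 d, including the case d = 1, where s = t *)
Record dihedral (d : nat) s t : Prop := Dihedral {
  dih_gt0 : (0 < d)%N;
  dih_ss : (s * s = 1)%g;
  dih_tt : (t * t = 1)%g;
  dih_gen : <<[set s; t]>>%g = [set: gT];
  dih_braid : alt s t d = alt t s d;
  dih_injs : forall m n, (m <= d)%N -> (n <= d)%N ->
    alt s t m = alt s t n -> m = n;
  dih_injt : forall m n, (m <= d)%N -> (n <= d)%N ->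
    alt t s m = alt t s n -> m = n;
  dih_sep : forall m n, (m < d)%N -> (n < d)%N ->
    alt s t m = alt t s n -> m = 0%N
}.

Lemma dihedral_sym d s t : dihedral d s t -> dihedral d t s.
Proof.
case=> d0 ss tt gen braid injs injt sep; split=> //; first by rewrite finset.setUC.
move=> m n md nd E; have n0 := sep n m nd md (esym E).
by apply: (injt m 0%N) => //; [apply: ltnW | rewrite E n0].
Qed.

Section Facts.
Variables (d : nat) (s t : gT) (D : dihedral d s t).

Lemma dih_altK n : (s * alt s t n.+1)%g = alt t s n.
Proof. by rewrite /= mulgA (dih_ss D) mul1g. Qed.

(** [dih_sep] stops short of length d, where the two words agree; at length d the braid relation
    gives both words the same first letter. *)
Lemma alt_len_eq m n : (m <= d)%N -> (n <= d)%N -> alt s t m = alt t s n -> m = n.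
Proof.
move=> md nd E; have [mE|md'] := eqVneq m d.
  rewrite mE in E *; apply: (dih_injt D) => //.
  by rewrite -E (dih_braid D).
have [nE|nd'] := eqVneq n d.
  rewrite nE in E *; apply: (dih_injs D) => //.
  by rewrite E (dih_braid D).
have md2 : (m < d)%N by rewrite ltn_neqAle md'.
have nd2 : (n < d)%N by rewrite ltn_neqAle nd'.
have m0 := dih_sep D md2 nd2 E.
by apply/esym; apply: (dih_injt D) => //; rewrite -E m0.
Qed.

Lemma dih_ind (P : gT -> Prop) : P 1%g -> (forall x, P x -> P (s * x)%g) ->
  (forall x, P x -> P (t * x)%g) -> forall x, P x.
Proof.
move=> P1 Ps Pt x; have : x \in <<[set s; t]>>%g by rewrite (dih_gen D) inE.
case/gen_prodgP=> n [c cS ->]; elim: n c cS => [|n IHn] c cS.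
  by rewrite big_ord0.
rewrite big_ord_recl; have := cS ord0; rewrite !inE => /orP[] /eqP->.
  by apply: Ps; apply: IHn.
by apply: Pt; apply: IHn.
Qed.

End Facts.

Section Words.
Variables (d : nat) (s t : gT) (D : dihedral d s t).
Let D' := dihedral_sym D.

Definition is_word k x := x = alt s t k \/ x = alt t s k.

Lemma is_word_S x k : (k < d)%N -> is_word k x ->
  (is_word k.+1 (s * x)%g \/ (0 < k)%N /\ is_word k.-1 (s * x)%g) /\
  (is_word k.+1 (t * x)%g \/ (0 < k)%N /\ is_word k.-1 (t * x)%g).
Proof.
move=> kd [->|->]; split.
- case: k kd => [|k] kd; first by left; left.
  by right; split=> //; right; rewrite (dih_altK D).
- by left; right.
- by left; left.
- case: k kd => [|k] kd; first by left; right.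
  by right; split=> //; left; rewrite (dih_altK D').
Qed.

Lemma is_word_d x : is_word d x -> is_word d.-1 (s * x)%g /\ is_word d.-1 (t * x)%g.
Proof.
have d0 := dih_gt0 D; case=> ->; rewrite -?(dih_braid D).
  split; last rewrite (dih_braid D); rewrite -(prednK d0).
    by right; rewrite (dih_altK D).
  by left; rewrite (dih_altK D').
split; last rewrite (dih_braid D); rewrite -(prednK d0).
  by right; rewrite (dih_altK D).
by left; rewrite (dih_altK D').
Qed.

Lemma wordP x : exists2 k, (k <= d)%N & is_word k x.
Proof.
move: x; apply: (dih_ind D); first by exists 0%N => //; left.
  move=> x [k]; rewrite leq_eqVlt => /orP[/eqP->|kd] xk.
    by exists d.-1; [exact: leq_pred | case: (is_word_d xk)].
  case: (is_word_S kd xk) => [[?|[k0 ?]] _]; first by exists k.+1.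
  by exists k.-1 => //; apply: leq_trans (leq_pred _) (ltnW kd).
move=> x [k]; rewrite leq_eqVlt => /orP[/eqP->|kd] xk.
  by exists d.-1; [exact: leq_pred | case: (is_word_d xk)].
case: (is_word_S kd xk) => [_ [?|[k0 ?]]]; first by exists k.+1.
by exists k.-1 => //; apply: leq_trans (leq_pred _) (ltnW kd).
Qed.

Lemma is_word_inj x k l : (k <= d)%N -> (l <= d)%N ->
  is_word k x -> is_word l x -> k = l.
Proof.
move=> kd ld [->|->] [] E.
- exact: (dih_injs D).
- exact: (alt_len_eq D).
- by apply/esym/(alt_len_eq D).
- exact: (dih_injt D).
Qed.

Lemma alt_expgs k : alt s t k \in ([set s; t] ^+ k)%g /\
                    alt t s k \in ([set s; t] ^+ k)%g.
Proof.
elim: k => [|k [IH1 IH2]]; first by rewrite /= expg0 inE.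
by rewrite expgS; split; apply: mem_mulg => //; rewrite !inE eqxx ?orbT.
Qed.

Lemma expgs_word m x : x \in ([set s; t] ^+ m)%g ->
  exists k, [/\ (k <= m)%N, (k <= d)%N & is_word k x].
Proof.
elim: m x => [|m IHm] x.
  by rewrite expg0 inE => /eqP->; exists 0%N; split=> //; left.
rewrite expgS => /mulsgP[u y uS /IHm[k [km kd yk]] ->].
have{uS}: u = s \/ u = t by move: uS; rewrite !inE => /orP[]/eqP; [left|right].
move: kd; rewrite leq_eqVlt => /orP[/eqP kE|kd] uE.
  have yd : is_word d y by rewrite -kE.
  exists d.-1; split; [by rewrite -kE; apply: leq_trans (leq_pred _) (leqW km)|exact: leq_pred|].
  by case: (is_word_d yd); case: uE => ->.
have [Hs Ht] := is_word_S kd yk.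
have : is_word k.+1 (u * y)%g \/ (0 < k)%N /\ is_word k.-1 (u * y)%g.
  by case: uE => ->.
case=> [?|[_ ?]]; first by exists k.+1.
exists k.-1; split=> //; first by apply: leq_trans (leq_pred _) (leqW km).
by apply: leq_trans (leq_pred _) (ltnW kd).
Qed.

(** [gen_length] searches only lengths below [#|gT|]; this bound puts every length up to d within
    its range. *)
Lemma lt_card_dihedral : (d < #|gT|)%N.
Proof.
pose f (i : 'I_d.+1) := alt s t i.
have f_inj : injective f.
  by move=> i j /(dih_injs D) E; apply/val_inj/E; rewrite -ltnS.
by rewrite -[d.+1]card_ord -(card_codom f_inj) max_card.
Qed.

Lemma gen_length_word k x : (k <= d)%N -> is_word k x ->
  gen_length [set s; t] x = k.
Proof.
move=> kd xk; rewrite /gen_length.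
set P := (fun n => x \in _).
have Pk : P k by case: xk; rewrite /P => ->; case: (alt_expgs k).
have kN : (k < #|gT|)%N by apply: leq_ltn_trans kd lt_card_dihedral.
have hasP : has P (iota 0 #|gT|) by apply/hasP; exists k; rewrite // mem_iota.
apply/eqP; rewrite eqn_leq; apply/andP; split; rewrite leqNgt; apply/negP.
  by move/(before_find 0%N); rewrite nth_iota // add0n Pk.
move=> lt_k; have := nth_find 0%N hasP.
rewrite nth_iota ?add0n; last by move: hasP; rewrite has_find size_iota.
move/expgs_word=> [l [le_l ld xl]].
by have E := is_word_inj kd ld xk xl; rewrite E ltnNge le_l in lt_k.
Qed.

End Words.
End Dihedral.

(** * Exponent rings and bases *)

Section ExponentRingTheory.
Variable R : realType.
Local Notation A := (expring R).
Implicit Types p q : A.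

Definition ebar p : A := explift (fun g => vexp (- g)) p.

Lemma ebarU (g : R) : ebar (vexp g) = vexp (- g).
Proof. exact: expliftE. Qed.

Lemma ebarB p q : ebar (p - q) = ebar p - ebar q.
Proof. exact: raddfB. Qed.

Lemma ebar0 : ebar 0 = 0. Proof. exact: raddf0. Qed.

Lemma vexpD (g h : R) : vexp (g + h) = vexp g * vexp h.
Proof. by rewrite [RHS]expring_mulU. Qed.

Lemma vexp0 : vexp (0 : R) = 1. Proof. by []. Qed.

Definition ecoeff (g : R) p : int := coeff g p.

Lemma ecoeffB g p q : ecoeff g (p - q) = ecoeff g p - ecoeff g q.
Proof. exact: coeffB. Qed.
Lemma ecoeffD g p q : ecoeff g (p + q) = ecoeff g p + ecoeff g q.
Proof. exact: coeffD. Qed.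
Lemma ecoeffN g p : ecoeff g (- p) = - ecoeff g p.
Proof. exact: coeffN. Qed.
Lemma ecoeff0 g : ecoeff g 0 = 0.
Proof. exact: coeff0. Qed.
Lemma ecoeffU g h : ecoeff g (vexp h) = (h == g)%:R.
Proof. by rewrite /ecoeff /vexp coeffU mul1r. Qed.

Lemma ecoeff_eq p q : (forall g, ecoeff g p = ecoeff g q) -> p = q.
Proof. by move=> E; apply/eqP/freeg_eqP=> g; apply: E. Qed.

Lemma ecoeff_bar g p : ecoeff g (ebar p) = ecoeff (- g) p.
Proof.
elim/expring_ind: p => [|p q Ep Eq|h]; first by rewrite ebar0 !ecoeff0.
  by rewrite ebarB !ecoeffB Ep Eq.
by rewrite ebarU !ecoeffU eqr_oppLR.
Qed.

Lemma ecoeff_mulU g h p : ecoeff g (vexp h * p) = ecoeff (g - h) p.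
Proof.
elim/expring_ind: p => [|p q Ep Eq|k]; first by rewrite mulr0 !ecoeff0.
  by rewrite mulrBr !ecoeffB Ep Eq.
rewrite -vexpD !ecoeffU; congr (_%:R); congr nat_of_bool.
by apply/eqP/eqP=> [<-|->]; ring.
Qed.

Lemma exp_negP p : exp_neg p <-> forall g, 0 <= g -> ecoeff g p = 0.
Proof.
split=> [np g g0|E g].
  by apply: coeff_outdom; apply/negP=> /np; rewrite ltNge g0.
by rewrite mem_dom ltNge; apply: contra => /E /eqP.
Qed.

Definition exp_npos p : Prop := forall g, 0 < g -> ecoeff g p = 0.

Lemma exp_neg0 : exp_neg (0 : A).
Proof. by apply/exp_negP=> g _; rewrite ecoeff0. Qed.

Lemma exp_negD p q : exp_neg p -> exp_neg q -> exp_neg (p + q).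
Proof.
move=> /exp_negP Ep /exp_negP Eq; apply/exp_negP=> g g0.
by rewrite ecoeffD Ep ?Eq.
Qed.

Lemma exp_negN p : exp_neg p -> exp_neg (- p).
Proof.
by move=> /exp_negP Ep; apply/exp_negP=> g g0; rewrite ecoeffN Ep ?oppr0.
Qed.

Lemma exp_neg_sum (I : Type) (r : seq I) (P : pred I) (F : I -> A) :
  (forall i, P i -> exp_neg (F i)) -> exp_neg (\sum_(i <- r | P i) F i).
Proof. by move=> nF; elim/big_rec: _ => [|i p /nF]; [exact: exp_neg0 | exact: exp_negD]. Qed.

Lemma exp_negU (g : R) : g < 0 -> exp_neg (vexp g).
Proof.
move=> g0; apply/exp_negP=> h h0; rewrite ecoeffU.
by case: eqP => // gh; rewrite -gh leNgt g0 in h0.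
Qed.

Lemma exp_npos_neg p : exp_neg p -> exp_npos p.
Proof. by move=> /exp_negP E g g0; apply: E; apply: ltW. Qed.

Lemma exp_nposU (g : R) : g <= 0 -> exp_npos (vexp g).
Proof.
move=> g0 h h0; rewrite ecoeffU.
by case: eqP => // gh; rewrite -gh ltNge g0 in h0.
Qed.

Lemma exp_negM p q : exp_neg p -> exp_npos q -> exp_neg (q * p).
Proof.
move=> np nq; have Eq : q = \sum_(z <- dom q) vexp z *~ coeff z q :> A.
  rewrite -[LHS](freeg_sumE q); apply: eq_bigr => z _.
  by rewrite [RHS]freegU_mulz intz.
rewrite Eq mulr_suml big_seq; apply: exp_neg_sum => g gq.
have g0 : g <= 0.
  by move: gq; rewrite mem_dom leNgt; apply: contra => /nq/eqP.
rewrite mulrzAl; apply/exp_negP=> h h0.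
have E : ecoeff h (vexp g * p) = 0.
  by rewrite ecoeff_mulU; move/exp_negP: np; apply; rewrite subr_ge0 (le_trans _ h0).
by rewrite /ecoeff raddfMz /= -/(ecoeff h _) E mul0rz.
Qed.

(** Bar negates exponents, so a fixed element has a support symmetric about 0. The uniqueness of the
    Kazhdan-Lusztig basis rests on this. *)
Lemma exp_neg_bar0 p : exp_neg p -> ebar p = p -> p = 0.
Proof.
move=> /exp_negP np bp; apply: ecoeff_eq => g; rewrite ecoeff0.
case: (lerP 0 g) => [|g0]; first exact: np.
by rewrite -bp ecoeff_bar np // oppr_ge0 ltW.
Qed.

(** The specialisation of v at 1, named so that it can carry the structure of a ring morphism on
    [expring R]. *)
Definition edeg p : int := deg p.

Lemma edeg_additive : additive edeg.
Proof. exact: deg_is_additive. Qed.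
HB.instance Definition _ := GRing.isZmodMorphism.Build A int edeg edeg_additive.

Lemma edegU (g : R) : edeg (vexp g) = 1. Proof. exact: degU. Qed.

Lemma edeg_monoid : monoid_morphism edeg.
Proof.
split=> [|p q]; first exact: edegU.
elim/expring_ind: p => [|p p' Ep Ep'|h]; first by rewrite mul0r !raddf0 mul0r.
  by rewrite mulrBl !raddfB /= Ep Ep' mulrBl.
rewrite edegU mul1r; elim/expring_ind: q => [|p p' Ep Ep'|k].
- by rewrite mulr0.
- by rewrite mulrBr !raddfB /= Ep Ep'.
- by rewrite -vexpD !edegU.
Qed.
HB.instance Definition _ := GRing.isMonoidMorphism.Build A int edeg edeg_monoid.

End ExponentRingTheory.

Section Bases.
Variables (R : realType) (gT : finGroupType) (H : lmodType (expring R)).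
Variables (b : gT -> H) (bB : is_basis b).
Implicit Types (g h : H) (x y : gT).

Lemma coordsK h : lincomb b (coords b h) = h.
Proof.
case: bB => f fK Kf.
exact: (@xgetPex _ 0 (fun a => lincomb b a = h) (ex_intro _ (f h) (Kf h))).
Qed.

Lemma lincombK a : coords b (lincomb b a) = a.
Proof. by apply: (bij_inj bB); rewrite coordsK. Qed.

Lemma coords_sumE h : h = \sum_x coords b h x *: b x.
Proof. by rewrite -[LHS]coordsK. Qed.

Lemma coords_linear p h g :
  coords b (p *: h + g) = [ffun x => p * coords b h x + coords b g x].
Proof.
rewrite -[RHS]lincombK; congr (coords b _).
rewrite {1}(coords_sumE h) {1}(coords_sumE g) scaler_sumr -big_split.
by apply: eq_bigr => x _; rewrite ffunE scalerDl scalerA.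
Qed.

Lemma coordsD h g x : coords b (h + g) x = coords b h x + coords b g x.
Proof. by rewrite -[h in LHS]scale1r coords_linear ffunE mul1r. Qed.

Lemma coords0 x : coords b 0 x = 0.
Proof. by apply: (addrI (coords b 0 x)); rewrite -coordsD !addr0. Qed.

Lemma coordsZ p h x : coords b (p *: h) x = p * coords b h x.
Proof. by rewrite -[p *: h]addr0 coords_linear ffunE coords0 addr0. Qed.

Lemma coordsN h x : coords b (- h) x = - coords b h x.
Proof. by apply/eqP; rewrite -addr_eq0 -coordsD addNr coords0. Qed.

Lemma coordsB h g x : coords b (h - g) x = coords b h x - coords b g x.
Proof. by rewrite coordsD coordsN. Qed.

Lemma coords_sum (I : Type) (r : seq I) (P : pred I) (F : I -> H) x :
  coords b (\sum_(i <- r | P i) F i) x = \sum_(i <- r | P i) coords b (F i) x.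
Proof.
by apply: (big_morph (fun h => coords b h x)) => [h g|]; rewrite ?coords0 ?coordsD.
Qed.

Lemma coords_basis y x : coords b (b y) x = (x == y)%:R.
Proof.
have E : b y = lincomb b [ffun x => (x == y)%:R].
  rewrite /lincomb (bigD1 y) //= ffunE eqxx scale1r big1 ?addr0 // => z /negbTE.
  by rewrite ffunE => ->; rewrite scale0r.
by rewrite E lincombK ffunE.
Qed.

Lemma coords_eq h g : (forall x, coords b h x = coords b g x) -> h = g.
Proof. by move=> E; rewrite -[h]coordsK -[g]coordsK; congr lincomb; apply/ffunP. Qed.

End Bases.

(** Both traces equal the same double sum over the two changes of basis. This is what moves
    characters of cells from the basis C to the basis T. *)
Lemma trace_basis (R : realType) (gT : finGroupType) (H : lmodType (expring R))
    (b b' : gT -> H) (bB : is_basis b) (bB' : is_basis b') (f : H -> H)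
    (fL : forall (a : gT -> expring R) (e : gT -> H),
       f (\sum_x a x *: e x) = \sum_x a x *: f (e x)) :
  \sum_x coords b (f (b x)) x = \sum_x coords b' (f (b' x)) x.
Proof.
transitivity (\sum_x \sum_y coords b (b' y) x * coords b' (f (b x)) y).
  apply: eq_bigr => x _; rewrite {1}(coords_sumE bB' (f (b x))) coords_sum //.
  by apply: eq_bigr => y _; rewrite coordsZ // mulrC.
rewrite exchange_big; apply: eq_bigr => y _.
rewrite {2}(coords_sumE bB (b' y)) fL coords_sum //.
by apply: eq_bigr => x _; rewrite coordsZ.
Qed.

(** Identities between linear combinations are checked on coordinates in the basis [hB], where
    [ring] decides them. *)
Ltac Hmod hB := apply: (coords_eq hB) => ?;
  rewrite ?(coordsD hB, coordsZ hB, coordsN hB, coords0 hB); ring.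

Lemma is_Hecke_sym (R : realType) (gT : finGroupType) (s t : gT) (c : gT -> R)
    (H : algType (expring R)) (T : gT -> H) :
  is_Hecke_algebra [set s; t] c T -> is_Hecke_algebra [set t; s] c T.
Proof. by rewrite finset.setUC. Qed.

(** * Hecke algebras of dihedral groups *)

Section DihedralHecke.
Variables (R : realType) (gT : finGroupType) (d : nat).
Variables (c : gT -> R) (H : algType (expring R)) (T : gT -> H).
Local Notation A := (expring R).
Implicit Types (s t x y : gT) (h Z : H) (p q : A).

Definition qdiff x : A := vexp (c x) - vexp (- c x).

Section OneGenerator.
Variables (s t : gT) (D : dihedral d s t) (hT : is_Hecke_algebra [set s; t] c T).
Let hB : is_basis T := Hecke_basis hT.

(** Lengths add in the product of 1 and w, so T_1 fixes every T_w on the left, hence also the unit,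
    which is a combination of the T_w. *)
Lemma Hecke_T1 : T 1%g = 1.
Proof.
have T1T w : T 1%g * T w = T w.
  rewrite (Hecke_mul hT) ?mul1g //.
  by rewrite (gen_length_word D (k := 0) (x := 1%g)) //; left.
rewrite -[LHS]mulr1 [X in _ * X](coords_sumE hB) mulr_sumr.
rewrite [RHS](coords_sumE hB).
by apply: eq_bigr => x _; rewrite -scalerAr T1T.
Qed.

Lemma Hecke_altS n : (n < d)%N -> T s * T (alt t s n) = T (alt s t n.+1).
Proof.
move=> nd; have Ls : gen_length [set s; t] s = 1%N.
  apply: (gen_length_word D); first exact: leq_trans nd.
  by left; rewrite /= mulg1.
have Ln : gen_length [set s; t] (alt t s n) = n.
  by apply: (gen_length_word D); [exact: ltnW | right].
have Ln1 : gen_length [set s; t] (alt s t n.+1) = n.+1.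
  by apply: (gen_length_word D) => //; left.
by rewrite (Hecke_mul hT) // Ls Ln -[(s * _)%g]/(alt s t n.+1) Ln1.
Qed.

Lemma Hecke_sq : T s * T s = 1 + qdiff s *: T s.
Proof.
have := Hecke_quad hT (_ : s \in _); rewrite !inE eqxx => /(_ isT).
rewrite mulrDr !mulrBl !mulr_algl !mulr_algr scalerA -vexpD subrr.
rewrite vexp0 scale1r => E; apply/eqP; rewrite -subr_eq0 -[X in _ == X]E.
by apply/eqP; rewrite /qdiff; Hmod hB.
Qed.

End OneGenerator.
End DihedralHecke.

(** * The bar involution and the uniqueness of the Kazhdan-Lusztig basis *)

Section DihedralBar.
Variables (R : realType) (gT : finGroupType) (d : nat).
Variables (c : gT -> R) (H : algType (expring R)) (T : gT -> H).
Local Notation A := (expring R).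
Implicit Types (s t x y : gT) (h Z : H) (p q : A).

Lemma Hecke_alt_sq s t (D : dihedral d s t)
    (hT : is_Hecke_algebra [set s; t] c T) n : (n < d)%N ->
  T s * T (alt s t n.+1) = T (alt t s n) + qdiff c s *: T (alt s t n.+1).
Proof.
move=> nd; rewrite -(Hecke_altS D hT nd) mulrA (Hecke_sq hT) mulrDl mul1r.
by rewrite -scalerAl.
Qed.

Variables (s t : gT) (D : dihedral d s t) (hT : is_Hecke_algebra [set s; t] c T).
Variables (bar : {rmorphism H -> H}) (hbar : is_bar_involution T bar).
Let hB : is_basis T := Hecke_basis hT.
Let D' := dihedral_sym D.
Let hT' := is_Hecke_sym hT.

Lemma bar_scale p h : bar (p *: h) = ebar p *: bar h.
Proof.
rewrite -mulr_algl rmorphM -[RHS]mulr_algl; congr (_ * _).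
elim/expring_ind: p => [|p q Ep Eq|g]; first by rewrite scale0r rmorph0 ebar0 scale0r.
  by rewrite scalerBl rmorphB Ep Eq ebarB scalerBl.
by rewrite (bar_vexp hbar) ebarU.
Qed.

Local Notation len := (gen_length [set s; t]).

Lemma lenP z : (len z <= d)%N /\ is_word s t (len z) z.
Proof. by have [k kd zk] := wordP D z; rewrite (gen_length_word D kd zk). Qed.

Lemma len_alt n : (n <= d)%N -> len (alt s t n) = n /\ len (alt t s n) = n.
Proof. by move=> nd; split; apply: (gen_length_word D) => //; [left | right]. Qed.

Definition low k h := forall z, (k <= len z)%N -> coords T h z = 0.

Lemma lowD k h h' : low k h -> low k h' -> low k (h + h').
Proof. by move=> L L' z kz; rewrite coordsD // L // L' // addr0. Qed.

Lemma lowZ k p h : low k h -> low k (p *: h).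
Proof. by move=> L z kz; rewrite coordsZ // L // mulr0. Qed.

Lemma low_leq k l h : (k <= l)%N -> low k h -> low l h.
Proof. by move=> kl L z lz; apply: L; apply: leq_trans lz. Qed.

Lemma low_sum k (I : Type) (r : seq I) (P : pred I) (F : I -> H) :
  (forall i, P i -> low k (F i)) -> low k (\sum_(i <- r | P i) F i).
Proof.
move=> L; elim/big_rec: _ => [z _|i h Pi]; first by rewrite coords0.
by apply: lowD; apply: L.
Qed.

Lemma lowT k z : (len z < k)%N -> low k (T z).
Proof.
move=> zk z' kz'; rewrite coords_basis //.
by case: eqP => // E; rewrite E leqNgt zk in kz'.
Qed.

Lemma low_mulT x k h : x = s \/ x = t -> low k h -> low k.+1 (T x * h).
Proof.
move=> xst L; rewrite [h](coords_sumE hB) mulr_sumr; apply: low_sum => z _.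
case: (ltnP (len z) k) => [zk|kz]; last first.
  by rewrite L // scale0r mulr0 => z' _; rewrite coords0.
rewrite -scalerAr; apply: lowZ; have [zd zw] := lenP z.
have key u v (E : dihedral d u v) (hE : is_Hecke_algebra [set u; v] c T) n :
    (forall m, (m <= d)%N -> len (alt u v m) = m /\ len (alt v u m) = m) ->
    (n <= d)%N -> (n < k)%N ->
    low k.+1 (T u * T (alt u v n)) /\ low k.+1 (T v * T (alt u v n)).
  move=> lenE nd nk; split.
    case: n nd nk => [|n] nd nk.
      rewrite (Hecke_T1 E hE) mulr1; apply: lowT.
      by have [] := lenE 1%N (dih_gt0 E); rewrite /= mulg1 => -> _.
    rewrite (Hecke_alt_sq E hE) //; apply: lowD; last apply: lowZ.
      by apply: lowT; have [_ ->] := lenE n (ltnW nd); apply: leqW; apply: ltnW.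
    by apply: lowT; have [-> _] := lenE n.+1 nd; apply: leqW.
  move: nd; rewrite leq_eqVlt => /orP[/eqP nE|nd]; last first.
    rewrite (Hecke_altS (dihedral_sym E) (is_Hecke_sym hE)) //.
    by apply: lowT; have [_ ->] := lenE n.+1 nd.
  (* The longest word is rewritten to start with v, which brings the product under the quadratic
     relation. *)
  have d0 := dih_gt0 E; rewrite nE (dih_braid E); rewrite nE in nk.
  have -> : alt v u d = alt v u d.-1.+1 by rewrite prednK.
  rewrite (Hecke_alt_sq (dihedral_sym E) (is_Hecke_sym hE)) ?prednK //.
  apply: lowD; last apply: lowZ; apply: lowT.
    by have [-> _] := lenE d.-1 (leq_pred d); lia.
  by have [_ ->] := lenE d (leqnn d); apply: leqW.
have lst : forall m, (m <= d)%N -> len (alt s t m) = m /\ len (alt t s m) = m.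
  exact: len_alt.
have lts : forall m, (m <= d)%N -> len (alt t s m) = m /\ len (alt s t m) = m.
  by move=> m /len_alt[].
have [k1 k2] := key s t D hT _ lst zd zk.
have [k3 k4] := key t s D' hT' _ lts zd zk.
by case: xst zw => -> [] ->.
Qed.

Lemma bar_Ts x : x = s \/ x = t -> bar (T x) = T x - qdiff c x *: 1.
Proof.
move=> xst; have xV : (x^-1 = x)%g.
  by apply/eqP; rewrite eq_invg_mul; case: xst => ->; rewrite ?(dih_ss D) ?(dih_tt D).
have sq : T x * T x = 1 + qdiff c x *: T x.
  by case: xst => ->; [apply: (Hecke_sq hT) | apply: (Hecke_sq hT')].
have [b1 _] := bar_T hbar x; rewrite xV in b1.
have E : T x * (T x - qdiff c x *: 1) = 1.
  by rewrite mulrBr sq -scalerAr mulr1 addrK.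
by rewrite -[LHS]mulr1 -[X in _ * X]E mulrA b1 mul1r.
Qed.

(** Unitriangularity comes from peeling off the first letter u: bar(T_u) is T_u minus a scalar, and
    a factor T_u raises lengths by at most one. *)
Lemma bar_tri z : low (len z) (bar (T z) - T z).
Proof.
have key n : (n <= d)%N -> low n (bar (T (alt s t n)) - T (alt s t n)) /\
    low n (bar (T (alt t s n)) - T (alt t s n)).
  have step u v (E : dihedral d u v) (hE : is_Hecke_algebra [set u; v] c T) m :
      u = s \/ u = t -> len (alt v u m) = m -> (m < d)%N ->
      low m (bar (T (alt v u m)) - T (alt v u m)) ->
      low m.+1 (bar (T (alt u v m.+1)) - T (alt u v m.+1)).
    move=> ust lm md L; rewrite -(Hecke_altS E hE) // rmorphM bar_Ts //.
    set l := _ - _ in L; have -> : bar (T (alt v u m)) = T (alt v u m) + l.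
      by rewrite addrC subrK.
    have -> : (T u - qdiff c u *: 1) * (T (alt v u m) + l) - T u * T (alt v u m) =
       T u * l + ((- qdiff c u) *: T (alt v u m) + (- qdiff c u) *: l).
      by rewrite mulrBl mulrDr -scalerAl mul1r; Hmod hB.
    apply: lowD; first exact: low_mulT.
    by apply: lowD; apply: lowZ; [apply: lowT; rewrite lm | exact: low_leq L].
  elim: n => [|n IHn] nd.
    by rewrite (Hecke_T1 D hT) rmorph1 subrr; split=> x _; rewrite coords0.
  have [I1 I2] := IHn (ltnW nd); have [l1 l2] := len_alt (ltnW nd).
  by split; [apply: (step s t) | apply: (step t s)] => //; [left | right].
have [zd zw] := lenP z; have [k1 k2] := key _ zd.
by move: (len z) zw k1 k2 => m [] ->.
Qed.

Definition Neg h := forall z, exp_neg (coords T h z).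

(** Descending induction on the length: once all longer coordinates vanish, unitriangularity makes a
    coordinate invariant under [ebar], and being negative it is 0. *)
Lemma neg_bar_inv0 h : Neg h -> bar h = h -> h = 0.
Proof.
move=> nh bh; suff L k : low (d.+1 - k) h.
  by apply: (coords_eq hB) => z; rewrite coords0 //; apply: (L d.+1); rewrite subnn.
elim: k => [|k IHk] z kz.
  by have [zd _] := lenP z; move: kz; rewrite subn0 ltnNge zd.
case: (ltnP (len z) (d.+1 - k)) => [zk|]; last exact: IHk.
apply: exp_neg_bar0; first exact: nh.
rewrite -[in RHS]bh [h in bar h](coords_sumE hB) rmorph_sum coords_sum //.
rewrite (bigD1 z) //= bar_scale coordsZ //.
have -> : coords T (bar (T z)) z = 1.
  have := bar_tri (leqnn (len z)); rewrite coordsB // coords_basis // eqxx.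
  by move/eqP; rewrite subr_eq0 => /eqP.
rewrite mulr1 big1 ?addr0 // => y yz; rewrite bar_scale coordsZ //.
case: (leqP (len y) (len z)) => [yz'|zy].
  have := bar_tri yz'; rewrite coordsB // coords_basis // eq_sym (negbTE yz).
  by rewrite subr0 => ->; rewrite mulr0.
by rewrite IHk ?ebar0 ?mul0r //; apply: leq_trans zy; rewrite -ltnS in kz *; lia.
Qed.

Variables (C : gT -> H) (hC : is_KL_basis T bar C).

Lemma Neg0 : Neg 0. Proof. by move=> z; rewrite coords0 //; apply: exp_neg0. Qed.

Lemma NegD h h' : Neg h -> Neg h' -> Neg (h + h').
Proof. by move=> n n' z; rewrite coordsD //; apply: exp_negD. Qed.

Lemma NegN h : Neg h -> Neg (- h).
Proof. by move=> n z; rewrite coordsN //; apply: exp_negN. Qed.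

Lemma NegT p z : exp_neg p -> Neg (p *: T z).
Proof.
move=> np y; rewrite coordsZ // coords_basis //.
by case: (_ == _); rewrite ?mulr1 // mulr0; apply: exp_neg0.
Qed.

Lemma KL_uniq w h : bar h = h -> Neg (h - T w) -> h = C w.
Proof.
move=> bh nh; apply/eqP; rewrite -subr_eq0; apply/eqP; apply: neg_bar_inv0; last first.
  by rewrite rmorphB bh (KL_bar hC).
have [a [na ->]] := KL_triangular hC w; rewrite opprD addrA.
apply: NegD => //; apply: NegN => z.
by rewrite lincombK.
Qed.

End DihedralBar.

(** * Kazhdan-Lusztig bases *)

Section KLForm.
Variables (R : realType) (gT : finGroupType) (d : nat).
Variables (c : gT -> R) (H : algType (expring R)) (T : gT -> H).
Local Notation A := (expring R).
Implicit Types (x y : gT) (h Z : H) (p q : A).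

(** For c x = 0 the power v^(-c x) is not in A_{<0}, while T_x is already bar-invariant, so no
    correction is added. Thus [Cgen x] is C_x as soon as 0 <= c x (see [KLgen]). *)
Definition qneg x : A := if 0 < c x then vexp (- c x) else 0.
Definition Cgen x : H := T x + qneg x *: 1.
Definition qsum x : A := vexp (c x) + vexp (- c x).

(** A sum built term by term, repetitions allowed, rather than a coordinate function: the effect of
    multiplying by C_t or applying [Nop] is then followed one term at a time. *)
Inductive NS (u v : gT) (m : nat) : H -> Prop :=
| NS0 : NS u v m 0
| NSD p j Z : (j < m)%N -> exp_neg p -> NS u v m Z ->
    NS u v m (p *: T (alt u v j) + Z).

Lemma NS_add u v m Z Z' : NS u v m Z -> NS u v m Z' -> NS u v m (Z + Z').
Proof.
move=> nZ nZ'; elim: nZ => [|p j Z1 jm np _ IH]; first by rewrite add0r.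
by rewrite -addrA; apply: NSD.
Qed.

Lemma NS_opp u v m Z : NS u v m Z -> NS u v m (- Z).
Proof.
elim=> [|p j Z1 jm np _ IH]; first by rewrite oppr0; apply: NS0.
by rewrite opprD -scaleNr; apply: NSD => //; apply: exp_negN.
Qed.

Lemma NS_T u v m p j : (j < m)%N -> exp_neg p -> NS u v m (p *: T (alt u v j)).
Proof. by move=> jm np; rewrite -[_ *: _]addr0; apply: NSD => //; apply: NS0. Qed.

Lemma NS_leq u v m n Z : (m <= n)%N -> NS u v m Z -> NS u v n Z.
Proof.
move=> mn; elim=> [|p j Z1 jm np _ IH]; first exact: NS0.
by apply: NSD => //; apply: leq_trans mn.
Qed.

(* By [KLformP], a bar-invariant element of this shape is C_w, w = s t s .. of
   length n + 1. *)
Definition KLform (s t : gT) (n : nat) h : Prop :=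
  exists2 Z, NS t s n Z & h = Cgen s * (T (alt t s n) + Z).

Section Gens.
Variables (s t : gT) (D : dihedral d s t) (hT : is_Hecke_algebra [set s; t] c T).
Variables (bar : {rmorphism H -> H}) (hbar : is_bar_involution T bar).
Variables (C : gT -> H) (hC : is_KL_basis T bar C).
Let hB : is_basis T := Hecke_basis hT.
Let D' := dihedral_sym D.
Let hT' := is_Hecke_sym hT.
Hypothesis cs0 : 0 < c s.

Let qnegE : qneg s = vexp (- c s). Proof. by rewrite /qneg cs0. Qed.
Let nqs : exp_neg (vexp (- c s)).
Proof. by apply: exp_negU; rewrite oppr_lt0. Qed.

Lemma Cgen_T n : (n < d)%N ->
  Cgen s * T (alt t s n) = T (alt s t n.+1) + vexp (- c s) *: T (alt t s n).
Proof.
by move=> nd; rewrite mulrDl -scalerAl mul1r qnegE (Hecke_altS D hT nd).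
Qed.

(** This is C_s T_s = v^(c_s) C_s, applied to T_(s t ..) = T_s T_(t s ..). *)
Lemma Cgen_T' n : (n < d)%N ->
  Cgen s * T (alt s t n.+1) = vexp (c s) *: (Cgen s * T (alt t s n)).
Proof.
move=> nd; rewrite Cgen_T // mulrDl -scalerAl mul1r qnegE.
rewrite (Hecke_alt_sq D hT nd) scalerDr scalerA -vexpD subrr vexp0 /qdiff.
by Hmod hB.
Qed.

Lemma Cgen_sq : Cgen s * Cgen s = qsum s *: Cgen s.
Proof.
have := Cgen_T' (dih_gt0 D); rewrite /= mulg1 (Hecke_T1 D hT) mulr1 => E.
by rewrite {2}/Cgen mulrDr E -scalerAr mulr1 qnegE -scalerDl.
Qed.

Lemma KLform_Cgen n h : KLform s t n h -> Cgen s * h = qsum s *: h.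
Proof. by case=> Z _ ->; rewrite mulrA Cgen_sq -scalerAl. Qed.

Lemma NS_Neg m Z : (m <= d)%N -> NS t s m Z -> Neg T (Cgen s * Z).
Proof.
move=> md; elim=> [|p j Z1 jm np _ IH]; first by rewrite mulr0; apply: (Neg0 hT).
rewrite mulrDr -scalerAr Cgen_T; last exact: leq_trans md.
apply: (NegD hT) => //; rewrite scalerDr scalerA; apply: (NegD hT).
  exact: (NegT hT).
by apply: (NegT hT) => //; rewrite mulrC; apply: exp_negM => //; apply: exp_npos_neg.
Qed.

(** Multiplying by C_s multiplies the negative coefficients of Z only by 1 and v^(-c_s). So
    everything but the leading term stays in A_{<0}, and [KL_uniq] applies. *)
Lemma KLformP n h : (n < d)%N -> bar h = h -> KLform s t n h -> h = C (alt s t n.+1).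
Proof.
move=> nd bh [Z nZ E]; apply: (KL_uniq D hT hbar hC) => //.
rewrite E mulrDr Cgen_T // [X in Neg _ X]addrC !addrA addNr add0r.
apply: (NegD hT); last exact: NS_Neg (ltnW nd) nZ.
exact: (NegT hT).
Qed.

Lemma KLform0 : KLform s t 0 (Cgen s).
Proof. by exists 0; [apply: NS0 | rewrite (Hecke_T1 D hT) addr0 mulr1]. Qed.

Section TwoPositive.
Hypothesis ct0 : 0 < c t.

(** Expanding C_s T_(t s ..) leaves a second term v^(-c_s) T_(t s ..), whose first letter t is
    absorbed by C_t at the price of a factor v^(c_t). *)
Lemma Cgen_altS j : (j.+1 < d)%N ->
  Cgen t * (Cgen s * T (alt t s j.+1)) =
  Cgen t * (T (alt s t j.+2) + vexp (c t - c s) *: T (alt s t j)).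
Proof.
move=> jd; rewrite Cgen_T // !mulrDr; congr (_ + _).
have := Hecke_alt_sq D' hT' (ltnW jd) => E.
rewrite -!scalerAr {1}/Cgen mulrDl E -scalerAl mul1r.
rewrite /Cgen mulrDl (Hecke_altS D' hT' (ltnW jd)) -scalerAl mul1r.
rewrite /qdiff /qneg ct0 !vexpD; apply: (coords_eq hB) => z.
have E1 : vexp (c t) * vexp (- c t) = 1 :> A by rewrite -vexpD subrr.
by rewrite ?(coordsD hB, coordsZ hB); ring: E1.
Qed.

(** The inequality between the parameters keeps v^(c_t - c_s) free of positive exponents, so
    negative coefficients stay negative. *)
Lemma NS_alt m Z : c t <= c s -> (m <= d)%N -> NS t s m Z ->
  exists2 Z', NS s t m.+1 Z' & Cgen t * (Cgen s * Z) = Cgen t * Z'.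
Proof.
move=> cts md; elim=> [|p j Z1 jm np _ [Z' nZ' E]].
  by exists 0; [apply: NS0 | rewrite mulr0].
have nn q : exp_npos q -> exp_neg (p * q).
  by move=> nq; rewrite mulrC; apply: exp_negM.
case: j jm => [|j] jm.
  exists (p *: T (alt s t 1) + ((p * vexp (- c s)) *: T (alt s t 0) + Z')).
    apply: NSD => //; apply: NSD => //; apply: nn; exact: exp_npos_neg.
  rewrite !mulrDr E !addrA; congr (_ + _); rewrite -!scalerAr.
  rewrite Cgen_T; last exact: leq_trans md.
  by rewrite mulrDr -!scalerAr scalerDr scalerA.
exists (p *: T (alt s t j.+2) + ((p * vexp (c t - c s)) *: T (alt s t j) + Z')).
  apply: NSD => //; apply: NSD => //; first by apply: leqW; apply: ltnW.
  by apply: nn; apply: exp_nposU; rewrite subr_le0.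
rewrite !mulrDr E !addrA; congr (_ + _); rewrite -!scalerAr.
rewrite Cgen_altS; last exact: leq_trans md.
by rewrite mulrDr -!scalerAr scalerDr scalerA.
Qed.

(** Now v^(c_t - c_s) lies in A_{<0}: the new term goes into Z and the product needs no
    correction. *)
Lemma KLform_lt n h : c t < c s -> (n.+1 < d)%N ->
  KLform s t n h -> KLform t s n.+1 (Cgen t * h).
Proof.
move=> cts nd [Z nZ ->]; have [Z' nZ' E] := NS_alt (ltW cts) (ltnW (ltnW nd)) nZ.
rewrite !mulrDr E; case: n nd nZ nZ' => [|n] nd nZ nZ'.
  exists (vexp (- c s) *: T (alt s t 0) + Z'); first exact: NSD.
  by rewrite Cgen_T ?(ltnW nd) // -mulrDr addrA.
exists (vexp (c t - c s) *: T (alt s t n) + Z').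
  by apply: NSD => //; apply: exp_negU; rewrite subr_lt0.
by rewrite Cgen_altS ?(ltnW nd) // -mulrDr addrA.
Qed.

Lemma KLform_eq0 h : (1 < d)%N ->
  KLform s t 0 h -> c t <= c s -> KLform t s 1 (Cgen t * h).
Proof.
move=> nd [Z nZ ->] cts; have [Z' nZ' E] := NS_alt cts (leq0n _) nZ.
rewrite !mulrDr E; exists (vexp (- c s) *: T (alt s t 0) + Z'); first exact: NSD.
by rewrite Cgen_T ?(ltnW nd) // -mulrDr addrA.
Qed.

(** For equal parameters the coefficient v^(c_t - c_s) is 1. The unwanted C_t T_(s t ..) with n
    letters is the leading part of h', whose remaining terms are negative. *)
Lemma KLform_eq n h h' : c t = c s -> (n.+2 < d)%N ->
  KLform s t n.+1 h -> KLform t s n h' -> KLform t s n.+2 (Cgen t * h - h').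
Proof.
move=> cts nd [Z nZ ->] [Z2 nZ2 ->].
have [|Z' nZ' E] := NS_alt _ (ltnW (ltnW nd)) nZ; first by rewrite cts.
rewrite !mulrDr E; exists (Z' - Z2).
  by apply: NS_add => //; apply: NS_opp; apply: NS_leq nZ2; lia.
rewrite Cgen_altS ?(ltnW nd) // cts subrr vexp0 scale1r !mulrDr mulrN.
by Hmod hB.
Qed.

End TwoPositive.

Section Unequal.
Hypotheses (ct0 : 0 <= c t) (cts : c t < c s).

(* [Nop] raises the length by two: [kap] is the constant for which
   Nop (C_s T_j) = C_s (T_(j+2) + T_(j-2)) for j >= 2, with T_j = T_(t s ..), j
   letters (see [Nop_TS]). *)
Definition kap : A := vexp (- c s - c t) - vexp (c t - c s).
Definition zet : A := qneg t * qsum s - kap.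
Definition Nop h : H := Cgen s * (T t * h) + kap *: h.

Lemma kap_neg : exp_neg kap.
Proof.
apply: exp_negD; last apply: exp_negN; apply: exp_negU.
  by rewrite -opprD oppr_lt0 ltr_wpDr.
by rewrite subr_lt0.
Qed.

(** For j = 0 and j = 1 there is no T_(j-2) in the formula for [Nop]; what stands in its place has
    negative coefficients and can be left in Z, so the first two recursions subtract nothing. *)
Lemma Nop_T0 : (1 < d)%N -> Nop (Cgen s * T (alt t s 0)) =
  Cgen s * (T (alt t s 2) + (vexp (- c s) *: T (alt t s 1) + kap *: T (alt t s 0))).
Proof.
move=> d1; rewrite /Nop {1}Cgen_T ?(ltnW d1) // (mulrDr (T t)) (Hecke_altS D' hT') //.
rewrite -scalerAr -[alt t s 0]/(alt s t 0) (Hecke_altS D' hT') ?(ltnW d1) //.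
by rewrite !mulrDr -!scalerAr addrA.
Qed.

Lemma Nop_T1 : (2 < d)%N -> Nop (Cgen s * T (alt t s 1)) =
  Cgen s * (T (alt t s 3) + vexp (- c s) *: T (alt t s 0)).
Proof.
move=> d2; rewrite /Nop {1}Cgen_T ?(ltnW d2) // (mulrDr (T t)) (Hecke_altS D' hT') //.
rewrite -scalerAr (Hecke_alt_sq D' hT') ?(ltnW (ltnW d2)) //.
rewrite !mulrDr -!scalerAr !mulrDr -!scalerAr /qdiff /kap !vexpD.
by rewrite [alt s t 0]/(alt t s 0); Hmod hB.
Qed.

Lemma Nop_TS j : (j.+3 < d)%N -> Nop (Cgen s * T (alt t s j.+2)) =
  Cgen s * (T (alt t s j.+4) + T (alt t s j)).
Proof.
move=> jd; rewrite /Nop {1}Cgen_T ?(ltnW jd) // (mulrDr (T t)) (Hecke_altS D' hT') //.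
rewrite -scalerAr (Hecke_alt_sq D' hT') ?(ltnW (ltnW jd)) //.
rewrite !mulrDr -!scalerAr !mulrDr -!scalerAr Cgen_T'; last lia.
have E1 : vexp (c s) * vexp (- c s) = 1 :> A by rewrite -vexpD subrr.
rewrite /qdiff /kap !vexpD; apply: (coords_eq hB) => z.
by rewrite ?(coordsD hB, coordsZ hB); ring: E1.
Qed.

Lemma NopD h h' : Nop (h + h') = Nop h + Nop h'.
Proof. by rewrite /Nop !mulrDr scalerDr addrACA. Qed.

Lemma NopZ p h : Nop (p *: h) = p *: Nop h.
Proof. by rewrite /Nop -!scalerAr scalerDr !scalerA mulrC. Qed.

Lemma NS_Nop m Z : (m < d.-1)%N -> NS t s m Z ->
  exists2 Z', NS t s m.+2 Z' & Nop (Cgen s * Z) = Cgen s * Z'.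
Proof.
move=> md; elim=> [|p j Z1 jm np _ [Z' nZ' E]].
  by exists 0; [apply: NS0 | rewrite /Nop !mulr0 scaler0 addr0].
have nn q : exp_npos q -> exp_neg (p * q).
  by move=> nq; rewrite mulrC; apply: exp_negM.
rewrite mulrDr NopD E -scalerAr NopZ; case: j jm => [|[|j]] jm.
- rewrite Nop_T0; last lia.
  exists (p *: T (alt t s 2) + ((p * vexp (- c s)) *: T (alt t s 1) +
     ((p * kap) *: T (alt t s 0) + Z'))).
    apply: NSD; rewrite ?ltnS //; apply: NSD; rewrite ?ltnS //.
      by apply: nn; apply: exp_npos_neg.
    by apply: NSD => //; apply: nn; apply: exp_npos_neg; apply: kap_neg.
  by rewrite /kap !mulrDr -!scalerAr; Hmod hB.
- rewrite Nop_T1; last lia.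
  exists (p *: T (alt t s 3) + ((p * vexp (- c s)) *: T (alt t s 0) + Z')).
    apply: NSD; rewrite ?ltnS //; apply: NSD; rewrite ?ltnS //.
    by apply: nn; apply: exp_npos_neg.
  by rewrite !mulrDr -!scalerAr; Hmod hB.
- rewrite Nop_TS; last lia.
  exists (p *: T (alt t s j.+4) + (p *: T (alt t s j) + Z')).
    by apply: NSD; rewrite ?ltnS //; apply: NSD => //; lia.
  by rewrite !mulrDr -!scalerAr; Hmod hB.
Qed.

Lemma KLform_Nop0 h : (1 < d)%N -> KLform s t 0 h -> KLform s t 2 (Nop h).
Proof.
move=> d1 [Z nZ ->]; have [|Z' nZ' E] := NS_Nop _ nZ; first lia.
exists (vexp (- c s) *: T (alt t s 1) + (kap *: T (alt t s 0) + Z')).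
  by apply: NSD => //; apply: NSD => //; apply: kap_neg.
by rewrite [X in Nop X]mulrDr NopD E Nop_T0 // -mulrDr !addrA.
Qed.

Lemma KLform_Nop1 h : (2 < d)%N -> KLform s t 1 h -> KLform s t 3 (Nop h).
Proof.
move=> d2 [Z nZ ->]; have [|Z' nZ' E] := NS_Nop _ nZ; first lia.
exists (vexp (- c s) *: T (alt t s 0) + Z'); first by apply: NSD.
by rewrite [X in Nop X]mulrDr NopD E Nop_T1 // -mulrDr !addrA.
Qed.

Lemma KLform_NopS n h h' : (n.+3 < d)%N -> KLform s t n.+2 h -> KLform s t n h' ->
  KLform s t n.+4 (Nop h - h').
Proof.
move=> nd [Z nZ ->] [Z2 nZ2 ->]; have [|Z' nZ' E] := NS_Nop _ nZ; first lia.
exists (Z' - Z2).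
  by apply: NS_add => //; apply: NS_opp; apply: NS_leq nZ2; lia.
rewrite [X in Nop X]mulrDr NopD E Nop_TS // !mulrDr mulrN.
by Hmod hB.
Qed.

(** [Nop] is written with T_t and [kap] for computations in the basis T. Here it is expressed by
    C_s, C_t and the bar-invariant scalar [zet], which shows that it preserves bar-invariance
    ([bar_Nop]). *)
Lemma NopE n h : KLform s t n h -> Nop h = Cgen s * (Cgen t * h) - zet *: h.
Proof.
move=> hF; have -> : Cgen t * h = T t * h + qneg t *: h.
  by rewrite mulrDl -scalerAl mul1r.
by rewrite /Nop mulrDr -scalerAr (KLform_Cgen hF) /zet; Hmod hB.
Qed.

Lemma zetE : zet = if 0 < c t then vexp (c s - c t) + vexp (c t - c s) else 0.
Proof.
rewrite /zet /qneg /qsum /kap; case: ifPn => ct; first by rewrite !vexpD; ring.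
have -> : c t = 0 by apply/eqP; rewrite eq_le leNgt ct.
by rewrite mul0r subr0 !sub0r subrr oppr0.
Qed.

Lemma zet_bar : ebar zet = zet.
Proof.
rewrite zetE; case: ifP => _; last exact: ebar0.
by rewrite [LHS]raddfD /= !expliftE !opprB addrC.
Qed.

End Unequal.
End Gens.
End KLForm.

(** * Products of C_s and C_t with the Kazhdan-Lusztig basis *)

Section KLRules.
Variables (R : realType) (gT : finGroupType) (d : nat).
Variables (c : gT -> R) (H : algType (expring R)) (T : gT -> H).
Variables (bar : {rmorphism H -> H}) (hbar : is_bar_involution T bar).
Variables (C : gT -> H) (hC : is_KL_basis T bar C).
Implicit Types (s t x y : gT) (h : H).
Local Notation Cg := (Cgen c T).

Lemma bar_Cgen s t (D : dihedral d s t) (hT : is_Hecke_algebra [set s; t] c T) :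
  0 <= c s -> bar (Cg s) = Cg s.
Proof.
move=> cs0; have hB := Hecke_basis hT.
rewrite rmorphD (bar_Ts D hT hbar); last by left.
rewrite (bar_scale hbar) rmorph1 /Cgen /qneg; case: ltrP => cs.
  by rewrite ebarU opprK /qdiff; Hmod hB.
have c0 : c s = 0 by apply/eqP; rewrite eq_le cs cs0.
by rewrite ebar0 /qdiff c0 oppr0; Hmod hB.
Qed.

Lemma KL1 s t (D : dihedral d s t) (hT : is_Hecke_algebra [set s; t] c T) :
  C 1%g = 1.
Proof.
apply/esym/(KL_uniq D hT hbar hC); first by rewrite rmorph1.
by rewrite (Hecke_T1 D hT) subrr; apply: (Neg0 hT).
Qed.

Lemma KLgen s t (D : dihedral d s t) (hT : is_Hecke_algebra [set s; t] c T) :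
  0 <= c s -> C s = Cg s.
Proof.
move=> cs0; apply/esym/(KL_uniq D hT hbar hC); first exact: (bar_Cgen D hT).
rewrite /Cgen addrAC subrr add0r -(Hecke_T1 D hT); apply: (NegT hT).
rewrite /qneg; case: ltrP => cs; last exact: exp_neg0.
by apply: exp_negU; rewrite oppr_lt0.
Qed.

Lemma KLeq_step s t (D : dihedral d s t) (hT : is_Hecke_algebra [set s; t] c T) n :
  0 < c s -> c t = c s -> (n.+2 < d)%N ->
  KLform c T s t n.+1 (C (alt s t n.+2)) -> KLform c T t s n (C (alt t s n.+1)) ->
  Cg t * C (alt s t n.+2) = C (alt t s n.+3) + C (alt t s n.+1) /\
  KLform c T t s n.+2 (C (alt t s n.+3)).
Proof.
move=> cs0 cts nd F1 F2; have ct0 : 0 < c t by rewrite cts.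
have F3 := KLform_eq D hT cs0 ct0 cts nd F1 F2.
have E : Cg t * C (alt s t n.+2) - C (alt t s n.+1) = C (alt t s n.+3).
  apply: (KLformP (dihedral_sym D) (is_Hecke_sym hT) hbar hC ct0 nd _ F3).
  rewrite rmorphB rmorphM !(KL_bar hC).
  by rewrite (bar_Cgen (dihedral_sym D) (is_Hecke_sym hT) (ltW ct0)).
by rewrite -E; split=> //; rewrite subrK.
Qed.

Lemma KLgen_form s t (D : dihedral d s t)
    (hT : is_Hecke_algebra [set s; t] c T) :
  0 < c s -> KLform c T s t 0 (C (alt s t 1)).
Proof.
by move=> cs0; rewrite /= mulg1 (KLgen D hT (ltW cs0)); apply: (KLform0 D hT).
Qed.

Lemma KLeq_step1 s t (D : dihedral d s t) (hT : is_Hecke_algebra [set s; t] c T) :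
  0 < c s -> c t = c s -> (1 < d)%N ->
  Cg t * C (alt s t 1) = C (alt t s 2) /\ KLform c T t s 1 (C (alt t s 2)).
Proof.
move=> cs0 cts d1; have ct0 : 0 < c t by rewrite cts.
have F : KLform c T t s 1 (Cg t * C (alt s t 1)).
  apply: (KLform_eq0 D hT cs0 ct0 d1); last by rewrite cts.
  exact: (KLgen_form D hT).
have E : Cg t * C (alt s t 1) = C (alt t s 2).
  apply: (KLformP (dihedral_sym D) (is_Hecke_sym hT) hbar hC ct0 d1) F.
  rewrite rmorphM (KL_bar hC).
  by rewrite (bar_Cgen (dihedral_sym D) (is_Hecke_sym hT) (ltW ct0)).
by rewrite -E.
Qed.

Section Rules.
Variables (s t : gT) (D : dihedral d s t) (hT : is_Hecke_algebra [set s; t] c T).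
Hypothesis cs0 : 0 < c s.
Let D' := dihedral_sym D.
Let hT' := is_Hecke_sym hT.
Let hB := Hecke_basis hT.

Lemma KLform_KLeq n : c t = c s -> (n < d)%N ->
  KLform c T s t n (C (alt s t n.+1)) /\ KLform c T t s n (C (alt t s n.+1)).
Proof.
move=> cts; have ct0 : 0 < c t by rewrite cts.
suff: ((n < d)%N -> KLform c T s t n (C (alt s t n.+1)) /\
                    KLform c T t s n (C (alt t s n.+1))) /\
      ((n.+1 < d)%N -> KLform c T s t n.+1 (C (alt s t n.+2)) /\
                       KLform c T t s n.+1 (C (alt t s n.+2))) by case.
elim: n => [|n [IH1 IH2]].
  split=> d1; first by split; [apply: (KLgen_form D hT) | apply: (KLgen_form D' hT')].
  by have [_ ?] := KLeq_step1 D hT cs0 cts d1; have [_ ?] := KLeq_step1 D' hT' ct0 (esym cts) d1.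
split=> // nd; have [F1 F2] := IH1 (ltnW (ltnW nd)); have [F3 F4] := IH2 (ltnW nd).
have [_ ?] := KLeq_step D hT cs0 cts nd F3 F2.
by have [_ ?] := KLeq_step D' hT' ct0 (esym cts) nd F4 F1.
Qed.

Lemma KLeq_mul n : c t = c s -> (n.+2 < d)%N ->
  Cg t * C (alt s t n.+2) = C (alt t s n.+3) + C (alt t s n.+1).
Proof.
move=> cts nd; have [F1 _] := KLform_KLeq cts (ltnW nd).
have [_ F2] := KLform_KLeq cts (ltnW (ltnW nd)).
by have [] := KLeq_step D hT cs0 cts nd F1 F2.
Qed.

Hypotheses (ct0 : 0 <= c t) (cts : c t < c s).

Lemma bar_Nop n h : KLform c T s t n h -> bar h = h ->
  bar (Nop c T s t h) = Nop c T s t h.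
Proof.
move=> F bh; rewrite (NopE D hT cs0 F) rmorphB !rmorphM (bar_scale hbar) bh.
by rewrite (bar_Cgen D hT (ltW cs0)) (bar_Cgen D' hT' ct0) (zet_bar s ct0).
Qed.

Let KLf n := KLform c T s t n (C (alt s t n.+1)).

Lemma KLne_form2 : (1 < d)%N ->
  Cg s * C (alt t s 1) = C (alt s t 2) /\ KLf 1.
Proof.
move=> d1; have F : KLform c T s t 1 (Cg s * C (alt t s 1)).
  rewrite /= mulg1 (KLgen D' hT' ct0); exists (qneg c t *: T (alt t s 0)).
    apply: NS_T => //; rewrite /qneg; case: ltrP => ct; last exact: exp_neg0.
    by apply: exp_negU; rewrite oppr_lt0.
  by rewrite /= mulg1 (Hecke_T1 D hT).
have E : Cg s * C (alt t s 1) = C (alt s t 2).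
  apply: (KLformP D hT hbar hC cs0 d1) F.
  by rewrite rmorphM (KL_bar hC) (bar_Cgen D hT (ltW cs0)).
by rewrite /KLf -E.
Qed.

Lemma KLne_Nop0 : (2 < d)%N -> Nop c T s t (C (alt s t 1)) = C (alt s t 3) /\ KLf 2.
Proof.
move=> d2; have F0 := KLgen_form D hT cs0.
have F := KLform_Nop0 D hT cs0 ct0 cts (ltnW d2) F0.
have E : Nop c T s t (C (alt s t 1)) = C (alt s t 3).
  by apply: (KLformP D hT hbar hC cs0 d2) F; apply: (bar_Nop F0); rewrite (KL_bar hC).
by rewrite /KLf -E.
Qed.

Lemma KLne_Nop1 : (3 < d)%N -> Nop c T s t (C (alt s t 2)) = C (alt s t 4) /\ KLf 3.
Proof.
move=> d2; have [_ F0] := KLne_form2 (ltnW (ltnW d2)).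
have F := KLform_Nop1 D hT cs0 ct0 cts (ltnW d2) F0.
have E : Nop c T s t (C (alt s t 2)) = C (alt s t 4).
  by apply: (KLformP D hT hbar hC cs0 d2) F; apply: (bar_Nop F0); rewrite (KL_bar hC).
by rewrite /KLf -E.
Qed.

Lemma KLne_NopS n : (n.+4 < d)%N -> KLf n -> KLf n.+2 ->
  Nop c T s t (C (alt s t n.+3)) = C (alt s t n.+4.+1) + C (alt s t n.+1) /\ KLf n.+4.
Proof.
move=> d2 F0 F2.
have F := KLform_NopS D hT cs0 ct0 cts (ltnW d2) F2 F0.
have E : Nop c T s t (C (alt s t n.+3)) - C (alt s t n.+1) = C (alt s t n.+4.+1).
  apply: (KLformP D hT hbar hC cs0 d2) F.
  by rewrite rmorphB (bar_Nop F2) !(KL_bar hC).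
by rewrite /KLf -E subrK.
Qed.

Lemma KLform_KLne n : (n < d)%N -> KLf n.
Proof.
(* [KLne_NopS] reaches n + 4 from n and n + 2, so four consecutive values are carried along. *)
suff: [/\ (n < d)%N -> KLf n, (n.+1 < d)%N -> KLf n.+1, (n.+2 < d)%N -> KLf n.+2 &
      (n.+3 < d)%N -> KLf n.+3] by case.
elim: n => [|n [I0 I1 I2 I3]].
  split=> d1; [exact: (KLgen_form D hT)|by case: (KLne_form2 d1)|
    by case: (KLne_Nop0 d1)|by case: (KLne_Nop1 d1)].
by split=> // d1; case: (KLne_NopS d1); [apply: I0; lia | apply: I2; lia |].
Qed.

Lemma KLne_mult0 : Cg t * C (alt s t 0) = C (alt t s 1).
Proof. by rewrite /= mulg1 (KL1 D hT) mulr1 (KLgen D' hT'). Qed.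

(** For c_t > 0 this is [KLform_lt]. For c_t = 0 the factor C_t is T_t with T_t^2 = 1; it permutes
    the T_w, so negative coefficients stay negative. *)
Lemma KLne_mult n : (n.+1 < d)%N -> Cg t * C (alt s t n.+1) = C (alt t s n.+2).
Proof.
move=> nd; have F := KLform_KLne (ltnW nd).
have bE : bar (Cg t * C (alt s t n.+1)) = Cg t * C (alt s t n.+1).
  by rewrite rmorphM (KL_bar hC) (bar_Cgen D' hT').
case: (ltrP 0 (c t)) => ct.
  apply: (KLformP D' hT' hbar hC ct nd) => //.
  exact: (KLform_lt D hT).
have {ct}ct : c t = 0 by apply/eqP; rewrite eq_le ct ct0.
have -> : Cg t = T t by rewrite /Cgen /qneg ct ltxx scale0r addr0.
have q0 : qdiff c t = 0 by rewrite /qdiff ct oppr0 subrr.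
have nqs : exp_neg (vexp (- c s)) by apply: exp_negU; rewrite oppr_lt0.
have TT j : (j < d)%N -> Neg T (vexp (- c s) *: (T t * T (alt t s j))).
  case: j => [|j] jd.
    have E := Hecke_altS D' hT' jd; rewrite -[alt t s 0]/(alt s t 0) E.
    exact: (NegT hT).
  by rewrite (Hecke_alt_sq D' hT' (ltnW jd)) q0 scale0r addr0; apply: (NegT hT).
apply: (KL_uniq D hT hbar hC).
  rewrite rmorphM (KL_bar hC) (bar_Ts D hT hbar); last by right.
  by rewrite q0 scale0r subr0.
have NZ : forall Z, NS T t s n Z -> Neg T (T t * (Cg s * Z)).
  move=> Z; elim=> [|p j Z1 jn np _ IH]; first by rewrite !mulr0; apply: (Neg0 hT).
  rewrite !mulrDr -!scalerAr; apply: (NegD hT) => //.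
  rewrite (Cgen_T D hT cs0); last lia.
  rewrite mulrDr (Hecke_altS D' hT'); last lia.
  rewrite scalerDr; apply: (NegD hT); first exact: (NegT hT).
  rewrite -scalerAr; move: (TT j) => /(_ _) NT z; rewrite coordsZ //; apply: exp_negM.
    by apply: NT; lia.
  exact: exp_npos_neg.
case: F => Z nZ ->; rewrite mulrDr (Cgen_T D hT cs0 (ltnW nd)).
rewrite !mulrDr (Hecke_altS D' hT' nd) -scalerAr.
set a1 := T (alt t s n.+2); set a2 := _ *: _; set a3 := _ * _.
have -> : a1 + a2 + a3 - a1 = a2 + a3 by rewrite addrC !addrA addNr add0r.
by apply: (NegD hT); [apply: TT; apply: ltnW | apply: NZ].
Qed.

Lemma KLne_mulsE n : (n < d)%N ->
  Cg s * (Cg t * C (alt s t n.+1)) =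
  Nop c T s t (C (alt s t n.+1)) + zet c s t *: C (alt s t n.+1).
Proof. by move=> nd; rewrite (NopE D hT cs0 (KLform_KLne nd)) subrK. Qed.

Lemma KLne_muls1 : (1 < d)%N -> Cg s * C (alt t s 1) = C (alt s t 2).
Proof. by case/KLne_form2. Qed.

Lemma KLne_muls2 : (2 < d)%N ->
  Cg s * C (alt t s 2) = C (alt s t 3) + zet c s t *: C (alt s t 1).
Proof.
move=> d2; rewrite -(KLne_mult (ltnW d2)) KLne_mulsE ?(ltnW (ltnW d2)) //.
by case: (KLne_Nop0 d2) => ->.
Qed.

Lemma KLne_muls3 : (3 < d)%N ->
  Cg s * C (alt t s 3) = C (alt s t 4) + zet c s t *: C (alt s t 2).
Proof.
move=> d2; rewrite -(KLne_mult (ltnW d2)) KLne_mulsE ?(ltnW (ltnW d2)) //.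
by case: (KLne_Nop1 d2) => ->.
Qed.

Lemma KLne_mulsS n : (n.+4 < d)%N ->
  Cg s * C (alt t s n.+4) =
  C (alt s t n.+4.+1) + C (alt s t n.+1) + zet c s t *: C (alt s t n.+3).
Proof.
move=> d2; rewrite -(KLne_mult (ltnW d2)) KLne_mulsE ?(ltnW (ltnW d2)) //.
by case: (KLne_NopS d2 (KLform_KLne _) (KLform_KLne _)) => [||-> _ //]; lia.
Qed.

Lemma KLsq n : (n < d)%N -> KLform c T s t n (C (alt s t n.+1)) ->
  Cg s * C (alt s t n.+1) = qsum c s *: C (alt s t n.+1).
Proof. by move=> _ /(KLform_Cgen D hT cs0). Qed.

End Rules.
End KLRules.

(** * Left cells *)

Section Cells.
Variables (R : realType) (gT : finGroupType) (d : nat).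
Variables (c : gT -> R) (H : algType (expring R)) (T : gT -> H).
Variables (bar : {rmorphism H -> H}) (hbar : is_bar_involution T bar).
Variables (C : gT -> H) (hC : is_KL_basis T bar C).
Variables (s t : gT) (D : dihedral d s t) (hT : is_Hecke_algebra [set s; t] c T).
Implicit Types (x y z w : gT) (g h : H) (X : gT -> Prop).
Local Notation Cg := (Cgen c T).
Let D' := dihedral_sym D.
Let hT' := is_Hecke_sym hT.
Let hB := Hecke_basis hT.
Let cB := KL_basis hC.

Lemma Hecke_gen_mul u y : u = s \/ u = t ->
  exists2 p : expring R, edeg p = 0 & T u * T y = T (u * y)%g + p *: T y.
Proof.
have q0 v : edeg (qdiff c v) = 0 by rewrite raddfB /= !edegU subrr.
have key a b (E : dihedral d a b) (hE : is_Hecke_algebra [set a; b] c T) n :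
    (n <= d)%N ->
    (exists2 p : expring R, edeg p = 0 &
       T a * T (alt a b n) = T (a * alt a b n)%g + p *: T (alt a b n)) /\
    (exists2 p : expring R, edeg p = 0 &
       T b * T (alt a b n) = T (b * alt a b n)%g + p *: T (alt a b n)).
  move=> nd; split.
    case: n nd => [|n] nd.
      by exists 0; rewrite ?raddf0 // scale0r addr0 mulg1 /= (Hecke_T1 E hE) mulr1.
    by exists (qdiff c a) => //; rewrite (Hecke_alt_sq E hE nd) (dih_altK E).
  move: nd; rewrite leq_eqVlt => /orP[/eqP->|nd].
    exists (qdiff c b) => //; rewrite (dih_braid E).
    have d0 := dih_gt0 E.
    have -> : alt b a d = alt b a d.-1.+1 by rewrite prednK.
    have E' := dihedral_sym E; have d1 : (d.-1 < d)%N by rewrite prednK.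
    by rewrite (Hecke_alt_sq E' (is_Hecke_sym hE) d1) (dih_altK E').
  exists 0; rewrite ?raddf0 // scale0r addr0.
  by rewrite (Hecke_altS (dihedral_sym E) (is_Hecke_sym hE) nd).
move=> ust; have [n nd yn] := wordP D y.
have [k1 k2] := key s t D hT n nd; have [k3 k4] := key t s D' hT' n nd.
by case: ust yn => -> [] ->.
Qed.

Section Upper.
Variable X : gT -> Prop.
Definition spX h := forall z, coords C h z <> 0 -> X z.

Lemma spXD h g : spX h -> spX g -> spX (h + g).
Proof.
move=> Xh Xg z; rewrite coordsD // => N.
have [h0|/eqP /Xh //] := eqVneq (coords C h z) 0.
by apply: Xg; move: N; rewrite h0 add0r.
Qed.

Lemma spXZ p h : spX h -> spX (p *: h).
Proof. by move=> Xh z; rewrite coordsZ // => N; apply: Xh => h0; rewrite h0 mulr0 in N. Qed.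

Lemma spX_sum (I : Type) (r : seq I) (P : pred I) (F : I -> H) :
  (forall i, P i -> spX (F i)) -> spX (\sum_(i <- r | P i) F i).
Proof.
move=> L; elim/big_rec: _ => [z|i h Pi]; first by rewrite coords0.
by apply: spXD; apply: L.
Qed.

Lemma spXC w : X w -> spX (C w).
Proof. by move=> Xw z; rewrite coords_basis //; case: eqP => [->|]. Qed.

(** The C_y with y in X then span a left ideal. For [KL_le] such a set is closed downwards
    ([le_upper]), x being below y when C_x occurs in a multiple of C_y. *)
Definition upper := forall y, X y -> spX (Cg s * C y) /\ spX (Cg t * C y).

Lemma spX_mul h g : upper -> spX h -> spX (g * h).
Proof.
move=> up Xh; have TX u : u = s \/ u = t -> forall h, spX h -> spX (T u * h).
  move=> ust {h Xh} h Xh.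
  have CX : spX (Cg u * h).
    rewrite [h](coords_sumE cB) mulr_sumr; apply: spX_sum => y _.
    have [->|/eqP N] := eqVneq (coords C h y) 0.
      by rewrite scale0r mulr0 => z; rewrite coords0.
    rewrite -scalerAr; apply: spXZ; have [] := up y (Xh _ N).
    by case: ust => ->.
  have -> : T u * h = Cg u * h + (- qneg c u) *: h.
    by rewrite mulrDl -scalerAl mul1r scaleNr addrK.
  by apply: spXD => //; apply: spXZ.
have altX n : (n <= d)%N -> (forall h, spX h -> spX (T (alt s t n) * h)) /\
    (forall h, spX h -> spX (T (alt t s n) * h)).
  elim: n => [|n IHn] nd.
    by rewrite /= (Hecke_T1 D hT); split=> h' Xh'; rewrite mul1r.
  have [I1 I2] := IHn (ltnW nd).
  rewrite -(Hecke_altS D hT nd) -(Hecke_altS D' hT' nd).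
  by split=> h' Xh'; rewrite -mulrA; apply: TX; auto.
rewrite [g](coords_sumE hB) mulr_suml; apply: spX_sum => w _.
rewrite -scalerAl; apply: spXZ; have [n nd] := wordP D w.
by have [k1 k2] := altX n nd; case=> ->; auto.
Qed.

Lemma le_upper x y : upper -> KL_le C x y -> X y -> X x.
Proof.
move=> up; elim=> [u v [h N]|//|u v w _ IH1 _ IH2] Xv; last by auto.
exact: (spX_mul up (spXC Xv) N).
Qed.

End Upper.

Lemma le_step h x y : coords C (h * C y) x <> 0 -> KL_le C x y.
Proof. by move=> N; apply: rt_step; exists h. Qed.

Lemma KL_refl x : KL_le C x x. Proof. exact: rt_refl. Qed.
Lemma KL_trans x y z : KL_le C x y -> KL_le C y z -> KL_le C x z.
Proof. exact: rt_trans. Qed.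

Definition KL_eqv x y := KL_le C x y /\ KL_le C y x.
Definition KL_class w : {set gT} := [set x | `[< KL_eqv x w >]].

Lemma left_cellE Gamma : is_left_cell C Gamma <-> exists w, Gamma = KL_class w.
Proof.
split=> [[w wP]|[w ->]]; exists w.
  apply/setP=> x; rewrite inE; apply/idP/asboolP; first by move/wP.
  by move=> ?; apply/wP.
by move=> x; rewrite inE; split=> [/asboolP//|?]; apply/asboolP.
Qed.

Definition KL_M x z w : int := edeg (coords C (T x * C w) z).

Definition KL_char (Gamma : {set gT}) x : R[i] := \sum_(w in Gamma) (KL_M x w w)%:~R.

Lemma KL_cellularE gamma :
  KL_cellular T C gamma <-> exists w, gamma = KL_char (KL_class w).
Proof.
have trE Gamma : (fun x => \tr (cell_mx T C Gamma x)) = KL_char Gamma.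
  apply/funext=> x; rewrite /mxtrace /KL_char.
  rewrite [RHS]big_enum_val /=.
  by apply: eq_bigr => i _; rewrite mxE.
split=> [[G [/left_cellE[w ->] ->]]|[w ->]]; first by exists w; rewrite trE.
by exists (KL_class w); rewrite trE; split=> //; apply/left_cellE; exists w.
Qed.

Lemma coords_mulr b (bB : is_basis b) h g z :
  coords b (h * g) z = \sum_w coords b g w * coords b (h * b w) z.
Proof.
rewrite {1}[g](coords_sumE bB) mulr_sumr coords_sum //.
by apply: eq_bigr => w _; rewrite -scalerAr coordsZ.
Qed.

(** The kernel of the specialisation at v = 1; modulo it H becomes the group ring, by [null_TT]. *)
Definition null h := forall z, edeg (coords T h z) = 0.

Lemma nullD h g : null h -> null g -> null (h + g).
Proof. by move=> nh ng z; rewrite coordsD // raddfD /= nh ng addr0. Qed.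

Lemma nullT p z : edeg p = 0 -> null (p *: T z).
Proof. by move=> np y; rewrite coordsZ // rmorphM /= np mul0r. Qed.

Lemma null_coords b (bB : is_basis b) h g z : null h -> edeg (coords b (h * g) z) = 0.
Proof.
move=> nh; rewrite [h](coords_sumE hB) mulr_suml coords_sum // raddf_sum big1 //= => w _.
by rewrite -scalerAl coordsZ // rmorphM /= nh mul0r.
Qed.

Lemma null_mull g h : null h -> null (g * h).
Proof.
move=> nh z; rewrite (coords_mulr hB) raddf_sum big1 //= => w _.
by rewrite rmorphM /= nh mul0r.
Qed.

Lemma null_TT x y : null (T x * T y - T (x * y)%g).
Proof.
move: x; apply: (dih_ind D).
- by rewrite mul1g (Hecke_T1 D hT) mul1r subrr => z; rewrite coords0 ?raddf0.
- move=> x IH; have [p p0 E] := Hecke_gen_mul x (or_introl (erefl s)).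
  have [q qq0 E2] := Hecke_gen_mul (x * y)%g (or_introl (erefl s)).
  have -> : T (s * x)%g * T y - T (s * x * y)%g =
     T s * (T x * T y - T (x * y)%g) + (q *: T (x * y)%g + (- p) *: (T x * T y)).
    rewrite mulrBr mulrA E E2 mulrDl -scalerAl mulgA; Hmod hB.
  apply: nullD; first exact: null_mull.
  apply: nullD; first exact: nullT.
  by move=> z; rewrite coordsZ // rmorphM raddfN /= p0 oppr0 mul0r.
- move=> x IH; have [p p0 E] := Hecke_gen_mul x (or_intror (erefl t)).
  have [q qq0 E2] := Hecke_gen_mul (x * y)%g (or_intror (erefl t)).
  have -> : T (t * x)%g * T y - T (t * x * y)%g =
     T t * (T x * T y - T (x * y)%g) + (q *: T (x * y)%g + (- p) *: (T x * T y)).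
    rewrite mulrBr mulrA E E2 mulrDl -scalerAl mulgA; Hmod hB.
  apply: nullD; first exact: null_mull.
  apply: nullD; first exact: nullT.
  by move=> z; rewrite coordsZ // rmorphM raddfN /= p0 oppr0 mul0r.
Qed.

Lemma edeg_TT x y z : edeg (coords T (T x * T y) z) = (z == x * y)%g%:R.
Proof.
have := null_TT x y z; rewrite coordsB // raddfB /= => /eqP; rewrite subr_eq0 => /eqP->.
by rewrite coords_basis //; case: eqP => _; rewrite ?rmorph1 ?rmorph0.
Qed.

Lemma KL_MM x y z w : KL_M (x * y)%g z w = \sum_v KL_M x z v * KL_M y v w.
Proof.
have -> : KL_M (x * y)%g z w = edeg (coords C (T x * (T y * C w)) z).
  apply/esym/eqP; rewrite -subr_eq0 -raddfB -coordsB //= mulrA -mulrBl.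
  by rewrite null_coords //; apply: null_TT.
rewrite (coords_mulr cB) raddf_sum; apply: eq_bigr => v _ /=.
by rewrite rmorphM mulrC.
Qed.

Lemma KL_M1 z w : KL_M 1%g z w = (z == w)%:R.
Proof.
by rewrite /KL_M (Hecke_T1 D hT) mul1r coords_basis //; case: eqP => _; rewrite ?rmorph1 ?rmorph0.
Qed.

(** A non-zero term with index v forces z <= v <= z' for the left preorder, so v stays in the cell:
    the diagonal block of a cell is multiplicative by itself. *)
Lemma KL_M_cell x y w0 z z' : z \in KL_class w0 -> z' \in KL_class w0 ->
  KL_M (x * y)%g z z' = \sum_(v in KL_class w0) KL_M x z v * KL_M y v z'.
Proof.
have cl v : v \in KL_class w0 -> KL_eqv v w0 by rewrite inE => /asboolP.
move=> /cl[zw wz] /cl[z'w wz']; rewrite KL_MM [RHS]big_mkcond; apply: eq_bigr => v _; rewrite inE.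
case: asboolP => // Nv.
have [->|/eqP N1] := eqVneq (KL_M x z v) 0; first by rewrite mul0r.
have [->|/eqP N2] := eqVneq (KL_M y v z') 0; first by rewrite mulr0.
case: Nv; split.
  apply: KL_trans z'w; apply: (@le_step (T y)) => E.
  by rewrite /KL_M E raddf0 in N2.
apply: KL_trans wz _; apply: (@le_step (T x)) => E.
by rewrite /KL_M E raddf0 in N1.
Qed.

Lemma KL_char_setT x : KL_char [set: gT] x = ((#|gT| * (x == 1%g))%N)%:R.
Proof.
rewrite /KL_char (eq_bigl predT) => [|w]; last by rewrite inE.
rewrite -rmorph_sum /= -raddf_sum /=.
have lin b (bB : is_basis b) : forall a : gT -> expring R,
   T x * (\sum_w a w *: b w) = \sum_w a w *: (T x * b w).
  by move=> a; rewrite mulr_sumr; apply: eq_bigr => w _; rewrite -scalerAr.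
rewrite (trace_basis cB hB (f := fun h => T x * h)) //; last 1 first.
  by move=> a b; rewrite mulr_sumr; apply: eq_bigr => w _; rewrite -scalerAr.
rewrite raddf_sum /= (eq_bigr (fun w => ((x == 1%g)%:R : int))) => [|w _].
  by rewrite sumr_const rmorphMn /= natrM rmorph_nat -mulr_natl.
by rewrite edeg_TT eq_sym -{2}[w]mul1g (inj_eq (mulIg w)).
Qed.

Section Ind.
Variable E : {set gT}.
Hypothesis cs0 : 0 < c s.
Hypothesis E_up : upper (fun x => x \in E).
Hypothesis E_s : s \in E.
Hypothesis E_r : forall w, w \in E -> exists h, C w = h * Cg s.

(** The hypotheses say that the C_w with w in E span H C_s. Right multiplication by C_s maps H into
    this ideal and becomes the scalar 2 on it, so the left-hand side is the trace of h -> T_x h C_s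
    at v = 1; the right-hand side is the same trace in the basis T. The character obtained is
    induced from the trivial character of {1, s}. *)
Lemma KL_char_ind x : KL_char E x *+ 2 =
  ((#|gT| * (x == 1%g))%N)%:R + (#|[set w | (x * w * s)%g == w]|)%:R.
Proof.
have trE : \sum_w edeg (coords C (T x * (C w * Cg s)) w) =
           \sum_w edeg (coords T (T x * (T w * Cg s)) w).
  rewrite -!raddf_sum /=; congr edeg.
  apply: (trace_basis cB hB (f := fun h => T x * (h * Cg s))).
  move=> a b; rewrite mulr_suml mulr_sumr; apply: eq_bigr => w _.
  by rewrite -scalerAl -scalerAr.
have <- : (\sum_w edeg (coords C (T x * (C w * Cg s)) w))%:~R = KL_char E x *+ 2.
  rewrite (bigID (fun w => w \in E)) /= [X in _ + X]big1 => [|w wE].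
    rewrite addr0 rmorph_sum /= /KL_char -sumrMnl; apply: eq_bigr => w wE.
    have [h hw] := E_r wE.
    have -> : C w * Cg s = qsum c s *: C w.
      by rewrite {1}hw -mulrA (Cgen_sq D hT cs0) -scalerAr -hw.
    rewrite -scalerAr coordsZ // rmorphM /= raddfD /= !edegU.
    by rewrite -[1 + 1]/(2%:R) mulr_natl rmorphMn.
  (* The image of C_w lies in the span of the C_y with y in E, so for w outside E the diagonal
     coordinate is 0. *)
  apply/eqP/negPn/negP=> N; case/negP: wE.
  have sE : spX (fun x => x \in E) (Cg s).
    by rewrite -(KLgen hbar hC D hT (ltW cs0)); apply: spXC.
  have K : spX (fun x => x \in E) (T x * (C w * Cg s)).
    by apply: spX_mul => //; apply: spX_mul.
  apply: K => Z.
  by rewrite Z raddf0 eqxx in N.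
rewrite trE -sum1_card natr_sum.
have -> : (#|gT| * (x == 1%g))%N%:R = \sum_(w : gT) (x == 1%g)%:R :> R[i].
  by rewrite sumr_const natrM mulr_natl.
rewrite [X in _ = _ + X]big_mkcond -big_split rmorph_sum; apply: eq_bigr => w _ /=.
have -> : T x * (T w * Cg s) = T x * (T w * T s) + qneg c s *: (T x * T w).
  by rewrite /Cgen !mulrDr -!scalerAr mulr1.
rewrite coordsD // coordsZ // raddfD /= rmorphM /= edeg_TT.
have -> : edeg (qneg c s) = 1 by rewrite /qneg cs0 edegU.
have -> : edeg (coords T (T x * (T w * T s)) w) = (w == x * w * s)%g%:R.
  rewrite mulrA -[T x * T w](subrK (T (x * w)%g)) mulrDl coordsD // raddfD /=.
  by rewrite (null_coords hB) ?add0r ?edeg_TT //; apply: null_TT.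
rewrite mul1r inE addrC rmorphD /= !rmorph_nat; congr (_ + _).
  by rewrite eq_sym; case: (_ == _).
by rewrite eq_sym -{2}[w]mul1g (inj_eq (mulIg w)).
Qed.

End Ind.
End Cells.

(** * The list of cellular characters *)

Section LinearCharacters.
Variables (R : realType) (gT : finGroupType) (d : nat) (s t : gT).
Implicit Types (x y : gT) (e : gT -> bool).

Definition is_lin (p q : bool) e : Prop :=
  [/\ forall x y, e (x * y)%g = e x (+) e y, e s = p & e t = q].

(* 0 if there is no linear character with these signs *)
Definition lin_char (p q : bool) x : R[i] :=
  if pselect (exists e, is_lin p q e) is left ex then (-1) ^+ (sval (cid ex) x)
  else 0.

Hypothesis D : dihedral d s t.

Lemma is_lin_inj p q e e' : is_lin p q e -> is_lin p q e' -> e =1 e'.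
Proof.
move=> [eM es et] [eM' es' et'] x.
have e1 f : (forall x y, f (x * y)%g = f x (+) f y) -> f 1%g = false.
  by move=> fM; have := fM 1%g 1%g; rewrite mulg1; case: (f 1%g).
move: x; apply: (dih_ind D) => [|x IH|x IH]; first by rewrite !e1.
  by rewrite eM eM' es es' IH.
by rewrite eM eM' et et' IH.
Qed.

Lemma lin_charE p q e x : is_lin p q e -> lin_char p q x = (-1) ^+ (e x).
Proof.
move=> le; rewrite /lin_char; case: pselect => [ex|[]]; last by exists e.
by rewrite (is_lin_inj (svalP (cid ex)) le).
Qed.

Lemma lin_char0 p q x : ~ (exists e, is_lin p q e) -> lin_char p q x = 0.
Proof. by move=> N; rewrite /lin_char; case: pselect. Qed.

Lemma is_linD p q p' q' e e' : is_lin p q e -> is_lin p' q' e' ->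
  is_lin (p (+) p') (q (+) q') (fun x => e x (+) e' x).
Proof.
move=> [eM es et] [eM' es' et']; split=> [x y||]; rewrite ?es ?es' ?et ?et' //.
by rewrite eM eM' !addbA; congr (_ (+) _); rewrite -!addbA; congr (_ (+) _); rewrite addbC.
Qed.

Lemma lin_charP (p q : bool) (f : gT -> R[i]) : f 1%g = 1 ->
  (forall x, f (s * x)%g = (-1) ^+ p * f x) ->
  (forall x, f (t * x)%g = (-1) ^+ q * f x) ->
  (exists e, is_lin p q e) /\ f = lin_char p q.
Proof.
move=> f1 fs ft; pose e x := f x != 1.
have N1 : (-1 : R[i]) != 1.
  by rewrite eq_sym -subr_eq0 opprK -[1 + 1]/(2%:R) pnatr_eq0.
have fE x : f x = (-1) ^+ (e x).
  have : f x = 1 \/ f x = -1.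
    move: x; apply: (dih_ind D) => [|x IH|x IH]; first by left.
      by rewrite fs; case: (p); case: IH => ->;
        rewrite ?expr0 ?expr1 ?mul1r ?mulrNN ?mul1r ?mulr1; auto.
    by rewrite ft; case: (q); case: IH => ->;
      rewrite ?expr0 ?expr1 ?mul1r ?mulrNN ?mul1r ?mulr1; auto.
  by rewrite /e; case=> ->; rewrite ?eqxx ?N1.
have fM x y : f (x * y)%g = f x * f y.
  move: x; apply: (dih_ind D) => [|x IH|x IH]; first by rewrite mul1g f1 mul1r.
    by rewrite -mulgA !fs IH mulrA.
  by rewrite -mulgA !ft IH mulrA.
have sgn_inj (b b' : bool) : (-1 : R[i]) ^+ b = (-1) ^+ b' -> b = b'.
  by case: b; case: b' => //= /eqP; rewrite expr0 expr1 ?[1 == _]eq_sym (negbTE N1).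
have le : is_lin p q e.
  split=> [x y||]; apply: sgn_inj; rewrite -?signr_addb -?fE //.
    by rewrite fM !fE signr_addb.
    by rewrite -[s]mulg1 fs f1 mulr1.
  by rewrite -[t]mulg1 ft f1 mulr1.
split; first by exists e.
by apply/funext=> x; rewrite (lin_charE _ le) fE.
Qed.

Lemma card_dih_gt1 p : ~ (exists e, is_lin p (~~ p) e) \/ (1 < d)%N.
Proof.
case: (ltnP 1 d) => [|d1]; [by right | left=> -[e [_ es et]]].
have d1' : d = 1%N by have := dih_gt0 D; lia.
have := dih_braid D; rewrite d1' /= !mulg1 => E.
by move: et; rewrite -E es; case: (p).
Qed.

Definition reg_char x : R[i] := ((#|gT| * (x == 1%g))%N)%:R.

Definition sum_lin x : R[i] := \sum_(pq : bool * bool) lin_char pq.1 pq.2 x.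

(* The sum of the irreducible characters of degree 2 (see [sum_deg2]) *)
Definition chi2 x : R[i] := (reg_char x - sum_lin x) / 2%:R.

Lemma sum_linE x : sum_lin x = lin_char false false x + lin_char false true x +
  lin_char true false x + lin_char true true x.
Proof.
rewrite /sum_lin -(pair_big xpredT xpredT (fun p q => lin_char p q x)) /=.
by rewrite !big_bool /= !addrA; ring.
Qed.

Definition lin_ex (p q : bool) : Prop := exists e, is_lin p q e.

Definition wt (a b : R) (p q : bool) : R := (-1) ^+ p * a + (-1) ^+ q * b.

Definition same_wt (a b : R) (p q p' q' : bool) : bool :=
  ((-1) ^+ p' * a == (-1) ^+ p * a) && ((-1) ^+ q' * b == (-1) ^+ q * b).

Definition lin_block (a b : R) (p q : bool) x : R[i] :=
  \sum_(pq : bool * bool | same_wt a b p q pq.1 pq.2) lin_char pq.1 pq.2 x.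

Definition cellular_char (a b : R) (gamma : gT -> R[i]) : Prop :=
  if (a == 0) && (b == 0) then gamma = reg_char else
  [\/ exists p q, [/\ lin_ex p q, wt a b p q != 0 & gamma = lin_block a b p q],
      exists p q, [/\ lin_ex p q, wt a b p q = 0 &
                      gamma = fun x => lin_char p q x + chi2 x]
    | [/\ (2 < d)%N, forall p q, lin_ex p q -> wt a b p q != 0 & gamma = chi2]].

(** The sum of chi(s) chi(x) over the linear characters chi. It counts the w with x w s = w
    ([fix_char_s]), because the characters of degree 2 vanish at s. *)
Definition fix_char x : R[i] :=
  lin_char false false x + lin_char false true x -
  (lin_char true false x + lin_char true true x).

End LinearCharacters.

(** * Cells with one or two elements, and words with a given last letter *)

Section Cells2.
Variables (R : realType) (gT : finGroupType) (d : nat).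
Variables (c : gT -> R) (H : algType (expring R)) (T : gT -> H).
Variables (bar : {rmorphism H -> H}) (hbar : is_bar_involution T bar).
Variables (C : gT -> H) (hC : is_KL_basis T bar C).
Variables (s t : gT) (D : dihedral d s t) (hT : is_Hecke_algebra [set s; t] c T).
Implicit Types (x y z w : gT).
Local Notation Cg := (Cgen c T).
Local Notation M := (KL_M T C).
Let hB := Hecke_basis hT.
Let cB := KL_basis hC.

Lemma KL_char_single w (p q : bool) : KL_class C w = [set w] ->
  M s w w = (-1) ^+ p -> M t w w = (-1) ^+ q ->
  lin_ex s t p q /\ KL_char T C [set w] = lin_char R s t p q.
Proof.
move=> cw Ms Mt.
have ww : w \in KL_class C w by rewrite cw inE.
have E x : KL_char T C [set w] x = (M x w w)%:~R by rewrite /KL_char big_set1.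
apply: (lin_charP D) => [|x|x]; rewrite !E.
- by rewrite (KL_M1 hC D hT) eqxx.
- by rewrite (KL_M_cell hC D hT s x ww ww) cw big_set1 Ms rmorphM rmorph_sign.
- by rewrite (KL_M_cell hC D hT t x ww ww) cw big_set1 Mt rmorphM rmorph_sign.
Qed.

Lemma KL_char_pair w w' (p : bool) : w != w' -> KL_class C w = [set w; w'] ->
  M s w w = (-1) ^+ p -> M s w' w' = (-1) ^+ p -> M s w w' = 0 -> M s w' w = 0 ->
  M t w w = 0 -> M t w' w' = 0 -> M t w w' = 1 -> M t w' w = 1 ->
  [/\ lin_ex s t p false, lin_ex s t p true &
  KL_char T C [set w; w'] = fun x => lin_char R s t p false x + lin_char R s t p true x].
Proof.
move=> nw cw s1 s2 s3 s4 t1 t2 t3 t4.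
have ww : w \in KL_class C w by rewrite cw !inE eqxx.
have ww' : w' \in KL_class C w by rewrite cw !inE eqxx orbT.
have E x : KL_char T C [set w; w'] x = (M x w w)%:~R + (M x w' w')%:~R.
  by rewrite /KL_char big_setU1 ?big_set1 // inE.
have cell a x z z' : z \in KL_class C w -> z' \in KL_class C w ->
  (M (a * x)%g z z' = M a z w * M x w z' + M a z w' * M x w' z').
  by move=> zc zc'; rewrite (KL_M_cell hC D hT a x zc zc') cw big_setU1 ?big_set1 // inE.
(* The linear form with values 1 on C_w and (-1)^q on C_w' is an eigenvector for s and for t.
   Averaging over q recovers the diagonal entry at w, and [F2] does the same for w'. *)
have F1 q : lin_ex s t p q /\
    (fun x => (M x w w + (-1) ^+ q * M x w' w)%:~R : R[i]) = lin_char R s t p q.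
  apply: (lin_charP D) => [|x|x].
  - by rewrite !(KL_M1 hC D hT) eqxx eq_sym (negbTE nw) mulr0 addr0.
  - rewrite !cell // s1 s2 s3 s4 !mul0r addr0 add0r !(rmorphD, rmorphM, rmorph_sign) /=.
    by rewrite mulrDr; congr (_ + _); rewrite mulrCA.
  - rewrite !cell // t1 t2 t3 t4 !mul0r !mul1r addr0 add0r !(rmorphD, rmorphM, rmorph_sign) /=.
    by rewrite mulrDr mulrA -expr2 sqrr_sign mul1r addrC.
have F2 q : lin_ex s t p q /\
    (fun x => (M x w' w' + (-1) ^+ q * M x w w')%:~R : R[i]) = lin_char R s t p q.
  apply: (lin_charP D) => [|x|x].
  - by rewrite !(KL_M1 hC D hT) eqxx (negbTE nw) mulr0 addr0.
  - rewrite !cell // s1 s2 s3 s4 !mul0r addr0 add0r !(rmorphD, rmorphM, rmorph_sign) /=.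
    by rewrite mulrDr; congr (_ + _); rewrite mulrCA.
  - rewrite !cell // t1 t2 t3 t4 !mul0r !mul1r addr0 add0r !(rmorphD, rmorphM, rmorph_sign) /=.
    by rewrite mulrDr mulrA -expr2 sqrr_sign mul1r addrC.
have [e0 E0] := F1 false; have [e1 E1] := F1 true.
have [_ E2] := F2 false; have [_ E3] := F2 true.
split=> //; apply/funext=> x; rewrite E.
have := congr1 (fun f => f x) E0; have := congr1 (fun f => f x) E1.
have := congr1 (fun f => f x) E2; have := congr1 (fun f => f x) E3.
rewrite /= !expr0 !expr1 !mulN1r !mul1r !rmorphB !rmorphD /= => A1 A2 A3 A4.
apply: (@mulIf _ 2%:R); first by rewrite pnatr_eq0.
have -> : 2%:R = 1 + 1 :> R[i] by [].
rewrite !mulrDr !mulr1 -{1}A4 -{1}A3 -A1 -A2; ring.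
Qed.

Lemma KL_M_gen u x y :
  M u x y = edeg (coords C (Cg u * C y) x) - edeg (qneg c u) * (x == y)%:R.
Proof.
have E : T u * C y = Cg u * C y - qneg c u *: C y.
  by rewrite mulrDl -scalerAl mul1r addrK.
rewrite /KL_M E coordsB // coordsZ // coords_basis // raddfB /= rmorphM /=.
by case: (x == y); rewrite ?rmorph1 ?rmorph0.
Qed.

(** The parity test chooses the first letter so that the last one is always s. *)
Definition ew n : gT := if odd n then alt s t n else alt t s n.

(** The elements with a reduced word ending in s. Lengths run up to d, so the longest element
    belongs to the sets for both last letters. *)
Definition ending : {set gT} := [set x | [exists n : 'I_d, x == ew n.+1]].

Lemma is_word_ew n : is_word s t n (ew n).
Proof. by rewrite /ew; case: odd; [left | right]. Qed.

Lemma endingP x : reflect (exists2 n, (0 < n <= d)%N & x = ew n) (x \in ending).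
Proof.
rewrite inE; apply: (iffP existsP) => [[n /eqP->]|[[//|n] /= nd ->]].
  by exists n.+1 => //=.
by exists (Ordinal nd).
Qed.

Lemma ending_ew n : (0 < n <= d)%N -> ew n \in ending.
Proof. by move=> nd; apply/endingP; exists n. Qed.

Lemma ending_s n : (n <= d)%N ->
  (alt s t n \in ending) = (0 < n)%N && (odd n || (n == d)).
Proof.
move=> nd; apply/endingP/andP => [[m /andP[m0 md] E]|[n0 /orP[on|/eqP nE]]].
- have Emn : n = m.
    by apply: (is_word_inj D nd md (or_introl erefl)); rewrite E; apply: is_word_ew.
  rewrite Emn in E nd *; split=> //; move: E; rewrite /ew; case: odd => //= E.
  by rewrite eqn_leq nd leqNgt; apply/negP=> md'; rewrite (dih_sep D md' md' E) in m0.
- by exists n; rewrite ?n0 // /ew on.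
- by exists n; rewrite ?n0 // /ew; case: odd; rewrite // nE (dih_braid D).
Qed.

Lemma ending_t n : (n <= d)%N ->
  (alt t s n \in ending) = (0 < n)%N && (~~ odd n || (n == d)).
Proof.
move=> nd; apply/endingP/andP => [[m /andP[m0 md] E]|[n0 /orP[on|/eqP nE]]].
- have Emn : n = m.
    by apply: (is_word_inj D nd md (or_intror erefl)); rewrite E; apply: is_word_ew.
  rewrite Emn in E nd *; split=> //; move: E; rewrite /ew; case: odd => //= E.
  by rewrite eqn_leq nd leqNgt; apply/negP=> md'; rewrite (dih_sep D md' md' (esym E)) in m0.
- by exists n; rewrite ?n0 // /ew (negbTE on).
- by exists n; rewrite ?n0 // /ew; case: odd; rewrite // nE (dih_braid D).
Qed.

End Cells2.

Fact half_sum_identity (F : comPzRingType) (r a b p q : F) :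
  r + (a + b - (p + q)) = a *+ 2 + (b * 2%:R + (r - (a + b + p + q))).
Proof. by ring. Qed.

(** * Left cells for equal positive parameters *)

Section EqualCase.
Variables (R : realType) (gT : finGroupType) (d : nat).
Variables (c : gT -> R) (H : algType (expring R)) (T : gT -> H).
Variables (bar : {rmorphism H -> H}) (hbar : is_bar_involution T bar).
Variables (C : gT -> H) (hC : is_KL_basis T bar C).
Implicit Types (s t x y z w : gT).
Local Notation Cg := (Cgen c T).
Local Notation M := (KL_M T C).
Let cB := KL_basis hC.

Lemma KL_class_eq w (G : {set gT}) : (forall x, x \in G -> KL_eqv C x w) ->
  (forall x, KL_le C x w -> KL_le C w x -> x \in G) -> KL_class C w = G.
Proof.
move=> G1 G2; apply/setP=> x; rewrite inE; apply/asboolP/idP => [[]|]; auto.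
Qed.

Lemma KL_eqv_sym x y : KL_eqv C x y -> KL_eqv C y x.
Proof. by case. Qed.

Lemma KL_eqv_trans x y z : KL_eqv C x y -> KL_eqv C y z -> KL_eqv C x z.
Proof.
by move=> [xy yx] [yz zy]; split; [apply: KL_trans yz | apply: KL_trans yx].
Qed.

Lemma KL_eqv_class x y : KL_eqv C x y -> KL_class C x = KL_class C y.
Proof.
move=> xy; apply: KL_class_eq => [z|z zx xz].
  by rewrite inE => /asboolP zy; apply: (KL_eqv_trans zy); apply: KL_eqv_sym.
by rewrite inE; apply/asboolP; apply: KL_eqv_trans xy.
Qed.

Lemma KL_charD (A B : {set gT}) x : [disjoint A & B] ->
  KL_char T C (A :|: B) x = KL_char T C A x + KL_char T C B x.
Proof.
move=> dAB; rewrite /KL_char -bigU //=.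
by apply: eq_bigl => w; rewrite inE.
Qed.

Section One.
Variables (s t : gT) (D : dihedral d s t) (hT : is_Hecke_algebra [set s; t] c T).
Hypotheses (cs0 : 0 < c s) (cts : c t = c s).
Let D' := dihedral_sym D.
Let hT' := is_Hecke_sym hT.

Lemma alt_neq1 n : (n < d)%N -> alt s t n.+1 != 1%g.
Proof. by move=> nd; apply/eqP => /(dih_injs D nd (leq0n d)). Qed.

Lemma eq_scal n : (n < d)%N -> Cg s * C (alt s t n.+1) = qsum c s *: C (alt s t n.+1).
Proof.
move=> nd; apply: (KLsq D hT cs0 nd).
by case: (KLform_KLeq hbar hC D hT cs0 cts nd).
Qed.

Lemma eq_act n : (n.+1 < d)%N -> Cg t * C (alt s t n.+1) =
  C (alt t s n.+2) + (if n == 0%N then 0 else C (alt t s n)).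
Proof.
case: n => [|n] nd.
  by rewrite addr0; case: (KLeq_step1 hbar hC D hT cs0 cts nd).
exact: (KLeq_mul hbar hC D hT cs0 cts nd).
Qed.

Lemma eq_edge n : (n.+1 < d)%N -> KL_le C (alt t s n.+2) (alt s t n.+1) /\
  ((0 < n)%N -> KL_le C (alt t s n) (alt s t n.+1)).
Proof.
move=> nd; have N : (n.+2 == n) = false by apply/negbTE; lia.
have Na : (alt t s n.+2 == alt t s n) = false.
  by apply/negbTE/eqP=> /(dih_injt D nd (ltnW (ltnW nd))); lia.
split=> [|n0]; apply: (@le_step _ _ _ _ (Cg t)); rewrite eq_act // coordsD //.
  rewrite coords_basis // eqxx; case: ifP => _; rewrite ?coords0 ?coords_basis ?Na //.
    by rewrite addr0; apply/eqP; apply: oner_neq0.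
  by rewrite addr0; apply/eqP; apply: oner_neq0.
rewrite (negbTE (lt0n_neq0 n0)) !coords_basis // eq_sym Na eqxx add0r.
by apply/eqP; apply: oner_neq0.
Qed.

End One.

Lemma eq_upper s t (D : dihedral d s t) (hT : is_Hecke_algebra [set s; t] c T)
    (X : gT -> Prop) : 0 < c s -> c t = c s ->
  (forall n, (n.+1 < d)%N -> X (alt s t n.+1) ->
      X (alt t s n.+2) /\ ((0 < n)%N -> X (alt t s n))) ->
  (forall n, (n.+1 < d)%N -> X (alt t s n.+1) ->
      X (alt s t n.+2) /\ ((0 < n)%N -> X (alt s t n))) ->
  (X 1%g -> X s /\ X t) -> upper c T C s t X.
Proof.
move=> cs0 cts.
have key a b (E : dihedral d a b) (hE : is_Hecke_algebra [set a; b] c T) n :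
   0 < c a -> c b = c a -> (n < d)%N ->
   (forall n, (n.+1 < d)%N -> X (alt a b n.+1) ->
      X (alt b a n.+2) /\ ((0 < n)%N -> X (alt b a n))) ->
   X (alt a b n.+1) -> spX C X (Cg a * C (alt a b n.+1)) /\
                       spX C X (Cg b * C (alt a b n.+1)).
  move=> ca cab nd X1 Xa; have cb : 0 < c b by rewrite cab.
  split; first by rewrite (eq_scal E hE) //; apply: (spXZ hC); apply: (spXC hC).
  (* The longest element has a word starting with b as well, so C_b acts on it by a scalar too. *)
  move: nd; rewrite leq_eqVlt => /orP[/eqP nE|nd].
    have wE : alt a b n.+1 = alt b a n.+1 by rewrite nE (dih_braid E).
    have Xb : X (alt b a n.+1) by rewrite -wE.
    have nd : (n < d)%N by rewrite -nE.
    rewrite wE (eq_scal (dihedral_sym E) (is_Hecke_sym hE)) //.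
    by apply: (spXZ hC); apply: (spXC hC).
  have [X2 X3] := X1 n nd Xa; rewrite (eq_act E hE) //.
  apply: (spXD hC); first exact: (spXC hC).
  case: eqP => [_ z|/eqP]; first by rewrite coords0.
  by rewrite -lt0n => /X3; apply: (spXC hC).
move=> Xs Xt X1 y Xy; have ct0 : 0 < c t by rewrite cts.
have D' := dihedral_sym D; have hT' := is_Hecke_sym hT.
have [[|n] nd yn] := wordP D y.
  have y1 : y = 1%g by case: yn.
  rewrite y1 in Xy *; have [Ps Pt] := X1 Xy.
  rewrite (KL1 hbar hC D hT) !mulr1.
  rewrite -(KLgen hbar hC D hT (ltW cs0)) -(KLgen hbar hC D' hT' (ltW ct0)).
  by split; apply: (spXC hC).
case: yn => yE; rewrite yE in Xy *; first exact: (key s t D hT n).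
by have [] := key t s D' hT' n ct0 (esym cts) nd Xt Xy.
Qed.

Section Classes.
Variables (s t : gT) (D : dihedral d s t) (hT : is_Hecke_algebra [set s; t] c T).
Hypotheses (cs0 : 0 < c s) (cts : c t = c s).
Let D' := dihedral_sym D.
Let hT' := is_Hecke_sym hT.
Let ct0 : 0 < c t. Proof. by rewrite cts. Qed.
Let w0 := alt s t d.

Lemma s_ending : s \in ending d s t.
Proof.
have : ew s t 1 \in ending d s t by apply: ending_ew; rewrite (dih_gt0 D).
by rewrite /ew /= mulg1.
Qed.

Lemma eq_upper_ending : upper c T C s t (fun x => x \in ending d s t).
Proof.
apply: eq_upper => // [n nd|n nd|].
- rewrite ending_s ?(ltnW nd) // ending_t //.
  rewrite (ltn_eqF nd) orbF /= => on; rewrite negbK in on *; rewrite on; split=> // n0.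
  by rewrite ending_t ?n0 ?on //; lia.
- rewrite ending_t ?(ltnW nd) // ending_s //.
  rewrite (ltn_eqF nd) orbF /= => on; rewrite negbK in on *; rewrite on; split=> // n0.
  by rewrite ending_s ?n0 ?on //; lia.
- by rewrite -[1%g]/(alt s t 0) ending_s.
Qed.

Lemma eq_upper_w0 : upper c T C s t (fun x => x = w0).
Proof.
apply: eq_upper => // [n nd E|n nd E|E].
- by have := dih_injs D (ltnW nd) (leqnn d) E; lia.
- rewrite /w0 (dih_braid D) in E.
  by have := dih_injt D (ltnW nd) (leqnn d) E; lia.
- have := dih_injs D (leq0n d) (leqnn d) E; have := dih_gt0 D; lia.
Qed.

Lemma eq_upper_n1 : upper c T C s t (fun x => x != 1%g).
Proof.
have d0 := dih_gt0 D; apply: eq_upper => // [n nd _|n nd _|]; last by rewrite eqxx.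
- split=> [|n0]; first exact: (alt_neq1 D' nd).
  by rewrite -(prednK n0); apply: (alt_neq1 D'); lia.
- split=> [|n0]; first exact: (alt_neq1 D nd).
  by rewrite -(prednK n0); apply: (alt_neq1 D); lia.
Qed.

Lemma eq_class1 : KL_class C 1%g = [set 1%g].
Proof.
apply: KL_class_eq => x; first by rewrite inE => /eqP->; split; apply: KL_refl.
move=> _ x1; rewrite inE; apply/negPn/negP=> N.
have := le_upper hC D hT eq_upper_n1 x1 N.
by rewrite eqxx.
Qed.

Lemma eq_class_w0 : KL_class C w0 = [set w0].
Proof.
apply: KL_class_eq => x; first by rewrite inE => /eqP->; split; apply: KL_refl.
move=> x1 _; rewrite inE; apply/eqP; exact: (le_upper hC D hT eq_upper_w0 x1).
Qed.

(** Neighbouring words with the same last letter are linked in both directions: multiplying by the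
    generator that is not the first letter gives the words with one letter more and one letter
    less. *)
Lemma eq_eqv n : (0 < n)%N -> (n < d)%N -> KL_eqv C (ew s t n) (s : gT).
Proof.
case: n => // n _; elim: n => [|n IHn] nd.
  by rewrite /ew /= mulg1; split; apply: KL_refl.
apply: KL_eqv_trans (IHn (ltnW nd)).
rewrite /ew /= negbK; case: (odd n) => /=.
  have [a1 _] := eq_edge D' hT' ct0 (esym cts) (ltnW nd).
  have [_ a2] := eq_edge D hT cs0 cts nd.
  by split; [exact: a1 | apply: a2].
have [a1 _] := eq_edge D hT cs0 cts (ltnW nd).
have [_ a2] := eq_edge D' hT' ct0 (esym cts) nd.
by split; [exact: a1 | apply: a2].
Qed.

Lemma eq_class_s : (1 < d)%N -> KL_class C s = ending d s t :\ w0.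
Proof.
move=> d1; apply: KL_class_eq => x.
  rewrite !inE => /andP[xw /existsP[n /eqP xE]]; rewrite xE; apply: eq_eqv => //.
  rewrite ltn_neqAle ltn_ord andbT; apply: contra xw => /eqP nd.
  by rewrite xE nd /ew; case: odd => //; rewrite /w0 (dih_braid D).
move=> xs sx; rewrite in_setD1; apply/andP; split.
  apply/eqP=> E; rewrite E in sx.
  have := le_upper hC D hT eq_upper_w0 sx erefl.
  by rewrite -[LHS]mulg1 => /(dih_injs D (ltnW d1) (leqnn d)); lia.
apply: (le_upper hC D hT eq_upper_ending xs).
exact: s_ending.
Qed.

(** The recursion for C_w only multiplies on the left, so the right factor C_s is kept. *)
Lemma eq_ending_r w : w \in ending d s t -> exists h, C w = h * Cg s.
Proof.
case/endingP=> n nd ->.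
have CS : C s = Cg s := KLgen hbar hC D hT (ltW cs0).
suff: ((0 < n <= d)%N -> exists h, C (ew s t n) = h * Cg s) /\
      ((0 < n.+1 <= d)%N -> exists h, C (ew s t n.+1) = h * Cg s) by case; auto.
elim: n {nd} => [|n [I1 I2]].
  by split=> // nd; exists 1; rewrite /ew /= mulg1 mul1r.
split=> // /= nd; have [h2 E2] := I2 (ltnW nd).
have step : exists g, C (ew s t n.+2) = g * C (ew s t n.+1) -
      (if n == 0%N then 0 else C (ew s t n)).
  rewrite /ew /= negbK; case: (odd n) => /=.
    by exists (Cg s); rewrite (eq_act D' hT') // addrK.
  by exists (Cg t); rewrite (eq_act D hT) // addrK.
have [g ->] := step; rewrite E2; case: eqP => [_|/eqP n0].
  by exists (g * h2); rewrite subr0 mulrA.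
have nd1 : (0 < n <= d)%N by rewrite lt0n n0; lia.
by have [h1 ->] := I1 nd1; exists (g * h2 - h1); rewrite mulrBl mulrA.
Qed.

Lemma eq_char_w0 : lin_ex s t false false /\
  KL_char T C [set w0] = lin_char R s t false false.
Proof.
have d1 : (d.-1 < d)%N by rewrite prednK // (dih_gt0 D).
have dE : d.-1.+1 = d by rewrite prednK // (dih_gt0 D).
have wE : w0 = alt t s d.-1.+1 by rewrite dE -(dih_braid D).
apply: (KL_char_single hC D hT eq_class_w0); rewrite (KL_M_gen c hC) eqxx expr0 mulr1.
  rewrite /w0 -{1}dE (eq_scal D hT) // dE coordsZ // coords_basis // eqxx mulr1.
  by rewrite /qsum raddfD /qneg cs0 /= !edegU addrK.
rewrite {1}wE (eq_scal D' hT') // -wE coordsZ // coords_basis // eqxx mulr1.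
by rewrite /qsum raddfD /qneg ct0 /= !edegU addrK.
Qed.

Lemma eq_char_1 : lin_ex s t true true /\
  KL_char T C [set 1%g] = lin_char R s t true true.
Proof.
have d0 := dih_gt0 D.
have s1 : 1%g != s by have := alt_neq1 D d0; rewrite /= mulg1 eq_sym.
have t1 : 1%g != t by have := alt_neq1 D' d0; rewrite /= mulg1 eq_sym.
apply: (KL_char_single hC D hT eq_class1); rewrite (KL_M_gen c hC) eqxx expr1 mulr1.
  rewrite (KL1 hbar hC D hT) mulr1 -(KLgen hbar hC D hT (ltW cs0)).
  by rewrite coords_basis // (negbTE s1) raddf0 sub0r /qneg cs0 edegU.
rewrite (KL1 hbar hC D hT) mulr1 -(KLgen hbar hC D' hT' (ltW ct0)).
by rewrite coords_basis // (negbTE t1) raddf0 sub0r /qneg ct0 edegU.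
Qed.

Hypothesis fixE : forall x, (#|[set w | (x * w * s)%g == w]|)%:R = fix_char R s t x.

(** All words ending in s together carry half of reg + fix, and the longest one accounts for the
    trivial character. *)
Lemma eq_char_s : (1 < d)%N -> KL_char T C (KL_class C s) =
  fun x => lin_char R s t false true x + chi2 R s t x.
Proof.
move=> d1; rewrite (eq_class_s d1); apply/funext=> x.
have dd : (0 < d <= d)%N by rewrite (dih_gt0 D) leqnn.
have w0E : w0 \in ending d s t by rewrite /w0 ending_s // eqxx orbT (dih_gt0 D).
have I : KL_char T C (ending d s t) x *+ 2 = reg_char R x + fix_char R s t x.
  rewrite -fixE; apply: (KL_char_ind hbar hC D hT cs0 eq_upper_ending s_ending).
  exact: eq_ending_r.
have E1 : KL_char T C (ending d s t) x =
    lin_char R s t false false x + KL_char T C (ending d s t :\ w0) x.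
  rewrite -{1}(finset.setD1K w0E) KL_charD; first by case: eq_char_w0 => _ ->.
  by rewrite finset.disjoints1 !inE eqxx.
apply: (@mulIf _ 2%:R); first by rewrite pnatr_eq0.
rewrite !mulr_natr; move: I; rewrite E1 mulrnDl => I.
apply: (addrI (lin_char R s t false false x *+ 2)); rewrite I.
rewrite -[(_ + chi2 _ _ _ _) *+ 2]mulr_natr mulrDl /chi2 mulfVK ?pnatr_eq0 // sum_linE // /fix_char.
exact: half_sum_identity.
Qed.

End Classes.
End EqualCase.

(** * The left preorder for unequal parameters *)

Section UnequalCase.
Variables (R : realType) (gT : finGroupType) (d : nat).
Variables (c : gT -> R) (H : algType (expring R)) (T : gT -> H).
Variables (bar : {rmorphism H -> H}) (hbar : is_bar_involution T bar).
Variables (C : gT -> H) (hC : is_KL_basis T bar C).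
Variables (s t : gT) (D : dihedral d s t) (hT : is_Hecke_algebra [set s; t] c T).
Hypotheses (cs0 : 0 < c s) (ct0 : 0 <= c t) (cts : c t < c s) (d_even : ~~ odd d).
Implicit Types (x y z w : gT).
Local Notation Cg := (Cgen c T).
Local Notation M := (KL_M T C).
Let cB := KL_basis hC.
Let D' := dihedral_sym D.
Let hT' := is_Hecke_sym hT.

Lemma even_gt1 : (1 < d)%N.
Proof. by have := dih_gt0 D; move: d_even; case: (d) => [|[|]]. Qed.
Let d1 := even_gt1.

Lemma ne_act_s n : (n < d)%N -> Cg s * C (alt s t n.+1) = qsum c s *: C (alt s t n.+1).
Proof.
by move=> nd; apply: (KLsq D hT cs0 nd); apply: (KLform_KLne hbar hC D hT cs0 ct0 cts nd).
Qed.

Lemma ne_act_t n : (n < d)%N -> Cg t * C (alt s t n) = C (alt t s n.+1).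
Proof.
case: n => [|n] nd; first exact: (KLne_mult0 hbar hC D hT ct0).
exact: (KLne_mult hbar hC D hT cs0 ct0 cts).
Qed.

(** Without the guards the lower words would be empty, for n = 0 in the first term and, by truncated
    subtraction, for n <= 2 in the second; C_1 does not occur in these products. *)
Lemma ne_act_st n : (n.+1 < d)%N -> Cg s * C (alt t s n.+1) = C (alt s t n.+2) +
  (if n == 0%N then 0 else zet c s t *: C (alt s t n)) +
  (if (n < 3)%N then 0 else C (alt s t (n - 2))).
Proof.
case: n => [|[|[|n]]] nd /=.
- by rewrite !addr0 (KLne_muls1 hbar hC D hT cs0 ct0).
- by rewrite !addr0 (KLne_muls2 hbar hC D hT cs0 ct0 cts).
- by rewrite !addr0 (KLne_muls3 hbar hC D hT cs0 ct0 cts).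
by rewrite (KLne_mulsS hbar hC D hT cs0 ct0 cts) // addrAC.
Qed.

Lemma ne_act_tt n : (n < d)%N -> 0 < c t ->
  Cg t * C (alt t s n.+1) = qsum c t *: C (alt t s n.+1).
Proof.
move=> nd ct; apply: (KLsq D' hT' ct nd).
case: n nd => [|n] nd; first exact: (KLgen_form hbar hC D' hT' ct).
rewrite -ne_act_t //; apply: (KLform_lt D hT cs0 ct cts nd).
exact: (KLform_KLne hbar hC D hT cs0 ct0 cts (ltnW nd)).
Qed.

Lemma ne_act_t0 n : (n < d)%N -> c t = 0 -> Cg t * C (alt t s n.+1) = C (alt s t n).
Proof.
move=> nd ct; rewrite -ne_act_t // mulrA.
have -> : Cg t = T t by rewrite /Cgen /qneg ct ltxx scale0r addr0.
by rewrite (Hecke_sq hT') /qdiff ct oppr0 subrr scale0r addr0 mul1r.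
Qed.

(** Only multiplication by the other generator has to be tested: on a word starting with s, C_s acts
    by a scalar, and likewise C_t on a word starting with t, except that for c_t = 0 it deletes the
    letter. *)
Lemma ne_upper (X : gT -> Prop) :
  (forall n, (n.+1 < d)%N -> X (alt s t n.+1) -> X (alt t s n.+2)) ->
  (forall n, (n.+1 < d)%N -> X (alt t s n.+1) -> [/\ X (alt s t n.+2),
     (0 < n)%N -> X (alt s t n) & (2 < n)%N -> X (alt s t (n - 2))]) ->
  (c t = 0 -> forall n, (n < d)%N -> X (alt t s n.+1) -> X (alt s t n)) ->
  (X 1%g -> X s /\ X t) -> upper c T C s t X.
Proof.
move=> X1 X2 X3 X4 y Xy.
have Ss n : (n < d)%N -> X (alt s t n.+1) -> spX C X (Cg s * C (alt s t n.+1)).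
  by move=> nd Xs; rewrite ne_act_s //; apply: (spXZ hC); apply: (spXC hC).
have Tt n : (n < d)%N -> X (alt t s n.+1) -> spX C X (Cg t * C (alt t s n.+1)).
  move=> nd Xs; case: (ltrP 0 (c t)) => ct.
    by rewrite ne_act_tt //; apply: (spXZ hC); apply: (spXC hC).
  have c0 : c t = 0 by apply/eqP; rewrite eq_le ct ct0.
  by rewrite ne_act_t0 //; apply: (spXC hC); apply: X3.
have [[|n] nd yn] := wordP D y.
  have y1 : y = 1%g by case: yn.
  rewrite y1 in Xy *; have [Ps Pt] := X4 Xy.
  rewrite (KL1 hbar hC D hT) !mulr1.
  rewrite -(KLgen hbar hC D hT (ltW cs0)) -(KLgen hbar hC D' hT' ct0).
  by split; apply: (spXC hC).
case: yn => yE; rewrite yE in Xy *; split; first exact: Ss; last exact: Tt.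
  move: nd; rewrite leq_eqVlt => /orP[/eqP nE|nd]; last first.
    by rewrite ne_act_t //; apply: (spXC hC); apply: X1.
  have wE : alt s t n.+1 = alt t s n.+1 by rewrite nE (dih_braid D).
  by rewrite wE in Xy *; apply: Tt; rewrite // -nE.
move: nd; rewrite leq_eqVlt => /orP[/eqP nE|nd].
  have wE : alt s t n.+1 = alt t s n.+1 by rewrite nE (dih_braid D).
  by rewrite -wE in Xy *; apply: Ss; rewrite // -nE.
have [P1 P2 P3] := X2 n nd Xy; rewrite ne_act_st //.
apply: (spXD hC); first apply: (spXD hC); first exact: (spXC hC).
  case: eqP => [_ z|/eqP]; first by rewrite coords0.
  by rewrite -lt0n => /P2 ?; apply: (spXZ hC); apply: (spXC hC).
case: ltnP => [_ z|/P3]; first by rewrite coords0.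
exact: (spXC hC).
Qed.

Lemma coords_alt k m : (k <= d)%N -> (m <= d)%N ->
  coords C (C (alt s t k)) (alt s t m) = (m == k)%:R.
Proof.
move=> kd md; rewrite coords_basis //; congr (_%:R); congr nat_of_bool.
by apply/eqP/eqP=> [/(dih_injs D md kd)|->].
Qed.

Let one_neq0 : (1 : expring R) <> 0. Proof. by apply/eqP/oner_neq0. Qed.

Lemma ne_edge1 n : (n.+1 < d)%N -> KL_le C (alt t s n.+2) (alt s t n.+1).
Proof.
by move=> nd; apply: (@le_step _ _ _ _ (Cg t)); rewrite ne_act_t // coords_basis // eqxx.
Qed.

Lemma ne_edge3 n : (n.+1 < d)%N -> KL_le C (alt s t n.+2) (alt t s n.+1).
Proof.
move=> nd; apply: (@le_step _ _ _ _ (Cg s)); rewrite ne_act_st // !coordsD //.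
rewrite coords_basis // eqxx.
case: eqP => [->|_]; first by rewrite coords0 // !addr0.
rewrite coordsZ // coords_alt ?(ltnW (ltnW nd)) // (_ : (n.+2 == n) = false); last lia.
rewrite mulr0 addr0; case: ltnP => _; first by rewrite coords0 // addr0.
by rewrite coords_alt; [rewrite (_ : (n.+2 == _) = false) ?addr0 //; lia | lia | lia].
Qed.

(** For c_t > 0 the link is the coefficient [zet], non-zero because its value at v = 1 is 2. For c_t
    = 0, where [zet] is 0, T_t deletes the first letter instead. *)
Lemma ne_edge2 n : (n.+2 < d)%N -> KL_le C (alt s t n.+1) (alt t s n.+2).
Proof.
move=> nd; case: (ltrP 0 (c t)) => ct; last first.
  have c0 : c t = 0 by apply/eqP; rewrite eq_le ct ct0.
  apply: (@le_step _ _ _ _ (Cg t)); rewrite ne_act_t0 ?(ltnW nd) //.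
  by rewrite coords_basis // eqxx.
apply: (@le_step _ _ _ _ (Cg s)); rewrite ne_act_st // -[n.+1 == 0%N]/false !coordsD //.
rewrite coords_alt; [|lia|lia]; rewrite (_ : (n.+1 == n.+3) = false); last lia.
rewrite coordsZ // coords_basis // eqxx mulr1 add0r.
have -> : coords C (if (n.+1 < 3)%N then 0 else C (alt s t (n.+1 - 2))) (alt s t n.+1) = 0.
  case: ltnP => _; first by rewrite coords0.
  by rewrite coords_alt; [rewrite (_ : (n.+1 == _) = false) //; lia | lia | lia].
rewrite addr0 (zetE s ct0) ct => /(congr1 (@edeg R)).
by rewrite raddfD raddf0 /= !edegU.
Qed.

Lemma ne_edge4 n : (n.+4 < d)%N -> KL_le C (alt s t n.+1) (alt t s n.+4).
Proof.
move=> nd; apply: (@le_step _ _ _ _ (Cg s));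
  rewrite ne_act_st // -[n.+3 == 0%N]/false -[(n.+3 < 3)%N]/false !coordsD //.
rewrite coords_alt; [|lia|lia]; rewrite (_ : (n.+1 == n.+4.+1) = false); last lia.
rewrite coordsZ // coords_alt; [|lia|lia]; rewrite (_ : (n.+1 == n.+3) = false); last lia.
by rewrite -[(n.+3 - 2)%N]/(n.+1) coords_basis // eqxx mulr0 !add0r.
Qed.

Lemma ne_eqv1 n : (n.+2 < d)%N -> KL_eqv C (alt t s n.+2) (alt s t n.+1).
Proof. by move=> nd; split; [apply: ne_edge1; lia | apply: ne_edge2]. Qed.

Lemma ne_eqv2 n : (n.+4 < d)%N -> KL_eqv C (alt s t n.+3) (alt t s n.+2).
Proof.
move=> nd; split; first by apply: ne_edge3; lia.
(* No single generator leads from length n + 3 down to n + 2; the path goes through lengths n + 4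
   and n + 1. *)
have e1 : KL_le C (alt t s n.+4) (alt s t n.+3) by apply: ne_edge1; lia.
have e2 := ne_edge4 nd.
have e3 : KL_le C (alt t s n.+2) (alt s t n.+1) by apply: ne_edge1; lia.
by apply: KL_trans e1; apply: KL_trans e2.
Qed.

Lemma ne_chain_s n : (n.+2 < d)%N -> KL_eqv C (ew s t n.+1) s.
Proof.
elim: n => [|n IHn] nd; first by rewrite /ew /= mulg1; split; apply: KL_refl.
apply: KL_eqv_trans (IHn (ltnW nd)); rewrite /ew /= negbK; case on: (odd n) => /=.
  by case: n on nd {IHn} => // n /= on nd; apply: ne_eqv2; lia.
by apply: ne_eqv1; lia.
Qed.

Lemma ne_chain_t n : (n.+2 < d)%N -> KL_eqv C (ew t s n.+2) (alt s t 2).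
Proof.
elim: n => [|n IHn] nd; first by rewrite /ew /=; split; apply: KL_refl.
apply: KL_eqv_trans (IHn (ltnW nd)); rewrite /ew /= !negbK; case on: (odd n) => /=.
  (* Here n + 3 and d are both even, so n + 3 < d yields the required n + 4 < d. *)
  by apply: (ne_eqv2 (n := n)); move: d_even nd on; lia.
by apply: (ne_eqv1 (n := n.+1)); lia.
Qed.

Let w0 := alt s t d.
Let v0 := alt s t d.-1.

Lemma ne_upper_v0 : upper c T C s t (fun x => x = v0 \/ x = w0).
Proof.
have dd : (d.-1 < d)%N by lia.
have A n : (n < d)%N -> alt t s n.+1 = v0 \/ alt t s n.+1 = w0 -> n.+1 = d.
  move=> nd [E|E].
    have Emn := alt_len_eq D' nd (ltnW dd) E.
    rewrite Emn in E *; have := dih_sep D' dd dd E; lia.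
  exact: (alt_len_eq D' nd (leqnn d) E).
apply: ne_upper => [n nd [E|E]|n nd E|_ n nd E|E].
- have En := dih_injs D (ltnW nd) (ltnW dd) E.
  by right; rewrite (_ : n.+2 = d) ?/w0 ?(dih_braid D) //; lia.
- by have := dih_injs D (ltnW nd) (leqnn d) E; lia.
- by have := A n (ltnW nd) E; lia.
- by left; rewrite /v0; have := A n nd E => <-.
- by case: E => E; [have := dih_injs D (leq0n d) (ltnW dd) E | have := dih_injs D (leq0n d)
  (leqnn d) E]; lia.
Qed.

Lemma ne_upper_s : upper c T C s t (fun x => x \in ending d s t).
Proof.
apply: ne_upper => [n nd|n nd|_ n nd|].
- by rewrite ending_s ?(ltnW nd) // ending_t //=; lia.
- rewrite ending_t ?(ltnW nd) // => on; split=> [|n0|n2]; rewrite ending_s //; lia.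
- by rewrite ending_t // ending_s ?(ltnW nd) //; move: d_even; case: eqP => [<-|]; lia.
- by rewrite -[1%g]/(alt s t 0) ending_s.
Qed.

Section Pos.
Hypothesis ctp : 0 < c t.
Let ct_neq0 : c t <> 0. Proof. by move=> E; move: ctp; rewrite E ltxx. Qed.

Lemma ne_upper_w0 : upper c T C s t (fun x => x = w0).
Proof.
apply: ne_upper => [n nd E|n nd E|//|E].
- by have := dih_injs D (ltnW nd) (leqnn d) E; lia.
- by have := alt_len_eq D' (ltnW nd) (leqnn d) E; lia.
- by have := dih_injs D (leq0n d) (leqnn d) E; lia.
Qed.

Lemma ne_upper_t : upper c T C s t (fun x => x \in ending d t s).
Proof.
apply: ne_upper => [n nd|n nd|//|].
- by rewrite (ending_t D') ?(ltnW nd) // (ending_s D') //=; lia.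
- by rewrite (ending_s D') ?(ltnW nd) // => on; split=> [|n0|n2]; rewrite (ending_t D') //; lia.
- by rewrite -[1%g]/(alt s t 0) (ending_t D').
Qed.

Lemma ne_upper_1 : upper c T C s t (fun x => x != 1%g).
Proof.
apply: ne_upper => [n nd _|n nd _|//|]; last by rewrite eqxx.
- exact: (alt_neq1 D' nd).
- split=> [|n0|n2]; first exact: (alt_neq1 D nd).
    by rewrite -(prednK n0); apply: (alt_neq1 D); lia.
  by case: n nd n2 => [|[|[|n]]] // nd _; rewrite subn2 /=; apply: (alt_neq1 D); lia.
Qed.

End Pos.

Lemma alt_s_neq_t n : (n <= d)%N -> alt s t n != t.
Proof.
move=> nd; apply/eqP=> E; have {}E : alt s t n = alt t s 1 by rewrite E /= mulg1.
have n1 := alt_len_eq D nd (ltnW d1) E; rewrite n1 in E.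
by have := dih_sep D d1 d1 E.
Qed.

Lemma alt_t_neq_t n : (n.+2 <= d)%N -> alt t s n.+2 != t.
Proof.
by move=> nd; apply/eqP; rewrite -[RHS]mulg1 => /(dih_injt D nd (ltnW d1)).
Qed.

Lemma ne_upper_tt : 0 < c t -> upper c T C s t (fun x => (x \in ending d t s) && (x != t)).
Proof.
move=> ctp; have ct_neq0 : c t <> 0 by move=> E; rewrite E ltxx in ctp.
apply: ne_upper => [n nd|n nd|//|].
- rewrite (ending_t D') ?(ltnW nd) // (ending_s D') //= => /andP[on _].
  by rewrite alt_t_neq_t // andbT; lia.
- rewrite (ending_s D') ?(ltnW nd) // => /andP[on nt].
  have n0 : n != 0%N by apply: contra nt => /eqP->; rewrite /= mulg1.
  by split=> [|?|n2]; rewrite (ending_t D') ?alt_s_neq_t //; lia.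
- by rewrite -[1%g]/(alt s t 0) (ending_t D').
Qed.

Lemma ne_upper_1t : c t = 0 -> upper c T C s t (fun x => (x != 1%g) && (x != t)).
Proof.
move=> c0; have S n : (0 < n <= d)%N -> (alt s t n != 1%g) && (alt s t n != t).
  case: n => // n /andP[_ nd]; rewrite alt_s_neq_t // andbT; exact: (alt_neq1 D nd).
have N n : (n < d)%N -> (alt t s n.+1 != 1%g) && (alt t s n.+1 != t) -> (0 < n)%N.
  by case: n => //= nd; rewrite mulg1 eqxx andbF.
apply: ne_upper => [n nd _|n nd|_ n nd|].
- by rewrite alt_t_neq_t // andbT; apply: (alt_neq1 D' nd).
- by move/(N n (ltnW nd)) => n0; split=> [|_|n2]; apply: S; lia.
- by move/(N n nd) => n0; apply: S; lia.
- by rewrite eqxx.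
Qed.

End UnequalCase.

Fact half_sum_identity2 (F : comPzRingType) (r a b p q : F) :
  r + (a + b - (p + q)) = (a + b) *+ 2 + (r - (a + b + p + q)).
Proof. by ring. Qed.

Fact half_sum_identity3 (F : comPzRingType) (r a b p q g m : F) :
  r *+ 2 = r + (a + b - (p + q)) + (p *+ 2 + q *+ 2 + g *+ 2) ->
  m = a + b + p + q -> g *+ 2 = r - m.
Proof.
move=> E ->; apply: (addIr (r + (a + b - (p + q)) + (p *+ 2 + q *+ 2))).
by transitivity (r *+ 2); [rewrite E | ]; ring.
Qed.

Section LinBlock.
Variables (R : realType) (gT : finGroupType) (s t : gT).

Lemma lin_blockE (a b : R) p q x : lin_block s t a b p q x =
  \sum_(p' : bool) \sum_(q' : bool)
     (if same_wt a b p q p' q' then lin_char R s t p' q' x else 0).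
Proof.
rewrite /lin_block big_mkcond pair_bigA /=.
by apply: eq_bigr => -[].
Qed.

Lemma sgn_mul_eq (a : R) (p p' : bool) : a != 0 ->
  ((-1) ^+ p' * a == (-1) ^+ p * a) = (p' == p).
Proof.
move=> a0; have N : (-1 == 1 :> R) = false.
  by apply/negbTE; rewrite -subr_eq0 -opprD oppr_eq0 -[1 + 1]/(2%:R) pnatr_eq0.
by rewrite (inj_eq (mulIf a0)); case: p; case: p'; rewrite ?expr0 ?expr1 ?eqxx ?[1 == _]eq_sym ?N.
Qed.

Lemma lin_block_neq0 (a b : R) p q : a != 0 -> b != 0 ->
  lin_block s t a b p q = lin_char R s t p q.
Proof.
move=> a0 b0; apply/funext=> x; rewrite lin_blockE !big_bool /same_wt.
rewrite !(sgn_mul_eq _ _ a0) !(sgn_mul_eq _ _ b0).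
by case: p; case: q; rewrite /= ?addr0 ?add0r.
Qed.

Lemma lin_block_eq0 (a : R) p q : a != 0 ->
  lin_block s t a 0 p q = fun x => lin_char R s t p false x + lin_char R s t p true x.
Proof.
move=> a0; apply/funext=> x; rewrite lin_blockE !big_bool /same_wt.
rewrite !(sgn_mul_eq _ _ a0) !mulr0 eqxx !andbT.
by case: p; case: q; rewrite /= ?addr0 ?add0r addrC.
Qed.

End LinBlock.

(** * Left cells and their characters for unequal parameters *)

Section UnequalCells.
Variables (R : realType) (gT : finGroupType) (d : nat).
Variables (c : gT -> R) (H : algType (expring R)) (T : gT -> H).
Variables (bar : {rmorphism H -> H}) (hbar : is_bar_involution T bar).
Variables (C : gT -> H) (hC : is_KL_basis T bar C).
Variables (s t : gT) (D : dihedral d s t) (hT : is_Hecke_algebra [set s; t] c T).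
Hypotheses (cs0 : 0 < c s) (ct0 : 0 <= c t) (cts : c t < c s) (d_even : ~~ odd d).
Implicit Types (x y z w : gT).
Local Notation Cg := (Cgen c T).
Local Notation M := (KL_M T C).
Local Notation w0 := (alt s t d).
Local Notation v0 := (alt s t d.-1).
Let cB := KL_basis hC.
Let D' := dihedral_sym D.
Let hT' := is_Hecke_sym hT.
Let d1 := even_gt1 D d_even.
Let dd : (d.-1 < d)%N. Proof. by rewrite prednK // ltnW. Qed.
Let upv := ne_upper_v0 hbar hC D hT cs0 ct0 cts d_even.
Let ups := ne_upper_s hbar hC D hT cs0 ct0 cts d_even.
Let le_up := le_upper hC D hT.

Let w0v0 : w0 != v0.
Proof. by apply/eqP=> /(dih_injs D (leqnn d) (ltnW dd)); lia. Qed.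

Let t1 : t = alt t s 1. Proof. by rewrite /= mulg1. Qed.
Let s1 : s = alt s t 1. Proof. by rewrite /= mulg1. Qed.

(** As d is even, [v0], of length d - 1, also ends in s; it splits off together with the longest
    element. For d = 2 nothing is left. *)
Definition ne_s : {set gT} := ending d s t :\: [set w0; v0].
Definition ne_t : {set gT} := ~: (ending d s t :|: [set 1%g; t]).

Lemma v0_ending : v0 \in ending d s t.
Proof. by rewrite ending_s ?(ltnW dd) //; move: d_even d1; lia. Qed.

Lemma w0_ending : w0 \in ending d s t.
Proof. by rewrite ending_s // eqxx orbT (ltnW d1). Qed.

(** The bound [2 < d] records that the set is empty for d = 2, in agreement with the condition
    attached to [chi2] in [cellular_char]. *)
Lemma ne_sP w : w \in ne_s -> (2 < d)%N /\ KL_eqv C w s.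
Proof.
rewrite !inE negb_or => /andP[/andP[ww wv] /existsP[n /eqP wE]].
have nd := ltn_ord n; rewrite wE in ww wv.
have n1 : n.+1 != d.
  by apply: contra ww => /eqP nE; rewrite nE /ew (negbTE d_even) (dih_braid D).
have n2 : n.+1 != d.-1.
  apply: contra wv => /eqP nE; rewrite nE /ew.
  by case: ifP => // /negbT; move: d_even d1; lia.
have nd2 : (n.+2 < d)%N by lia.
split; first by lia.
by rewrite wE; apply: (ne_chain_s hbar hC D hT cs0 ct0 cts d_even nd2).
Qed.

Lemma ne_tP w : w \in ne_t -> (2 < d)%N /\ KL_eqv C w (alt s t 2).
Proof.
rewrite finset.in_setC finset.in_setU !finset.in_set2 !negb_or => /andP[wE /andP[w1 wt]].
have [k kd wk] := wordP D w.
have k0 : k != 0%N by apply: contra w1 => /eqP k0; move: wk; rewrite k0 => -[] ->.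
have kE : w = ew t s k /\ (1 < k < d)%N.
  case: wk => wk; rewrite wk in wE wt *.
    rewrite ending_s // in wE.
    have [ok kr] : ~~ odd k /\ (1 < k < d)%N by split; lia.
    by rewrite /ew (negbTE ok).
  rewrite ending_t // in wE.
  have k1 : k != 1%N by apply: contra wt => /eqP->; rewrite /= mulg1.
  have [ok kr] : odd k /\ (1 < k < d)%N by split; lia.
  by rewrite /ew ok.
case: kE => -> /andP[]; case: k {kd wk k0} => [|[|k]] // _ kd.
split; first by lia.
by apply: (ne_chain_t hbar hC D hT cs0 ct0 cts d_even kd).
Qed.

Lemma ne_cover w : w \in [set 1%g; t] :|: ([set w0; v0] :|: (ne_s :|: ne_t)).
Proof.
rewrite /ne_s /ne_t !inE; case: (w == 1%g); case: (w == t) => //=.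
by case: (w == w0); case: (w == v0) => //=; case: [exists _, _].
Qed.

Let st2_in : (2 < d)%N -> alt s t 2 \notin ending d s t.
Proof. by move=> d2; rewrite ending_s ?(ltnW d2) //=; lia. Qed.

Lemma s_in_ne_s : (2 < d)%N -> s \in ne_s.
Proof.
move=> d2; rewrite finset.in_setD (s_ending D) andbT !inE negb_or.
apply/andP; split; apply/eqP; rewrite -[LHS]mulg1 => /(dih_injs D (ltnW d1)).
  by move/(_ (leqnn d)); lia.
by move/(_ (ltnW dd)); lia.
Qed.

Lemma ne_class_s : (2 < d)%N -> KL_class C s = ne_s.
Proof.
move=> d2; have sin := s_in_ne_s d2.
apply: KL_class_eq => x; first by case/ne_sP.
move=> xs sx; rewrite finset.in_setD (le_up ups xs) ?(s_ending D) // andbT.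
apply/negP=> /set2P xE; move: sin; rewrite finset.in_setD => /andP[/negP N _]; apply: N.
have : s = v0 \/ s = w0.
  by apply: (le_up upv sx); case: xE => ->; [right | left].
by case=> sE; apply/set2P; [right | left].
Qed.

Lemma ne_class_t : (2 < d)%N -> KL_class C (alt s t 2) = ne_t.
Proof.
move=> d2; apply: KL_class_eq => x; first by case/ne_tP.
move=> xs sx; rewrite finset.in_setC finset.in_setU negb_or; apply/andP; split.
  apply/negP=> xE; have := st2_in d2; apply/negP/negPn.
  exact: (le_up ups sx).
(* The elements 1 and t are excluded by left ideals that contain s t but not them; which ideals
   exist depends on whether c_t is 0. *)
case: (ltrP 0 (c t)) => ct.
  apply/negP=> /set2P[] xE; rewrite xE in sx xs.
    have up1 := ne_upper_1 hbar hC D hT cs0 ct0 cts d_even ct.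
    by have := le_up up1 xs (alt_neq1 D d1); rewrite eqxx.
  have upt := ne_upper_tt hbar hC D hT cs0 ct0 cts d_even ct.
  have st2 : (alt s t 2 \in ending d t s) && (alt s t 2 != t).
    by rewrite (ending_t D') // (alt_s_neq_t D d_even).
  by have := le_up upt xs st2; rewrite eqxx andbF.
have c0 : c t = 0 by apply/eqP; rewrite eq_le ct ct0.
have up1 := ne_upper_1t hbar hC D hT cs0 ct0 cts d_even c0.
have st2 : (alt s t 2 != 1%g) && (alt s t 2 != t).
  by rewrite (alt_s_neq_t D d_even) // andbT; apply: (alt_neq1 D d1).
by have := le_up up1 xs st2; rewrite !inE negb_or.
Qed.

Lemma ne_ending_r w : w \in ending d s t -> exists h, C w = h * Cg s.
Proof.
case/endingP=> n; elim: n {-2}n (leqnn n) w => [|m IH] n nm w.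
  by case: n nm => // _ /andP[].
move=> nd ->; case: n nm nd => [//|[|n]] nm nd.
  by exists 1; rewrite /ew [alt s t 1]/= mulg1 mul1r (KLgen hbar hC D hT (ltW cs0)).
have [||h hE] := IH n.+1 _ (ew s t n.+1) _ erefl; [lia | lia |].
case on: (odd n); last first.
  have e1 : ew s t n.+1 = alt s t n.+1 by rewrite /ew [odd _]/= on.
  have e2 : ew s t n.+2 = alt t s n.+2 by rewrite /ew [odd _]/= negbK on.
  have nd' : (n.+1 < d)%N by lia.
  have E := ne_act_t hbar hC D hT cs0 ct0 cts nd'.
  by exists (Cg t * h); rewrite e2 -E -e1 hE mulrA.
have e1 : ew s t n.+1 = alt t s n.+1 by rewrite /ew [odd _]/= on.
have e2 : ew s t n.+2 = alt s t n.+2 by rewrite /ew [odd _]/= negbK on.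
have e0 : ew s t n = alt s t n by rewrite /ew on.
have nd' : (n.+1 < d)%N by lia.
have E := ne_act_st hbar hC D hT cs0 ct0 cts nd'.
have n0 : (n == 0%N) = false by move: on; case: (n).
have [||h1 hE1] := IH n _ (ew s t n) _ erefl; [lia | lia |].
have [h2 hE2] : exists h2, (if (n < 3)%N then 0 else C (alt s t (n - 2))) = h2 * Cg s.
  case: ltnP => n3; first by exists 0; rewrite mul0r.
  have [||h2 hE2] := IH (n - 2)%N _ (ew s t (n - 2)) _ erefl; [lia | lia |].
  exists h2; rewrite -hE2 /ew; case: ifP => // /negbT; lia.
exists (Cg s * h - (zet c s t *: h1) - h2).
rewrite !mulrBl -mulrA -hE -scalerAl -hE1 -hE2 e0 e1 e2.
rewrite E n0; set u := C _; set v := _ *: _; set w' := if _ then _ else _.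
by rewrite addrAC addrK addrK.
Qed.

Let cC x y : coords C (C y) x = (x == y)%:R. Proof. exact: coords_basis. Qed.

Let Ms_s n : (n < d)%N -> forall x, M s x (alt s t n.+1) = (x == alt s t n.+1)%:R.
Proof.
move=> nd x; rewrite (KL_M_gen c hC) (ne_act_s hbar hC D hT cs0 ct0 cts nd).
rewrite coordsZ // cC rmorphM /qneg cs0 /qsum raddfD /= !edegU.
by case: (x == _); rewrite ?rmorph1 ?rmorph0 ?mulr0 ?mulr1 ?subr0 ?addrK.
Qed.

Let Mt_s n : (n < d)%N -> forall x, M t x (alt s t n) =
  (x == alt t s n.+1)%:R - edeg (qneg c t) * (x == alt s t n)%:R.
Proof.
move=> nd x; rewrite (KL_M_gen c hC) (ne_act_t hbar hC D hT cs0 ct0 cts nd) cC.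
by case: (x == alt t s _); rewrite ?rmorph1 ?rmorph0.
Qed.

Let Ms_1 x : M s x 1%g = (x == s)%:R - (x == 1%g)%:R.
Proof.
rewrite (KL_M_gen c hC) (KL1 hbar hC D hT) mulr1 -(KLgen hbar hC D hT (ltW cs0)) cC.
by rewrite /qneg cs0 edegU mul1r; case: (x == s); rewrite ?rmorph1 ?rmorph0.
Qed.

Let Ms_t x : M s x t = (x == alt s t 2)%:R - (x == t)%:R.
Proof.
rewrite (KL_M_gen c hC) /qneg cs0 edegU mul1r.
have := ne_act_st hbar hC D hT cs0 ct0 cts (n := 0) d1.
rewrite -t1 !addr0 => ->; rewrite cC.
by case: (x == alt s t 2); rewrite ?rmorph1 ?rmorph0.
Qed.

Let one_s : (1 == s)%g = false.
Proof. by apply/negbTE; rewrite eq_sym s1; apply: (alt_neq1 D (ltnW d1)). Qed.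
Let one_t : (1 == t)%g = false.
Proof. by apply/negbTE; rewrite eq_sym t1; apply: (alt_neq1 D' (ltnW d1)). Qed.
Let t_s : (t == s) = false.
Proof.
by apply/negbTE; rewrite eq_sym s1; apply: (alt_s_neq_t D d_even (ltnW d1)).
Qed.
Let t_st2 : (t == alt s t 2) = false.
Proof. by apply/negbTE; rewrite eq_sym; apply: (alt_s_neq_t D d_even d1). Qed.

Let w0E : w0 = alt s t d.-1.+1. Proof. by rewrite prednK // ltnW. Qed.
Let v0E : v0 = alt s t d.-2.+1. Proof. by congr alt; move: d1; lia. Qed.

Section Positive.
Hypothesis ctp : 0 < c t.
Let qt : edeg (qneg c t) = 1. Proof. by rewrite /qneg ctp edegU. Qed.
Let up1 := ne_upper_1 hbar hC D hT cs0 ct0 cts d_even ctp.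
Let upw := ne_upper_w0 hbar hC D hT cs0 ct0 cts d_even ctp.
Let upt := ne_upper_t hbar hC D hT cs0 ct0 cts d_even ctp.
Let uptt := ne_upper_tt hbar hC D hT cs0 ct0 cts d_even ctp.

Let Mt_t n : (n < d)%N -> forall x, M t x (alt t s n.+1) = (x == alt t s n.+1)%:R.
Proof.
move=> nd x; rewrite (KL_M_gen c hC) (ne_act_tt hbar hC D hT cs0 ct0 cts nd ctp).
rewrite coordsZ // cC rmorphM qt /qsum raddfD /= !edegU.
by case: (x == _); rewrite ?rmorph1 ?rmorph0 ?mulr0 ?mulr1 ?subr0 ?addrK.
Qed.

Lemma pos_class1 : KL_class C 1%g = [set 1%g].
Proof.
apply: KL_class_eq => x; first by rewrite inE => /eqP->; split; apply: KL_refl.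
move=> _ x1; rewrite inE; apply/negPn/negP=> N.
by have := le_up up1 x1 N; rewrite eqxx.
Qed.

Lemma pos_class_w0 : KL_class C w0 = [set w0].
Proof.
apply: KL_class_eq => x; first by rewrite inE => /eqP->; split; apply: KL_refl.
move=> x1 _; rewrite inE; apply/eqP; exact: (le_up upw x1).
Qed.

Lemma pos_class_v0 : KL_class C v0 = [set v0].
Proof.
apply: KL_class_eq => x; first by rewrite inE => /eqP->; split; apply: KL_refl.
move=> x1 x2; rewrite inE; apply/eqP.
case: (le_up upv x1 (or_introl erefl)) => // xw; rewrite xw in x2.
by have E := le_up upw x2 erefl; move: w0v0; rewrite E eqxx.
Qed.

Lemma pos_class_t : KL_class C t = [set t].
Proof.
have tt : t \in ending d t s by apply: (s_ending D').
apply: KL_class_eq => x; first by rewrite inE => /eqP->; split; apply: KL_refl.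
move=> x1 x2; rewrite inE; apply/negPn/negP=> N.
have xt := le_up upt x1 tt.
have xx : (x \in ending d t s) && (x != t) by rewrite xt.
by have := le_up uptt x2 xx; rewrite eqxx andbF.
Qed.

Lemma pos_char_1 : lin_ex s t true true /\
  KL_char T C [set 1%g] = lin_char R s t true true.
Proof.
apply: (KL_char_single hC D hT pos_class1).
  by rewrite Ms_1 one_s eqxx sub0r.
by have := Mt_s (ltnW d1) 1%g; rewrite /= mulg1 one_t eqxx qt mulr1 sub0r.
Qed.

Lemma pos_char_t : lin_ex s t true false /\
  KL_char T C [set t] = lin_char R s t true false.
Proof.
apply: (KL_char_single hC D hT pos_class_t).
  by rewrite Ms_t t_st2 eqxx sub0r.
by have := Mt_t (ltnW d1) t; rewrite -t1 eqxx.
Qed.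

Lemma pos_char_w0 : lin_ex s t false false /\
  KL_char T C [set w0] = lin_char R s t false false.
Proof.
apply: (KL_char_single hC D hT pos_class_w0).
  by have := Ms_s dd w0; rewrite -w0E eqxx.
have := Mt_t dd w0; rewrite (_ : alt t s d.-1.+1 = w0) ?eqxx //.
by rewrite (dih_braid D) prednK // ltnW.
Qed.

Lemma pos_char_v0 : lin_ex s t false true /\
  KL_char T C [set v0] = lin_char R s t false true.
Proof.
apply: (KL_char_single hC D hT pos_class_v0).
  have d2 : (d.-2 < d)%N by lia.
  by have := Ms_s d2 v0; rewrite -v0E eqxx.
rewrite (Mt_s dd) (_ : alt t s d.-1.+1 = w0); last first.
  by rewrite (dih_braid D) prednK // ltnW.
by rewrite eq_sym (negbTE w0v0) eqxx qt mulr1 sub0r.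
Qed.

End Positive.

Section Zero.
Hypothesis c0 : c t = 0.
Let qt : edeg (qneg c t) = 0. Proof. by rewrite /qneg c0 ltxx raddf0. Qed.
Let up1 := ne_upper_1t hbar hC D hT cs0 ct0 cts d_even c0.

Let Mt_t n : (n < d)%N -> forall x, M t x (alt t s n.+1) = (x == alt s t n)%:R.
Proof.
move=> nd x; rewrite (KL_M_gen c hC) (ne_act_t0 hbar hC D hT cs0 ct0 cts nd c0) cC qt.
by rewrite mul0r subr0; case: (x == _); rewrite ?rmorph1 ?rmorph0.
Qed.

Let eqv_t n : (n < d)%N -> KL_eqv C (alt t s n.+1) (alt s t n).
Proof.
move=> nd; split; apply: (@le_step _ _ _ _ (Cg t)).
  by rewrite (ne_act_t hbar hC D hT cs0 ct0 cts nd) cC eqxx; apply/eqP/oner_neq0.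
by rewrite (ne_act_t0 hbar hC D hT cs0 ct0 cts nd c0) cC eqxx; apply/eqP/oner_neq0.
Qed.

Lemma zero_class1 : KL_class C 1%g = [set 1%g; t].
Proof.
apply: KL_class_eq => x.
  case/set2P=> ->; first by split; apply: KL_refl.
  by have := eqv_t (ltnW d1); rewrite -t1.
move=> _ x1; apply/negPn/negP; rewrite !inE negb_or => N.
by have := le_up up1 x1 N; rewrite eqxx.
Qed.

Let w0t : w0 = alt t s d.-1.+1.
Proof. by rewrite (dih_braid D) prednK // ltnW. Qed.

Lemma zero_class_w0 : KL_class C w0 = [set w0; v0].
Proof.
apply: KL_class_eq => x.
  case/set2P=> ->; first by split; apply: KL_refl.
  by rewrite w0t; apply: KL_eqv_sym; apply: (eqv_t dd).
by move=> x1 _; apply/set2P; case: (le_up upv x1 (or_intror erefl)); auto.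
Qed.

Lemma zero_char1 : [/\ lin_ex s t true false, lin_ex s t true true &
  KL_char T C [set 1%g; t] =
  fun x => lin_char R s t true false x + lin_char R s t true true x].
Proof.
have N : 1%g != t by rewrite one_t.
have A x : M t x 1%g = (x == t)%:R.
  by have := Mt_s (ltnW d1) x; rewrite -t1 qt mul0r subr0.
have B x : M t x t = (x == 1%g)%:R.
  by have := Mt_t (ltnW d1) x; rewrite -t1.
apply: (KL_char_pair hC D hT N zero_class1); rewrite ?Ms_1 ?Ms_t ?A ?B ?eqxx.
- by rewrite one_s sub0r.
- by rewrite t_st2 sub0r.
- by rewrite one_t subr0 eq_sym (negbTE (alt_neq1 D d1)).
- by rewrite t_s eq_sym one_t subr0.
- by rewrite one_t.
- by rewrite eq_sym one_t.
- by [].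
- by [].
Qed.

Lemma zero_char_w0 : [/\ lin_ex s t false false, lin_ex s t false true &
  KL_char T C [set w0; v0] =
  fun x => lin_char R s t false false x + lin_char R s t false true x].
Proof.
have A x : M s x w0 = (x == w0)%:R by have := Ms_s dd x; rewrite -w0E.
have d2 : (d.-2 < d)%N by lia.
have B x : M s x v0 = (x == v0)%:R by have := Ms_s d2 x; rewrite -v0E.
have A' x : M t x w0 = (x == v0)%:R by have := Mt_t dd x; rewrite -w0t.
have B' x : M t x v0 = (x == w0)%:R.
  by have := Mt_s dd x; rewrite -w0t qt mul0r subr0.
apply: (KL_char_pair hC D hT w0v0 zero_class_w0);
  by rewrite ?A ?B ?A' ?B' ?eqxx // ?(negbTE w0v0) // eq_sym (negbTE w0v0).
Qed.

End Zero.

Lemma ne_lin_ex p q : lin_ex s t p q.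
Proof.
case: (ltrP 0 (c t)) => ct.
  case: (pos_char_1 ct) (pos_char_t ct) (pos_char_w0 ct) (pos_char_v0 ct) => ? _ [? _] [? _] [? _].
  by case: p; case: q.
have c0 : c t = 0 by apply/eqP; rewrite eq_le ct ct0.
case: (zero_char1 c0) (zero_char_w0 c0) => ? ? _ [? ? _].
by case: p; case: q.
Qed.

Lemma ne_char_P : KL_char T C [set w0; v0] =
  fun x => lin_char R s t false false x + lin_char R s t false true x.
Proof.
case: (ltrP 0 (c t)) => ct.
  apply/funext=> x; rewrite KL_charD ?(pos_char_w0 ct).2 ?(pos_char_v0 ct).2 //.
  by rewrite finset.disjoints1 inE.
have c0 : c t = 0 by apply/eqP; rewrite eq_le ct ct0.
by case: (zero_char_w0 c0).
Qed.

Lemma ne_char_Q : KL_char T C [set 1%g; t] =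
  fun x => lin_char R s t true false x + lin_char R s t true true x.
Proof.
case: (ltrP 0 (c t)) => ct.
  apply/funext=> x; rewrite KL_charD ?(pos_char_1 ct).2 ?(pos_char_t ct).2.
    by rewrite addrC.
  by rewrite finset.disjoints1 inE one_t.
have c0 : c t = 0 by apply/eqP; rewrite eq_le ct ct0.
by case: (zero_char1 c0).
Qed.

Hypothesis fixE : forall x, (#|[set w | (x * w * s)%g == w]|)%:R = fix_char R s t x.

Lemma ne_char_ending x :
  KL_char T C (ending d s t) x *+ 2 = reg_char R x + fix_char R s t x.
Proof.
rewrite -fixE; apply: (KL_char_ind hbar hC D hT cs0 ups (s_ending D)).
exact: ne_ending_r.
Qed.

(** From half of reg + fix one takes away the two linear characters trivial on s, carried by [w0]
    and [v0]. The words ending in t then follow by taking the complement in the regular character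
    ([ne_char_t]). *)
Lemma ne_char_s : KL_char T C ne_s = chi2 R s t.
Proof.
apply/funext=> x; have I := ne_char_ending x.
have PE : [set w0; v0] \subset ending d s t.
  by apply/fintype.subsetP=> y /set2P[] ->; [apply: w0_ending | apply: v0_ending].
have E1 : KL_char T C (ending d s t) x =
   KL_char T C [set w0; v0] x + KL_char T C ne_s x.
  rewrite -KL_charD; last first.
    rewrite -finset.setI_eq0; apply/eqP/setP=> y; rewrite !inE.
    by case: (y == w0); case: (y == v0).
  by rewrite -{1}(finset.setID (ending d s t) [set w0; v0]) (finset.setIidPr PE).
apply: (@mulIf _ 2%:R); first by rewrite pnatr_eq0.
move: I; rewrite E1 ne_char_P /chi2 mulfVK ?pnatr_eq0 // mulrnDl => I.
rewrite mulr_natr; apply: (addrI ((lin_char R s t false false x +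
  lin_char R s t false true x) *+ 2)).
by rewrite I sum_linE // /fix_char; exact: half_sum_identity2.
Qed.

Lemma ne_char_t : KL_char T C ne_t = chi2 R s t.
Proof.
apply/funext=> x; have I := ne_char_ending x.
have one_e : 1%g \notin ending d s t by have := ending_s D (leq0n d) => /= ->.
have t_e : t \notin ending d s t.
  by have := ending_t D (ltnW d1); rewrite -t1 => ->; move: d1; lia.
have E1 : reg_char R x = KL_char T C (ending d s t) x +
   (KL_char T C [set 1%g; t] x + KL_char T C ne_t x).
  rewrite /reg_char -(KL_char_setT hC D hT) -!KL_charD.
  - congr (KL_char T C _ x); apply/setP=> y; rewrite /ne_t !inE.
    by case: (y == 1%g); case: (y == t); case: [exists _, _].
  - rewrite -finset.setI_eq0; apply/eqP/setP=> y; rewrite /ne_t finset.in_setI finset.in_setU.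
    rewrite finset.in_setC finset.in_setU finset.in_set2 finset.in_set0.
    case: eqP => [->|_]; first by rewrite (negbTE one_e).
    case: eqP => [->|_]; first by rewrite (negbTE t_e).
    by rewrite /= orbF; case: (y \in _).
  - rewrite -finset.setI_eq0; apply/eqP/setP=> y; rewrite /ne_t finset.in_setI.
    rewrite finset.in_setC finset.in_setU finset.in_set2 finset.in_set0.
    by case: (_ || _); rewrite ?orbT //= andbF.
apply: (@mulIf _ 2%:R); first by rewrite pnatr_eq0.
rewrite /chi2 mulfVK ?pnatr_eq0 // mulr_natr.
move: E1 => /(congr1 (fun u => u *+ 2)); rewrite /= ne_char_Q !mulrnDl I => E1.
by apply: (half_sum_identity3 E1); rewrite sum_linE.
Qed.

Let ab_neq0 p q : wt (c s) (c t) p q != 0.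
Proof.
rewrite /wt; case: p; case: q; rewrite ?expr0 ?expr1 ?mul1r ?mulN1r.
- by rewrite -opprD oppr_eq0 gt_eqF // ltr_wpDr.
- by rewrite addrC subr_eq0 lt_eqF.
- by rewrite subr_eq0 gt_eqF.
- by rewrite gt_eqF // ltr_wpDr.
Qed.

(** Since a > b >= 0, no weight vanishes and the second family of [cellular_char] is empty. *)
Lemma KL_unequal gamma :
  KL_cellular T C gamma <-> cellular_char d s t (c s) (c t) gamma.
Proof.
rewrite KL_cellularE /cellular_char (gt_eqF cs0) /=.
have cs_neq0 : c s != 0 by rewrite gt_eqF.
split=> [[w ->]|].
  have [wQ|wP|wS] : [\/ w \in [set 1%g; t], w \in [set w0; v0] |
     w \in ne_s \/ w \in ne_t].
    have := ne_cover w; rewrite finset.in_setU => /orP[|]; first by constructor 1.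
    rewrite finset.in_setU => /orP[|]; first by constructor 2.
    by rewrite finset.in_setU => /orP[|]; constructor 3; [left | right].
  - constructor 1; case: (ltrP 0 (c t)) => ct.
      have ct_neq0 : c t != 0 by rewrite gt_eqF.
      case/set2P: wQ => ->.
        exists true, true; rewrite ab_neq0 (pos_class1 ct) (pos_char_1 ct).2.
        by rewrite lin_block_neq0 //; split=> //; apply: ne_lin_ex.
      exists true, false; rewrite ab_neq0 (pos_class_t ct) (pos_char_t ct).2.
      by rewrite lin_block_neq0 //; split=> //; apply: ne_lin_ex.
    have c0 : c t = 0 by apply/eqP; rewrite eq_le ct ct0.
    have -> : KL_class C w = [set 1%g; t].
      rewrite -(zero_class1 c0); apply: KL_eqv_class.
      by move: wQ; rewrite -(zero_class1 c0) inE => /asboolP.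
    exists true, true; rewrite ab_neq0 ne_char_Q c0 lin_block_eq0 //.
    by split=> //; apply: ne_lin_ex.
  - constructor 1; case: (ltrP 0 (c t)) => ct.
      have ct_neq0 : c t != 0 by rewrite gt_eqF.
      case/set2P: wP => ->.
        exists false, false; rewrite ab_neq0 (pos_class_w0 ct) (pos_char_w0 ct).2.
        by rewrite lin_block_neq0 //; split=> //; apply: ne_lin_ex.
      exists false, true; rewrite ab_neq0 (pos_class_v0 ct) (pos_char_v0 ct).2.
      by rewrite lin_block_neq0 //; split=> //; apply: ne_lin_ex.
    have c0 : c t = 0 by apply/eqP; rewrite eq_le ct ct0.
    have -> : KL_class C w = [set w0; v0].
      rewrite -(zero_class_w0 c0); apply: KL_eqv_class.
      by move: wP; rewrite -(zero_class_w0 c0) inE => /asboolP.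
    exists false, false; rewrite ab_neq0 ne_char_P c0 lin_block_eq0 //.
    by split=> //; apply: ne_lin_ex.
  - constructor 3; case: wS => [/ne_sP|/ne_tP] [d2 ws].
      by split=> // ; rewrite (KL_eqv_class ws) ne_class_s // ne_char_s.
    by split=> // ; rewrite (KL_eqv_class ws) ne_class_t // ne_char_t.
case=> [[p [q [ex _ ->]]]|[p [q [_ /eqP N _]]]|[d2 _ ->]].
- case: (ltrP 0 (c t)) => ct.
    have ct_neq0 : c t != 0 by rewrite gt_eqF.
    rewrite lin_block_neq0 //; case: p {ex}; case: q.
    + by exists 1%g; rewrite (pos_class1 ct) (pos_char_1 ct).2.
    + by exists t; rewrite (pos_class_t ct) (pos_char_t ct).2.
    + by exists v0; rewrite (pos_class_v0 ct) (pos_char_v0 ct).2.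
    + by exists w0; rewrite (pos_class_w0 ct) (pos_char_w0 ct).2.
  have c0 : c t = 0 by apply/eqP; rewrite eq_le ct ct0.
  rewrite c0 lin_block_eq0 //; case: p {ex}.
    by exists 1%g; rewrite (zero_class1 c0) ne_char_Q.
  by exists w0; rewrite (zero_class_w0 c0) ne_char_P.
- by rewrite (negbTE (ab_neq0 p q)) in N.
- by exists s; rewrite ne_class_s // ne_char_s.
Qed.

End UnequalCells.

(** * Exchange of the generators and sign twists *)

Section Swap.
Variables (R : realType) (gT : finGroupType) (d : nat) (s t : gT).
Hypothesis D : dihedral d s t.
Implicit Types (x y : gT).

Lemma is_lin_swap (p q : bool) (e : gT -> bool) : is_lin t s p q e <-> is_lin s t q p e.
Proof. by split=> -[eM e1 e2]; split. Qed.

Lemma lin_ex_swap p q : lin_ex t s p q <-> lin_ex s t q p.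
Proof. by split=> -[e /is_lin_swap le]; exists e. Qed.

Lemma lin_char_swap p q x : lin_char R t s p q x = lin_char R s t q p x.
Proof.
have [[e le]|N] := pselect (exists e, is_lin s t q p e).
  rewrite (lin_charE R D x le).
  by apply: (lin_charE R (dihedral_sym D)); apply/is_lin_swap.
rewrite (lin_char0 R x N) lin_char0 // => -[e le]; apply: N.
by exists e; apply/is_lin_swap.
Qed.

Lemma chi2_swap x : chi2 R t s x = chi2 R s t x.
Proof.
rewrite /chi2; congr ((_ - _) / _); rewrite !sum_linE !lin_char_swap.
by rewrite -!addrA; congr (_ + _); rewrite addrCA.
Qed.

Lemma lin_block_swap (a b : R) p q x : lin_block t s b a p q x = lin_block s t a b q p x.
Proof.
rewrite !lin_blockE exchange_big; apply: eq_bigr => q' _; apply: eq_bigr => p' _.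
by rewrite /same_wt andbC lin_char_swap.
Qed.

Lemma cellular_char_swap (a b : R) gamma :
  cellular_char d t s b a gamma -> cellular_char d s t a b gamma.
Proof.
rewrite /cellular_char andbC; case: ifP => // _.
have wtC p q : wt b a p q = wt a b q p by rewrite /wt addrC.
case=> [[p [q [ex N ->]]]|[p [q [ex N ->]]]|[d2 N ->]].
- constructor 1; exists q, p; split; [exact/lin_ex_swap | by rewrite -wtC |].
  by apply/funext=> x; rewrite lin_block_swap.
- constructor 2; exists q, p; split; [exact/lin_ex_swap | by rewrite -wtC |].
  by apply/funext=> x; rewrite lin_char_swap chi2_swap.
- constructor 3; split=> //; last by apply/funext=> x; rewrite chi2_swap.
  by move=> p q /lin_ex_swap ex; rewrite -wtC; apply: N.
Qed.

(* Multiplication by the sign character [e] turns the parameters (a, b) into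
   ((-1)^p0 a, (-1)^q0 b). *)
Section Twist.
Variables (p0 q0 : bool) (e : gT -> bool) (le : is_lin s t p0 q0 e).

Lemma lin_ex_twist p q : lin_ex s t p q -> lin_ex s t (p (+) p0) (q (+) q0).
Proof. by case=> e' le'; exists (fun x => e' x (+) e x); apply: is_linD. Qed.

Lemma lin_char_twist p q x :
  (-1) ^+ (e x) * lin_char R s t p q x = lin_char R s t (p (+) p0) (q (+) q0) x.
Proof.
have [[e' le']|N] := pselect (exists e, is_lin s t p q e).
  rewrite (lin_charE R D x le') (lin_charE R D x (is_linD le' le)).
  by rewrite signr_addb mulrC.
rewrite (lin_char0 R x N) mulr0 lin_char0 // => -[e' le'].
have := is_linD le' le; rewrite -!addbA !addbb !addbF => le2.
by apply: N; eexists; apply: le2.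
Qed.

Lemma e1 : e 1%g = false.
Proof. by case: le => eM _ _; have := eM 1%g 1%g; rewrite mulg1; case: (e 1%g). Qed.

Lemma reg_char_twist x : (-1) ^+ (e x) * reg_char R x = reg_char R x.
Proof.
rewrite /reg_char; case: (eqVneq x 1%g) => [->|_]; first by rewrite e1 expr0 mul1r.
by rewrite muln0 mulr0.
Qed.

Let sh (pq : bool * bool) := (pq.1 (+) p0, pq.2 (+) q0).
Let sh_inj : injective sh.
Proof. by apply: (can_inj (g := sh)) => -[p q]; rewrite /sh /= -!addbA !addbb !addbF. Qed.

Lemma chi2_twist x : (-1) ^+ (e x) * chi2 R s t x = chi2 R s t x.
Proof.
rewrite /chi2 mulrA; congr (_ / _); rewrite mulrBr reg_char_twist; congr (_ - _).
rewrite /sum_lin mulr_sumr [RHS](reindex_inj sh_inj) /=.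
by apply: eq_bigr => -[p q] _ /=; rewrite lin_char_twist.
Qed.

Let sgn2 (p p' : bool) (a : R) : (-1) ^+ (p (+) p') * ((-1) ^+ p' * a) = (-1) ^+ p * a.
Proof. by rewrite mulrA -signr_addb -addbA addbb addbF. Qed.

Lemma lin_block_twist (a b : R) p q x :
  (-1) ^+ (e x) * lin_block s t a b p q x =
  lin_block s t ((-1) ^+ p0 * a) ((-1) ^+ q0 * b) (p (+) p0) (q (+) q0) x.
Proof.
rewrite /lin_block mulr_sumr [RHS](reindex_inj sh_inj) /=.
apply: eq_big => -[p' q'] /=; first by rewrite /same_wt !sgn2.
by rewrite lin_char_twist.
Qed.

Lemma cellular_char_twist (a b : R) gamma : cellular_char d s t a b gamma ->
  cellular_char d s t ((-1) ^+ p0 * a) ((-1) ^+ q0 * b)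
    (fun x => (-1) ^+ (e x) * gamma x).
Proof.
rewrite /cellular_char !mulf_eq0 !signr_eq0 /=; case: ifP => [_ ->|_].
  by apply/funext=> x; rewrite reg_char_twist.
have wtT p q : wt ((-1) ^+ p0 * a) ((-1) ^+ q0 * b) (p (+) p0) (q (+) q0) = wt a b p q.
  by rewrite /wt !sgn2.
case=> [[p [q [ex N ->]]]|[p [q [ex N ->]]]|[d2 N ->]].
- constructor 1; exists (p (+) p0), (q (+) q0); rewrite wtT; split=> //.
    exact: lin_ex_twist.
  by apply/funext=> x; rewrite lin_block_twist.
- constructor 2; exists (p (+) p0), (q (+) q0); rewrite wtT; split=> //.
    exact: lin_ex_twist.
  by apply/funext=> x; rewrite mulrDr lin_char_twist chi2_twist.
- constructor 3; split=> //; last by apply/funext=> x; rewrite chi2_twist.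
  move=> p q ex; have := N _ _ (lin_ex_twist ex).
  by have := wtT (p (+) p0) (q (+) q0); rewrite -!addbA !addbb !addbF => ->.
Qed.

Section TwistKL.
Variables (c : gT -> R) (H : algType (expring R)) (T : gT -> H).
Variables (bar : {rmorphism H -> H}) (hbar : is_bar_involution T bar).
Variables (C : gT -> H) (hC : is_KL_basis T bar C).
Local Notation sg x := ((-1) ^+ (e x)).

Let sgM x y : (sg (x * y)%g : expring R) = sg x * sg y.
Proof. by case: le => eM _ _; rewrite eM signr_addb. Qed.

Let sgK x : (sg x : expring R) * sg x = 1.
Proof. by rewrite -expr2 sqrr_sign. Qed.

Let eV x : e x^-1%g = e x.
Proof.
case: le => eM _ _; have := eM x x^-1%g; rewrite mulgV e1.
by case: (e x); case: (e _).
Qed.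

Definition twist (b : gT -> H) : gT -> H := fun x => (sg x : expring R) *: b x.

Lemma lincomb_twist b a : lincomb (twist b) a = lincomb b [ffun x => sg x * a x].
Proof. by apply: eq_bigr => x _; rewrite ffunE scalerA mulrC. Qed.

Lemma twist_basis b : is_basis b -> is_basis (twist b).
Proof.
case=> g gK Kg; exists (fun h => [ffun x => sg x * g h x]) => [a|h].
  by rewrite lincomb_twist gK; apply/ffunP=> x; rewrite !ffunE mulrA sgK mul1r.
rewrite lincomb_twist -[RHS]Kg; congr lincomb.
by apply/ffunP=> x; rewrite !ffunE mulrA sgK mul1r.
Qed.

Lemma coords_twist b h x : is_basis b -> coords (twist b) h x = sg x * coords b h x.
Proof.
move=> bB; have -> : h = lincomb (twist b) [ffun x => sg x * coords b h x].
  rewrite lincomb_twist -[LHS](coordsK bB); congr lincomb.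
  by apply/ffunP=> y; rewrite !ffunE mulrA sgK mul1r.
rewrite (lincombK (twist_basis bB)) ffunE lincomb_twist.
congr (_ * _); rewrite (lincombK bB) ffunE.
by rewrite ffunE mulrA sgK mul1r.
Qed.

Lemma twist_mul b h y : h * twist b y = (sg y : expring R) *: (h * b y).
Proof. by rewrite /twist -scalerAr. Qed.

(** The element -T_u has the eigenvalues v^(-c_u) and -v^(c_u), which are those prescribed by the
    parameter -c_u. *)
Lemma twist_Hecke : is_Hecke_algebra [set s; t] c T ->
  forall c', c' s = (-1) ^+ p0 * c s -> c' t = (-1) ^+ q0 * c t ->
  is_Hecke_algebra [set s; t] c' (twist T).
Proof.
move=> hT c' cs' ct'; split; first exact: (twist_basis (Hecke_basis hT)).
- move=> w w' E; rewrite /twist -scalerAr -scalerAl scalerA (Hecke_mul hT E).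
  by rewrite sgM mulrC.
- have [_ es et] := le.
  move=> u us; have := Hecke_quad hT us.
  have -> : c' u = (-1) ^+ (e u) * c u.
    by move: us; rewrite !inE => /orP[]/eqP->; rewrite ?es ?et.
  rewrite /twist; case: (e u); rewrite ?expr0 ?expr1 ?mul1r ?scale1r //.
  rewrite !mulN1r opprK scaleN1r => E.
  rewrite -opprD mulNr -mulrN opprD opprK addrC -[RHS]E.
  rewrite !mulrDr !mulrDl !mulNr !mulrN !mulr_algl !mulr_algr.
  rewrite !scalerA -!vexpD subrr addNr.
  have cB := Hecke_basis hT; Hmod cB.
Qed.

Let bar_sg (b : {rmorphism H -> H}) x h :
  b ((sg x : expring R) *: h) = (sg x : expring R) *: b h.
Proof. by case: (e x); rewrite ?scaleN1r ?scale1r // raddfN. Qed.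

Lemma twist_bar : is_bar_involution (twist T) bar.
Proof.
split; [exact: bar_involutive hbar | exact: bar_vexp hbar|] => w.
have [b1 b2] := bar_T hbar w.
rewrite /twist bar_sg -!scalerAl -!scalerAr !scalerA eV sgK !scale1r.
by [].
Qed.

Lemma twist_KL : is_Hecke_algebra [set s; t] c T ->
  is_KL_basis (twist T) bar (twist C).
Proof.
move=> hT; split; first exact: (twist_basis (KL_basis hC)).
  by move=> w; rewrite /twist bar_sg (KL_bar hC).
move=> w; have [a [na E]] := KL_triangular hC w.
exists [ffun x => sg w * (sg x * a x)]; split.
  move=> x; rewrite ffunE.
  have N p y : exp_neg p -> exp_neg ((sg y : expring R) * p).
    by case: (e y); rewrite ?mulN1r ?mul1r // => np; apply: exp_negN.
  exact/N/N.
rewrite /twist E scalerDr; congr (_ + _); rewrite lincomb_twist.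
rewrite /lincomb scaler_sumr; apply: eq_bigr => x _.
rewrite !ffunE scalerA; congr (_ *: _).
by rewrite [RHS]mulrCA (mulrA (sg x)) sgK mul1r.
Qed.

Lemma coords_twist_neq0 h x y :
  coords (twist C) (h * twist C y) x <> 0 <-> coords C (h * C y) x <> 0.
Proof.
have cB := KL_basis hC; rewrite (coords_twist _ _ cB) twist_mul coordsZ //.
by case: (e x); case: (e y); rewrite ?mulN1r ?mul1r ?opprK //;
  split=> N E; apply: N; rewrite ?E ?oppr0 //; apply/eqP; rewrite -oppr_eq0 E.
Qed.

(** Signs do not change which coordinates vanish, so the cells stay the same and only the characters
    are multiplied by the sign. *)
Lemma KL_le_twist : KL_le (twist C) = KL_le C.
Proof.
rewrite /KL_le; congr clos_refl_trans; apply/funext=> x; apply/funext=> y.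
by apply/propext; split=> -[h /coords_twist_neq0 N]; exists h.
Qed.

Lemma KL_class_twist w : KL_class (twist C) w = KL_class C w.
Proof. by apply/setP=> x; rewrite !inE /KL_eqv KL_le_twist. Qed.

Lemma KL_char_twist G :
  KL_char (twist T) (twist C) G = fun x => sg x * KL_char T C G x.
Proof.
have cB := KL_basis hC.
apply/funext=> x; rewrite /KL_char mulr_sumr; apply: eq_bigr => w _.
rewrite /KL_M (coords_twist _ _ cB) twist_mul coordsZ // -scalerAl coordsZ //.
rewrite [sg w * (_ * _)]mulrA sgK mul1r rmorphM rmorph_sign rmorphM /=.
by rewrite rmorph_sign.
Qed.

Lemma KL_cellular_twist gamma : KL_cellular T C gamma <->
  KL_cellular (twist T) (twist C) (fun x => sg x * gamma x).
Proof.
rewrite !KL_cellularE; split=> -[w E]; exists w.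
  by rewrite KL_class_twist KL_char_twist E.
move: E; rewrite KL_class_twist KL_char_twist => E.
apply/funext=> x; have /(congr1 (fun f => sg x * f x)) := E.
by rewrite /= !mulrA -!expr2 !sqrr_sign !mul1r.
Qed.

End TwistKL.
End Twist.
End Swap.

(** * Kazhdan-Lusztig cellular characters for all real parameters *)

Section KLMain.
Variables (R : realType) (gT : finGroupType) (d : nat).
Variables (H : algType (expring R)).
Variables (bar : {rmorphism H -> H}).

Lemma KL_equal (c : gT -> R) T C s t (hbar : is_bar_involution T bar)
  (hC : is_KL_basis T bar C) (D : dihedral d s t)
  (hT : is_Hecke_algebra [set s; t] c T) :
  0 < c s -> c t = c s ->
  (forall x, (#|[set w | (x * w * s)%g == w]|)%:R = fix_char R s t x) ->
  (forall x, (#|[set w | (x * w * t)%g == w]|)%:R = fix_char R t s x) ->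
  (~~ odd d -> forall p q, lin_ex s t p q) ->
  forall gamma, KL_cellular T C gamma <-> cellular_char d s t (c s) (c t) gamma.
Proof.
move=> cs0 cts fs ft lex gamma.
have ct0 : 0 < c t by rewrite cts.
have D' := dihedral_sym D; have hT' := is_Hecke_sym hT.
have cs_neq0 : c s != 0 by rewrite gt_eqF.
have ct_neq0 : c t != 0 by rewrite gt_eqF.
have wt_eq p : wt (c s) (c t) p p != 0.
  rewrite /wt cts -mulrDr mulf_eq0 signr_eq0 /= gt_eqF //.
  by rewrite -mulr2n pmulrn_lgt0.
have wt_ne p : wt (c s) (c t) p (~~ p) = 0.
  by rewrite /wt cts; case: p; rewrite expr0 expr1 mulN1r mul1r ?addNr ?subrr.
have E1 := eq_class1 hbar hC D hT cs0 cts.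
have [x1 C1] := eq_char_1 hbar hC D hT cs0 cts.
have E0 := eq_class_w0 hbar hC D hT cs0 cts.
have [x0 C0] := eq_char_w0 hbar hC D hT cs0 cts.
have Cs := eq_char_s hbar hC D hT cs0 cts fs.
have Ct (d1 : (1 < d)%N) : KL_char T C (KL_class C t) =
    fun x => lin_char R s t true false x + chi2 R s t x.
  rewrite (eq_char_s hbar hC D' hT' ct0 (esym cts) ft d1).
  by apply/funext=> x; rewrite (lin_char_swap _ D) (chi2_swap _ D).
(* Multiplication by e_{1,1}, which exists, exchanges the two mixed characters. *)
have lexN p : lin_ex s t p (~~ p) -> forall q, lin_ex s t q (~~ q).
  case=> e0 le0 q; have [e2 le2] := x1.
  case: (eqVneq p q) le0 => [->|pq] le0; first by exists e0.
  have := is_linD le0 le2; rewrite !addbT negbK.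
  have -> : ~~ p = q by move: pq; case: (p); case: (q).
  have -> : p = ~~ q by move: pq; case: (p); case: (q).
  by move=> ?; eexists; eauto.
(* If the mixed character does not exist, its [lin_char] is 0 and the cell carries [chi2] alone, the
   third family; d = 2 is then impossible, since d even makes all four linear characters exist. *)
have C3 p : (1 < d)%N -> cellular_char d s t (c s) (c t)
     (fun x => lin_char R s t p (~~ p) x + chi2 R s t x).
  move=> d1; rewrite /cellular_char (negbTE cs_neq0) /=.
  have [ex|N] := pselect (lin_ex s t p (~~ p)).
    by constructor 2; exists p, (~~ p).
  constructor 3; split; last first.
  - by apply/funext=> x; rewrite (lin_char0 R x N) add0r.
  - move=> p' q' ex; case: (eqVneq q' p') => [->|qp]; first exact: wt_eq.
    have qE : q' = ~~ p' by move: qp; case: (q'); case: (p').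
    by rewrite qE in ex; case: N; apply: lexN ex _.
  - rewrite ltn_neqAle d1 andbT; apply/eqP=> d2; apply: N; apply: lex.
    by rewrite -d2.
rewrite KL_cellularE; split=> [[w ->]|].
  have [k kd wk] := wordP D w.
  case: (eqVneq k 0%N) => [k0|k0].
    have -> : w = 1%g by move: wk; rewrite k0 => -[] ->.
    rewrite E1 C1 /cellular_char (negbTE cs_neq0) /=; constructor 1.
    by exists true, true; rewrite lin_block_neq0.
  case: (eqVneq k d) => [kE|kd'].
    have -> : w = alt s t d by move: wk; rewrite kE => -[] ->; rewrite ?(dih_braid D).
    rewrite E0 C0 /cellular_char (negbTE cs_neq0) /=; constructor 1.
    by exists false, false; rewrite lin_block_neq0.
  have {}kd : (k < d)%N by rewrite ltn_neqAle kd'.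
  have k1 : (0 < k)%N by rewrite lt0n.
  have d1 : (1 < d)%N by lia.
  have A : KL_eqv C w s \/ KL_eqv C w t.
    have A1 := eq_eqv hbar hC D hT cs0 cts k1 kd.
    have A2 := eq_eqv hbar hC D' hT' ct0 (esym cts) k1 kd.
    by move: A1 A2; rewrite /ew; case: odd; case: wk => ->; auto.
  case: A => /KL_eqv_class ->; first by rewrite Cs //; apply: (C3 false).
  by rewrite Ct //; apply: (C3 true).
rewrite /cellular_char (negbTE cs_neq0) /=.
have R3 p : (1 < d)%N -> exists w,
    (fun x => lin_char R s t p (~~ p) x + chi2 R s t x) = KL_char T C (KL_class C w).
  by case: p => d1; [exists t; rewrite Ct | exists s; rewrite Cs].
case=> [[p [q [ex N ->]]]|[p [q [ex N ->]]]|[d2 N ->]].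
- have qE : q = p.
    case: (eqVneq q p) => // qp; move: N.
    have -> : q = ~~ p by move: qp; case: (q); case: (p).
    by rewrite wt_ne eqxx.
  rewrite qE lin_block_neq0 //; case: p {ex N qE}.
    by exists 1%g; rewrite E1 C1.
  by exists (alt s t d); rewrite E0 C0.
- have qE : q = ~~ p.
    case: (eqVneq q p) => [qp|]; last by case: (q); case: (p).
    by move: (wt_eq p); rewrite -{2}qp N eqxx.
  rewrite qE in ex *; apply: R3.
  by case: (card_dih_gt1 D p) => // -[].
- have [w E] := R3 false (ltnW d2); exists w; rewrite -E.
  apply/funext=> x; rewrite lin_char0 ?add0r // => ex.
  by have := N _ _ ex; rewrite wt_ne eqxx.
Qed.

(** With c = 0 every T_w is bar-invariant, so C_w = T_w and generators permute this basis. Any two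
    elements are then linked in both directions, which leaves a single cell. *)
Lemma KL_zero (c : gT -> R) T C s t (hbar : is_bar_involution T bar)
  (hC : is_KL_basis T bar C) (D : dihedral d s t)
  (hT : is_Hecke_algebra [set s; t] c T) :
  c s = 0 -> c t = 0 ->
  forall gamma, KL_cellular T C gamma <-> cellular_char d s t (c s) (c t) gamma.
Proof.
move=> cs0 ct0 gamma; rewrite /cellular_char cs0 ct0 eqxx /=.
have D' := dihedral_sym D; have hT' := is_Hecke_sym hT.
have q0 u : c u = 0 -> qdiff c u = 0 by move=> cu; rewrite /qdiff cu oppr0 subrr.
have cB := KL_basis hC; have hB := Hecke_basis hT.
have key a b (E : dihedral d a b) (hE : is_Hecke_algebra [set a; b] c T) n :
    c a = 0 -> c b = 0 -> (n <= d)%N ->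
    T a * T (alt a b n) = T (a * alt a b n)%g /\
    T b * T (alt a b n) = T (b * alt a b n)%g.
  move=> ca cb nd; split.
    case: n nd => [|n] nd; first by rewrite mulg1 /= (Hecke_T1 E hE) mulr1.
    by rewrite (Hecke_alt_sq E hE nd) q0 // scale0r addr0 (dih_altK E).
  move: nd; rewrite leq_eqVlt => /orP[/eqP->|nd]; last first.
    by rewrite (Hecke_altS (dihedral_sym E) (is_Hecke_sym hE) nd).
  rewrite (dih_braid E); have d0 := dih_gt0 E.
  have -> : alt b a d = alt b a d.-1.+1 by rewrite prednK.
  have E' := dihedral_sym E; have d1 : (d.-1 < d)%N by rewrite prednK.
  by rewrite (Hecke_alt_sq E' (is_Hecke_sym hE) d1) q0 // scale0r addr0 (dih_altK E').
have TT y : T s * T y = T (s * y)%g /\ T t * T y = T (t * y)%g.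
  have [n nd [->|->]] := wordP D y; first exact: key.
  by have [] := key t s D' hT' n ct0 cs0 nd.
have CT w : C w = T w.
  apply/esym/(KL_uniq D hT hbar hC); last by rewrite subrr; apply: (Neg0 hT).
  move: w; apply: (dih_ind D) => [|x IH|x IH].
  - by rewrite (Hecke_T1 D hT) rmorph1.
  - rewrite -(TT x).1 rmorphM IH (bar_Ts D hT hbar); last by left.
    by rewrite q0 // scale0r subr0.
  - rewrite -(TT x).2 rmorphM IH (bar_Ts D hT hbar); last by right.
    by rewrite q0 // scale0r subr0.
have st u x : T u * T x = T (u * x)%g -> KL_le C (u * x)%g x.
  move=> E; apply: (@le_step _ _ _ _ (T u)); rewrite !CT E -CT coords_basis // eqxx.
  exact/eqP/oner_neq0.
have eqv w : KL_eqv C w 1%g.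
  move: w; apply: (dih_ind D) => [|x IH|x IH]; first by split; apply: KL_refl.
  - apply: KL_eqv_trans IH; split; first by apply: st; case: (TT x).
    by have := st s (s * x)%g (TT _).1; rewrite mulgA (dih_ss D) mul1g.
  - apply: KL_eqv_trans IH; split; first by apply: st; case: (TT x).
    by have := st t (t * x)%g (TT _).2; rewrite mulgA (dih_tt D) mul1g.
have cl w : KL_class C w = [set: gT].
  apply/setP=> x; rewrite !inE; apply/asboolP.
  by apply: KL_eqv_trans (eqv x) (KL_eqv_sym (eqv w)).
have E : KL_char T C [set: gT] = @reg_char R gT.
  apply/funext=> x; exact: (KL_char_setT hC D hT).
rewrite KL_cellularE; split=> [[w ->]|->]; first by rewrite cl E.
by exists 1%g; rewrite cl E.
Qed.

Lemma KL_nonneg (c : gT -> R) T C s t (hbar : is_bar_involution T bar)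
  (hC : is_KL_basis T bar C) (D : dihedral d s t)
  (hT : is_Hecke_algebra [set s; t] c T) :
  0 <= c t -> c t <= c s -> (odd d -> c t = c s) ->
  (forall x, (#|[set w | (x * w * s)%g == w]|)%:R = fix_char R s t x) ->
  (forall x, (#|[set w | (x * w * t)%g == w]|)%:R = fix_char R t s x) ->
  (~~ odd d -> forall p q, lin_ex s t p q) ->
  forall gamma, KL_cellular T C gamma <-> cellular_char d s t (c s) (c t) gamma.
Proof.
move=> ct0 cts od fs ft lex gamma.
move: cts; rewrite le_eqVlt => /orP[/eqP ceq|clt]; last first.
  apply: (KL_unequal hbar hC D hT) => //; first exact: le_lt_trans clt.
  by apply/negP=> /od E; rewrite E ltxx in clt.
move: ct0; rewrite le_eqVlt => /orP[/eqP c0|cp].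
  by apply: (KL_zero hbar hC D hT); rewrite -?ceq -c0.
by apply: (KL_equal hbar hC D hT); rewrite -?ceq.
Qed.

Theorem KL_cellular_charE (c : gT -> R) T C s t (hbar : is_bar_involution T bar)
  (hC : is_KL_basis T bar C) (D : dihedral d s t)
  (hT : is_Hecke_algebra [set s; t] c T) :
  (odd d -> c t = c s) ->
  (forall x, (#|[set w | (x * w * s)%g == w]|)%:R = fix_char R s t x) ->
  (forall x, (#|[set w | (x * w * t)%g == w]|)%:R = fix_char R t s x) ->
  (~~ odd d -> forall p q, lin_ex s t p q) ->
  (forall p, lin_ex s t p p) ->
  forall gamma, KL_cellular T C gamma <-> cellular_char d s t (c s) (c t) gamma.
Proof.
move=> od fs ft lex lexp gamma.
(* The twist by this character replaces c by its absolute value. For d odd the parameters agree, so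
   the two required signs are equal and the character exists. *)
have [e le] : lin_ex s t (c s < 0) (c t < 0).
  by case: (boolP (odd d)) => [/od ->|/lex].
have absE (a : R) : (-1) ^+ (a < 0)%R * a = `|a|.
  by rewrite normrEsign.
pose c' x := `|c x|; have c0 x : 0 <= c' x by apply: normr_ge0.
have hT2 : is_Hecke_algebra [set s; t] c' (twist e T).
  by apply: (twist_Hecke le hT); rewrite absE.
have hC2 := twist_KL e hC hT; have hbar2 := twist_bar le hbar.
rewrite (KL_cellular_twist e hC).
have od' : odd d -> c' t = c' s by move=> /od E; rewrite /c' E.
have mid g : KL_cellular (twist e T) (twist e C) g <->
    cellular_char d s t (c' s) (c' t) g.
  case: (lerP (c' t) (c' s)) => [l|/ltW l].
    by apply: (KL_nonneg hbar2 hC2 D hT2).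
  have D' := dihedral_sym D; have hT3 := is_Hecke_sym hT2.
  have -> : cellular_char d s t (c' s) (c' t) g <-> cellular_char d t s (c' t) (c' s) g.
    by split; apply: cellular_char_swap => //; apply: dihedral_sym.
  apply: (KL_nonneg hbar2 hC2 D' hT3) => //; first by move/od'.
  by move=> nd p q; apply/(lin_ex_swap s t); apply: lex.
rewrite mid; have tw := cellular_char_twist D le.
split; last by move/tw; rewrite !absE.
move/tw; rewrite /c' -!absE !mulrA -!expr2 !sqrr_sign !mul1r.
congr cellular_char; apply/funext=> x.
by rewrite mulrA -expr2 sqrr_sign mul1r.
Qed.

End KLMain.

(** * Irreducible representations *)

Lemma forall_ord2 (P : 'I_2 -> Prop) : P 0 -> P 1 -> forall i, P i.
Proof.
move=> P0 P1 [[|[|//]] lt].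
  by rewrite (_ : Ordinal lt = 0) //; apply: val_inj.
by rewrite (_ : Ordinal lt = 1) //; apply: val_inj.
Qed.

Lemma mulmx22E (K : pzSemiRingType) m n (A : 'M[K]_(m, 2)) (B : 'M[K]_(2, n)) i j :
  (A *m B) i j = A i 0 * B 0 j + A i 1 * B 1 j.
Proof.
rewrite mxE big_ord_recl big_ord_recl big_ord0 addr0; congr (_ + A i _ * B _ j);
  exact: val_inj.
Qed.

Section MatrixDihedral.
Variables (R : realType) (d : nat) (zeta : R[i]).
Variables (gT : finGroupType) (V : mx_representation R[i] [set: gT] 2).
Variable s_ : nat -> gT.
Hypotheses (hzeta : d.-primitive_root zeta) (hV : mx_faithful V)
  (hs : forall i : nat, V (s_ i) = refl_mx zeta i)
  (hW : <<[set s_ 0%N; s_ 1%N]>>%g = [set: gT]).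
Local Notation F := (R[i]).
Local Notation s := (s_ 0%N).
Local Notation t := (s_ 1%N).

(** Rotations for [o = false], reflections for [o = true]; the flags add up under multiplication. *)
Definition dih_mx (o : bool) (u : F) : 'M[F]_2 :=
  \matrix_(i, j) (if (i == j) (+) o then (if i == 0 then u else u^-1) else 0).

Lemma dih_mx_inj o o' u u' : u != 0 -> u' != 0 -> dih_mx o u = dih_mx o' u' ->
  o = o' /\ u = u'.
Proof.
move=> u0 u0' /matrixP E; have := E 0 0; have := E 0 1; rewrite !mxE /=.
case: (o); case: (o') => /= E2 E3; first by split.
- by rewrite E2 eqxx in u0.
- by rewrite E3 eqxx in u0.
- by split.
Qed.

Lemma refl_mxE i : refl_mx zeta i = dih_mx true (zeta ^+ i).
Proof.
apply/matrixP; apply: forall_ord2; apply: forall_ord2; rewrite !mxE //=.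
Qed.

Lemma dih_mxM o o' u u' : u != 0 ->
  dih_mx o u *m dih_mx o' u' = dih_mx (o (+) o') (if o then u / u' else u * u').
Proof.
move=> u0; apply/matrixP; apply: forall_ord2; apply: forall_ord2;
  rewrite !mxE !big_ord_recl big_ord0 !mxE /=; case: o; case: o' => /=;
  by rewrite ?(mulr0, mul0r, addr0, add0r) // invfM ?invrK // mulrC.
Qed.

Let zeta_neq0 : zeta != 0.
Proof.
apply/eqP=> z0; have := prim_expr_order hzeta.
rewrite z0 expr0n gtn_eqF ?(prim_order_gt0 hzeta) //= => /eqP.
by rewrite eq_sym oner_eq0.
Qed.

Let zX_neq0 n : zeta ^+ n != 0. Proof. by rewrite expf_neq0. Qed.

Lemma V_inj x y : V x = V y -> x = y.
Proof. by apply: (mx_faithful_inj hV); rewrite inE. Qed.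

Lemma V_M x y : V (x * y)%g = V x *m V y.
Proof. by rewrite repr_mxM ?inE. Qed.

Lemma V_s n : V (s_ n) = dih_mx true (zeta ^+ n).
Proof. by rewrite hs refl_mxE. Qed.

Lemma V_1 : V 1%g = dih_mx false 1.
Proof.
rewrite repr_mx1; apply/matrixP; apply: forall_ord2; apply: forall_ord2;
  by rewrite !mxE /= ?invr1.
Qed.

Lemma V_alt n : V (alt t s n) = dih_mx (odd n) (zeta ^+ uphalf n) /\
  V (alt s t n) = dih_mx (odd n) (zeta ^- n./2).
Proof.
elim: n => [|n [I1 I2]]; first by rewrite V_1 /= expr0 invr1.
rewrite /= !V_M I1 I2 !V_s !dih_mxM ?zX_neq0 ?expr0 ?oner_eq0 //.
by rewrite addTb invrK -exprD mul1r add1n.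
Qed.

Lemma matrix_dihedral : dihedral d s t.
Proof.
have d0 := prim_order_gt0 hzeta.
have sq x : V x = dih_mx true (zeta ^+ 0) \/ V x = dih_mx true (zeta ^+ 1) ->
    (x * x = 1)%g.
  move=> E; apply: V_inj; rewrite V_M V_1.
  by case: E => ->; rewrite dih_mxM ?zX_neq0 //= divff ?zX_neq0.
have inv_inj m n : zeta ^- m = zeta ^- n -> zeta ^+ m = zeta ^+ n.
  by move/invr_inj.
split=> //.
- by apply: sq; left; rewrite V_s.
- by apply: sq; right; rewrite V_s.
- apply: V_inj; have [-> ->] := V_alt d; congr dih_mx.
  apply: (mulfI (zX_neq0 d./2)); rewrite mulfV ?zX_neq0 // -exprD.
  by rewrite (_ : (d./2 + uphalf d)%N = d) ?(prim_expr_order hzeta) //; lia.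
- move=> m n md nd E; have := congr1 V E; rewrite !(V_alt _).2.
  case/dih_mx_inj; rewrite ?invr_eq0 ?zX_neq0 // => o /inv_inj/eqP.
  by rewrite (eq_prim_root_expr hzeta) !modn_small; lia.
- move=> m n md nd E; have := congr1 V E; rewrite !(V_alt _).1.
  case/dih_mx_inj; rewrite ?zX_neq0 // => o /eqP.
  rewrite (eq_prim_root_expr hzeta); case: (ltnP 1 d) => d1.
    by rewrite !modn_small; lia.
  by move=> _; lia.
- move=> m n md nd E; have := congr1 V E; rewrite (V_alt _).1 (V_alt _).2.
  case/dih_mx_inj; rewrite ?invr_eq0 ?zX_neq0 // => o E2.
  have : zeta ^+ (m./2 + uphalf n) == zeta ^+ 0.
    by rewrite exprD -E2 mulfV ?zX_neq0.
  by rewrite (eq_prim_root_expr hzeta) mod0n modn_small; lia.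
Qed.

Lemma V_rot : V (t * s)%g = dih_mx false zeta.
Proof. by rewrite V_M !V_s dih_mxM ?zX_neq0 //= expr0 expr1 divr1. Qed.

Lemma V_rotX n : V ((t * s) ^+ n)%g = dih_mx false (zeta ^+ n).
Proof.
elim: n => [|n IHn]; first by rewrite expg0 V_1.
by rewrite expgS V_M IHn V_rot dih_mxM //= exprS.
Qed.

Lemma s_rot n : s_ n = ((t * s) ^+ n * s)%g.
Proof. by apply: V_inj; rewrite V_M V_rotX !V_s dih_mxM ?zX_neq0 //= expr0 mulr1. Qed.

Lemma s_SS n : s_ n.+2 = (s_ n ^ (t * s)^-1)%g.
Proof.
apply: V_inj; rewrite conjgE invgK V_M (V_M (s_ n)) V_rot !V_s.
have -> : V (t * s)^-1%g = dih_mx false zeta^-1.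
  have -> : ((t * s)^-1 = s * t)%g.
    by rewrite invMg; congr (_ * _)%g; apply/eqP; rewrite eq_invg_mul; apply/eqP;
       [exact: dih_ss matrix_dihedral | exact: dih_tt matrix_dihedral].
  by rewrite V_M !V_s dih_mxM ?zX_neq0 //= expr0 expr1 mul1r.
rewrite mulmxA !dih_mxM ?mulf_neq0 ?zX_neq0 //= invrK.
by rewrite -exprS -exprSr.
Qed.

Lemma s_per n : s_ (n + d) = s_ n.
Proof. by apply: V_inj; rewrite !V_s exprD (prim_expr_order hzeta) mulr1. Qed.

Lemma rot_d : ((t * s) ^+ d = 1)%g.
Proof. by apply: V_inj; rewrite V_rotX (prim_expr_order hzeta) V_1. Qed.

Lemma lin_ex_diag p : lin_ex s t p p.
Proof.
case: p; last by exists (fun=> false).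
(* The determinant is -1 on s and on t. *)
pose f x := V x 0 0 * V x 1 1 - V x 0 1 * V x 1 0.
suff : lin_ex s t true true /\ f = lin_char R s t true true by case.
apply: (lin_charP matrix_dihedral) => [|x|x]; rewrite /f.
- by rewrite V_1 !mxE /= invr1 mulr1 mulr0 subr0.
- rewrite V_M V_s !mulmx22E !mxE /= expr0 expr1 invr1.
  rewrite !(mul0r, mul1r, addr0, add0r) mulN1r opprB.
  by congr (_ - _); rewrite mulrC.
- rewrite V_M V_s !mulmx22E !mxE /= expr1.
  rewrite !(mul0r, addr0, add0r) mulN1r opprB.
  have E u v : zeta * u * (zeta^-1 * v) = v * u.
    by rewrite mulrACA mulfV ?zeta_neq0 // mul1r mulrC.
  by rewrite !E.
Qed.

Lemma zeta_half : ~~ odd d -> zeta ^+ d./2 = -1.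
Proof.
move=> nd; have d0 := prim_order_gt0 hzeta.
have : (zeta ^+ d./2) ^+ 2 = 1.
  by rewrite -exprM muln2 halfK (negbTE nd) subn0 (prim_expr_order hzeta).
move/eqP; rewrite sqrf_eq1 => /orP[|/eqP //].
rewrite -(prim_order_dvd hzeta) => /dvdn_leq; lia.
Qed.

Lemma lin_ex_even p q : ~~ odd d -> lin_ex s t p q.
Proof.
move=> nd; have zh := zeta_half nd.
(* A row of V x has a single non-zero entry, a power of zeta, which the row sum extracts. Its
   (d/2)-th power is a sign that does not depend on the row; it is 1 at s and -1 at t. *)
pose A (i : 'I_2) x := (V x i 0 + V x i 1) ^+ d./2.
have As x : A 0 (s * x)%g = A 1 x /\ A 1 (s * x)%g = A 0 x.
  rewrite /A V_M V_s !mulmx22E !mxE /= expr0 invr1.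
  by rewrite !(mul0r, mul1r, addr0, add0r).
have At x : A 0 (t * x)%g = - A 1 x /\ A 1 (t * x)%g = - A 0 x.
  rewrite /A V_M V_s !mulmx22E !mxE /= expr1.
  rewrite !(mul0r, addr0, add0r) -!mulrDr !exprMn exprVn zh invrN1 !mulN1r.
  by [].
have A01 x : A 0 x = A 1 x.
  move: x; apply: (dih_ind matrix_dihedral) => [|x IH|x IH].
  - by rewrite /A V_1 !mxE /= addr0 add0r invr1.
  - by rewrite (As x).1 (As x).2.
  - by rewrite (At x).1 (At x).2 IH.
have [ft _] : lin_ex s t false true /\ A 0 = lin_char R s t false true.
  apply: (lin_charP matrix_dihedral) => [|x|x].
  - by rewrite /A V_1 !mxE /= addr0 expr1n.
  - by rewrite (As x).1 mul1r.
  - by rewrite (At x).1 mulN1r A01.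
have D := matrix_dihedral.
case: ft => e le; have [e' le'] := lin_ex_diag true.
have := is_linD le le' => le2.
by case: p; case: q; [exact: lin_ex_diag | exists (fun x => e x (+) e' x) | exists e |
  exact: lin_ex_diag].
Qed.

Variable c : gT -> R.
Hypothesis hc : forall (i : nat) (w : gT), c (s_ i ^ w)%g = c (s_ i).

Lemma c_SS n : c (s_ n.+2) = c (s_ n).
Proof. by rewrite s_SS hc. Qed.

Lemma c_parity n : c (s_ n) = if odd n then c t else c s.
Proof.
suff : c (s_ n) = (if odd n then c t else c s) /\
       c (s_ n.+1) = (if odd n.+1 then c t else c s) by case.
by elim: n => [|n [I1 I2]]; split; rewrite // c_SS /= negbK.
Qed.

Lemma c_odd : odd d -> c t = c s.
Proof.
move=> od; have := s_per 0; rewrite add0n => E.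
by have := c_parity d; rewrite od E.
Qed.

End MatrixDihedral.

(** * Characters of a finite group over the complex numbers *)

Section IrrFacts.
Variables (R : realType) (gT : finGroupType).
Local Notation F := (R[i]).
Local Notation W := [set: gT].
Implicit Types (chi : Irr R gT) (x y : gT).

Lemma pchar_group : pgroup.pgroup [char F]^' W.
Proof.
apply/pgroup.pgroupP=> p pr _; rewrite !inE negb_and pr /=.
by rewrite pnatr_eq0 -lt0n prime_gt0.
Qed.

Lemma splitW : group_splitting_field F [set: gT]%G.
Proof. exact: group_closure_closed_field. Qed.

Lemma irr_abs chi : mx_absolutely_irreducible (irr_repr chi).
Proof. by apply: splitW; apply: socle_irr. Qed.

Lemma reprM n (rho : mx_representation F W n) x y : rho (x * y)%g = rho x *m rho y.
Proof. by rewrite repr_mxM ?inE. Qed.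

Lemma trace_regular x : \tr (regular_repr F [set: gT]%G x) = reg_char R x.
Proof.
rewrite /mxtrace /reg_char.
transitivity (\sum_(i < #|[set: gT]|) (x == 1%g)%:R : F).
  apply: eq_bigr => i _; rewrite !mxE eqxx /=.
  rewrite -(inj_eq enum_val_inj) enum_rankK_in ?inE //.
  by rewrite eq_sym -{2}[enum_val i]mulg1 (inj_eq (mulgI _)).
by rewrite sumr_const card_ord cardsT natrM mulr_natl.
Qed.

Lemma reg_charE x : \sum_chi (irr_degree chi)%:R * Defs.irr_char chi x = reg_char R x.
Proof.
rewrite -trace_regular (mxtrace_regular_pchar (DecSocleType _) pchar_group splitW) ?inE //.
by apply: eq_bigr => chi _; rewrite mulr_natl.
Qed.

Lemma repr_trJ n (rho : mx_representation F W n) x y :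
  \tr (rho (x ^ y)%g) = \tr (rho x).
Proof. by rewrite conjgE !reprM mxtrace_mulC -mulmxA -reprM mulgV repr_mx1 mulmx1. Qed.

Lemma irr_char1 chi : Defs.irr_char chi 1%g = (irr_degree chi)%:R.
Proof. by rewrite /Defs.irr_char repr_mx1 mxtrace1. Qed.

(* By Schur, the sum of the conjugates of x acts by a scalar. *)
Lemma repr_conj_sum n (rho : mx_representation F W n) x y :
  mx_absolutely_irreducible rho ->
  n%:R * \sum_w \tr (rho (w^-1 * x * w * y)%g) =
  #|gT|%:R * \tr (rho x) * \tr (rho y).
Proof.
move=> abs; pose A := \sum_w rho (w^-1 * x * w)%g.
have cA : centgmx rho A.
  apply/centgmxP=> z _.
  rewrite mulmx_suml mulmx_sumr (reindex_inj (mulIg z^-1%g)) /=.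
  apply: eq_bigr => w _; rewrite -!reprM; congr (rho _).
  by rewrite invMg invgK !mulgA mulgKV.
have /is_scalar_mxP[a aE] := mx_abs_irr_cent_scalar abs cA.
have -> : \sum_w \tr (rho (w^-1 * x * w * y)%g) = a * \tr (rho y).
  rewrite -[RHS]mxtraceZ -mul_scalar_mx -aE mulmx_suml raddf_sum /=.
  by apply: eq_bigr => w _; rewrite (reprM rho _ y).
have trA : \tr A = #|gT|%:R * \tr (rho x).
  rewrite raddf_sum (eq_bigr (fun _ => \tr (rho x))) => [|w _]; last first.
    by rewrite /= -mulgA -conjgE repr_trJ.
  by rewrite sumr_const mulr_natl.
by rewrite -trA aE mxtrace_scalar mulrA mulr_natl.
Qed.

Lemma irr_conj_sum chi x y :
  (irr_degree chi)%:R * \sum_w Defs.irr_char chi (w^-1 * x * w * y)%g =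
  #|gT|%:R * Defs.irr_char chi x * Defs.irr_char chi y.
Proof. exact: repr_conj_sum (irr_abs chi). Qed.

(** Column orthogonality, with y^-1 in place of complex conjugation: [irr_conj_sum] turns each
    product into a sum over w, and summing over chi produces the regular character at w^-1 x w
    y^-1. *)
Lemma fix_count x y :
  (#|[set w | (x * w * y^-1)%g == w]|)%:R = \sum_chi Defs.irr_char chi x * Defs.irr_char
    chi y^-1%g :> F.
Proof.
have g0 : (#|gT|%:R : F) != 0 by rewrite pnatr_eq0 -lt0n; apply/card_gt0P; exists 1%g.
apply: (mulfI g0); rewrite mulr_sumr.
rewrite (eq_bigr (fun chi => \sum_w (irr_degree chi)%:R *
   Defs.irr_char chi (w^-1 * x * w * y^-1)%g)) => [|chi _]; last first.
  by rewrite mulrA -irr_conj_sum mulr_sumr.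
rewrite exchange_big /=.
rewrite (eq_bigr (fun w => reg_char R (w^-1 * x * w * y^-1)%g)) => [|w _]; last first.
  exact: reg_charE.
rewrite -[X in _ * X%:R]sum1_card natr_sum mulr_sumr big_mkcond; apply: eq_bigr => w _.
rewrite inE /reg_char natrM mulr1.
have -> : (w^-1 * x * w * y^-1 == 1)%g = (x * w * y^-1 == w)%g.
  by rewrite -!mulgA -eq_mulVg1 eq_sym.
by case: (_ == w); rewrite ?mulr1 ?mulr0.
Qed.

Lemma trace_grpalg_mx (K : fieldType) (f : {rmorphism F -> K}) n
    (rho : mx_representation F W n) (a : grpalg K gT) h :
  \tr (map_repr f rho h^-1%g *m grpalg_mx (map_repr f rho) a) =
  \sum_g a g * f (\tr (rho (h^-1 * g)%g)).
Proof.
rewrite /grpalg_mx mulmx_sumr raddf_sum; apply: eq_bigr => g _ /=.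
by rewrite -scalemxAr mxtraceZ -map_mxM -reprM trace_map_mx.
Qed.

(** Fourier inversion: the sum over chi of chi(1) times the trace of h^-1 a on chi is the order of
    the group times the coefficient of a at h. The coefficients are taken in an extension K, so as
    to apply to C(V). *)
Lemma irr_faithful (K : fieldType) (f : {rmorphism F -> K}) (a : grpalg K gT) :
  (forall chi, grpalg_mx (map_repr f (irr_repr chi)) a = 0) -> a = 0.
Proof.
move=> a0; apply/ffunP=> h; rewrite [RHS]ffunE.
have g0 : f (#|gT|%:R) != 0.
  by rewrite fmorph_eq0 pnatr_eq0 -lt0n; apply/card_gt0P; exists 1%g.
apply: (mulfI g0); rewrite mulr0.
transitivity (\sum_chi \sum_g f (irr_degree chi)%:R *
    (a g * f (Defs.irr_char chi (h^-1 * g)%g))); last first.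
  apply: big1 => chi _; rewrite -mulr_sumr -trace_grpalg_mx.
  by rewrite a0 mulmx0 raddf0 mulr0.
rewrite exchange_big /= (eq_bigr (fun g => a g * f (reg_char R (h^-1 * g)%g))).
  rewrite (bigD1 h) //= mulVg /reg_char eqxx muln1 big1 ?addr0 1?mulrC // => g gh.
  by rewrite -eq_mulVg1 eq_sym (negbTE gh) muln0 rmorph0 mulr0.
move=> g _; rewrite -reg_charE rmorph_sum mulr_sumr; apply: eq_bigr => chi _.
by rewrite mulrCA rmorphM.
Qed.

End IrrFacts.

Fact fix_swap_identity (K : comPzRingType) (l00 l01 l10 l11 : K) :
  - l11 + l10 + (- l01 + l00) = l00 + l10 - (l01 + l11).
Proof. by ring. Qed.

(** * Irreducible representations of the dihedral group *)

Section IrrDihedral.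
Variables (R : realType) (d : nat) (zeta : R[i]).
Variables (gT : finGroupType) (V : mx_representation R[i] [set: gT] 2).
Variable s_ : nat -> gT.
Hypotheses (hzeta : d.-primitive_root zeta) (hV : mx_faithful V)
  (hs : forall i : nat, V (s_ i) = refl_mx zeta i)
  (hW : <<[set s_ 0%N; s_ 1%N]>>%g = [set: gT]).
Local Notation F := (R[i]).
Local Notation W := [set: gT].
Local Notation s := (s_ 0%N).
Local Notation t := (s_ 1%N).
Implicit Types (chi : Irr R gT) (x y : gT).
Let D := matrix_dihedral hzeta hV hs hW.

Lemma s_sq i : (s_ i * s_ i = 1)%g.
Proof.
apply: (V_inj hV); rewrite V_M !(V_s hs) dih_mxM ?expf_neq0 //=.
  rewrite divff; first by rewrite V_1.
  rewrite expf_neq0 //; apply/eqP=> z0; have := prim_expr_order hzeta.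
  by rewrite z0 expr0n gtn_eqF ?(prim_order_gt0 hzeta) //= => /eqP; rewrite eq_sym oner_eq0.
apply/eqP=> z0; have := prim_expr_order hzeta.
by rewrite z0 expr0n gtn_eqF ?(prim_order_gt0 hzeta) //= => /eqP; rewrite eq_sym oner_eq0.
Qed.

(** For an eigenvector v of the rotation t s, the vectors v and v s span a stable subspace, which is
    everything by irreducibility. They are the rows of P, and xi is the eigenvalue. *)
Lemma repr_model n (rho : mx_representation F W n) : mx_irreducible rho ->
  exists xi, exists2 P : 'M[F]_(2, n), xi ^+ d = 1 /\ row_full P &
    forall i, P *m rho (s_ i) = dih_mx true (xi ^+ i) *m P.
Proof.
case/mx_irrP=> n0 irr.
have [xi /eigenvalueP[v vE v0]] := eigenvalue_closed (rho (t * s)%g) n0.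
have vX i : v *m rho ((t * s) ^+ i)%g = xi ^+ i *: v.
  elim: i => [|i IH]; first by rewrite expg0 repr_mx1 mulmx1 expr0 scale1r.
  by rewrite expgSr reprM mulmxA IH -scalemxAl vE scalerA exprSr.
have xid : xi ^+ d = 1.
  have := vX d; rewrite (rot_d hzeta hV hs) repr_mx1 mulmx1 => /eqP.
  rewrite -{1}[v]scale1r -subr_eq0 -scalerBl scaler_eq0 (negbTE v0) orbF subr_eq0.
  by move/eqP.
have xi0 : xi != 0.
  apply/eqP=> z0; move: xid.
  by rewrite z0 expr0n gtn_eqF ?(prim_order_gt0 hzeta) //= => /eqP; rewrite eq_sym oner_eq0.
have [u uE] : exists u, u = v *m rho s by exists (v *m rho s).
pose P : 'M[F]_(2, n) := \matrix_(i, j) (if i == 0 then v 0 j else u 0 j).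
have Ps i : P *m rho (s_ i) = dih_mx true (xi ^+ i) *m P.
  have e1 : v *m rho (s_ i) = xi ^+ i *: u.
    by rewrite (s_rot hzeta hV hs) reprM mulmxA vX -scalemxAl uE.
  have e2 : u *m rho (s_ i) = xi ^- i *: v.
    have E : (s * s_ i = ((t * s) ^+ i)^-1)%g.
      by apply/eqP; rewrite eq_sym eq_invg_mul mulgA -(s_rot hzeta hV hs) s_sq.
    rewrite uE -mulmxA -reprM E -[LHS]scale1r -[X in X *: _](mulVf (expf_neq0 i xi0)).
    rewrite -scalerA scalemxAl -vX -mulmxA -reprM mulgV repr_mx1 mulmx1.
    by [].
  apply/matrixP; apply: forall_ord2 => j; rewrite mulmx22E !mxE /=.
    rewrite mul0r add0r.
    have := congr1 (fun A : 'rV_n => A 0 j) e1; rewrite !mxE => <-.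
    by apply: eq_bigr => k _; rewrite !mxE.
  rewrite mul0r addr0.
  have := congr1 (fun A : 'rV_n => A 0 j) e2; rewrite !mxE => <-.
  by apply: eq_bigr => k _; rewrite !mxE.
exists xi, P => //; split=> //; rewrite -[row_full P]/(\rank P == n).
have : row_full (<<P>>%MS); last by rewrite /row_full genmxE.
apply: irr; last first.
  apply: contra v0 => /eqP P0; have {}P0 : P = 0.
    by apply/eqP; rewrite -submx0 -genmxE P0 submx0.
  apply/eqP/matrixP=> i j; rewrite ord1 mxE.
  by have := congr1 (fun A : 'M_(2, n) => A 0 j) P0; rewrite !mxE.
apply/mxmoduleP=> x _; rewrite (eqmxMr _ (genmxE P)) genmxE.
move: x; apply: (dih_ind D) => [|x IH|x IH]; first by rewrite repr_mx1 mulmx1.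
  by rewrite reprM mulmxA Ps -mulmxA (submx_trans (submxMl _ _)).
by rewrite reprM mulmxA Ps -mulmxA (submx_trans (submxMl _ _)).
Qed.

Lemma repr_deg n (rho : mx_representation F W n) : mx_irreducible rho ->
  n = 1%N \/ n = 2.
Proof.
move=> irr; have [_ [P [_ fP] _]] := repr_model irr.
case/mx_irrP: irr => n0 _; have := rank_leq_row P; rewrite (eqP fP).
by case: n n0 {rho P fP} => [|[|[|]]] //; [left | right].
Qed.

Lemma repr_model2 (rho : mx_representation F W 2) : mx_irreducible rho ->
  exists xi, exists2 P : 'M[F]_2, [/\ xi ^+ d = 1, xi ^+ 2 != 1 & P \in unitmx] &
    forall i, rho (s_ i) = invmx P *m dih_mx true (xi ^+ i) *m P.
Proof.
move=> irr; have [xi [P [xid fP] Ps]] := repr_model irr.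
have uP : P \in unitmx by rewrite -row_full_unit.
exists xi, P => [|i]; last by rewrite -mulmxA -Ps mulKmx.
split=> //; apply/eqP=> xi2.
have xi0 : xi != 0.
  by apply/eqP=> z; move/eqP: xi2; rewrite z expr0n eq_sym oner_eq0.
have xiV i : xi ^- i = xi ^+ i.
  apply: (mulfI (expf_neq0 i xi0)); rewrite mulfV ?expf_neq0 //.
  by rewrite -exprD addnn -mul2n exprM xi2 expr1n.
(* If xi^2 = 1, the sum of the two rows of P spans a stable line, against irreducibility. *)
pose w : 'rV[F]_2 := const_mx 1 *m P.
have ws i : w *m rho (s_ i) = xi ^+ i *: w.
  rewrite -mulmxA Ps mulmxA scalemxAl; congr (_ *m P).
  apply/matrixP=> j; rewrite ord1; apply: forall_ord2; rewrite mulmx22E !mxE /=.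
    by rewrite mulr0 add0r mulr1 mul1r xiV.
  by rewrite mulr0 addr0 mulr1 mul1r.
have w0 : w != 0.
  apply/eqP=> w0; have : const_mx 1 = 0 :> 'rV[F]_2.
    by rewrite -[LHS](mulmxK uP) -/w w0 mul0mx.
  by move/matrixP/(_ 0 0)/eqP; rewrite !mxE oner_eq0.
case/mx_irrP: irr => _ /(_ <<w>>%MS).
have modw : mxmodule rho <<w>>%MS.
  apply/mxmoduleP=> x _; rewrite (eqmxMr _ (genmxE w)) genmxE.
  move: x; apply: (dih_ind D) => [|x IH|x IH]; first by rewrite repr_mx1 mulmx1.
    by rewrite reprM mulmxA ws -scalemxAl scalemx_sub.
  by rewrite reprM mulmxA ws -scalemxAl scalemx_sub.
move/(_ modw); rewrite -mxrank_eq0 genmxE mxrank_eq0 w0 /row_full genmxE => /(_ isT).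
by move/eqP=> rw; have := rank_leq_row w; rewrite rw.
Qed.

Lemma irr_deg chi : irr_degree chi = 1%N \/ irr_degree chi = 2.
Proof. exact: repr_deg (socle_irr chi). Qed.

Lemma repr2_trace n (rho : mx_representation F W n) : mx_irreducible rho -> n = 2 ->
  forall i, \tr (rho (s_ i)) = 0.
Proof.
move=> irr n2; move: rho irr; rewrite n2 => rho irr i.
have [xi [P [_ _ uP] ->]] := repr_model2 irr.
rewrite mxtrace_mulC mulmxA mulmxV // mul1mx /mxtrace big1 // => j _.
by rewrite mxE eqxx.
Qed.

Lemma repr1_traceM n (rho : mx_representation F W n) : n = 1%N ->
  forall x y, \tr (rho (x * y)%g) = \tr (rho x) * \tr (rho y).
Proof.
move=> n1; move: rho; rewrite n1 => rho x y.
rewrite reprM [rho x]mx11_scalar [rho y]mx11_scalar -scalar_mxM.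
by rewrite !mxtrace_scalar !mulr1n.
Qed.

Lemma repr1_rsim n n' (rho : mx_representation F W n) (rho' : mx_representation F W n') :
  n = 1%N -> n' = 1%N -> (forall x, \tr (rho x) = \tr (rho' x)) -> mx_rsim rho rho'.
Proof.
move=> n1 n1'; move: rho rho'; rewrite n1 n1' => rho rho' E.
apply: (@MxReprSim _ _ _ _ _ _ _ 1%:M) => // [|x _].
  by rewrite row_free_unit unitmx1.
rewrite mulmx1 mul1mx [LHS]mx11_scalar [RHS]mx11_scalar; congr _%:M.
by have := E x; rewrite /mxtrace !big_ord1.
Qed.

Lemma irr_deg1_inj chi chi' : irr_degree chi = 1%N -> irr_degree chi' = 1%N ->
  (forall x, Defs.irr_char chi x = Defs.irr_char chi' x) -> chi = chi'.
Proof.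
move=> d1 d1' E; have := repr1_rsim d1 d1' E.
move/(irr_comp_rsim_pchar (DecSocleType (regular_repr F [set: gT]%G)) (pchar_group R gT)).
by rewrite !(irr_reprK_pchar (pchar_group R gT)).
Qed.

Definition lin_idx chi : bool * bool :=
  (Defs.irr_char chi s != 1, Defs.irr_char chi t != 1).

Lemma irr_deg1 chi : irr_degree chi = 1%N ->
  lin_ex s t (lin_idx chi).1 (lin_idx chi).2 /\
  Defs.irr_char chi = lin_char R s t (lin_idx chi).1 (lin_idx chi).2.
Proof.
move=> d1; have fM : forall x y, Defs.irr_char chi (x * y)%g =
    Defs.irr_char chi x * Defs.irr_char chi y := repr1_traceM (irr_repr chi) d1.
have f1 : Defs.irr_char chi 1%g = 1 by rewrite irr_char1 d1.
have sgn i : Defs.irr_char chi (s_ i) = (-1) ^+ (Defs.irr_char chi (s_ i) != 1).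
  have : Defs.irr_char chi (s_ i) ^+ 2 == 1 by rewrite expr2 -fM s_sq f1.
  rewrite sqrf_eq1; case: eqP => [->//|_ /= /eqP->].
  by rewrite expr1.
apply: (lin_charP D) => // x; rewrite fM; congr (_ * _); exact: sgn.
Qed.

Lemma lin_ex_irr p q : lin_ex s t p q ->
  exists2 chi, irr_degree chi = 1%N & lin_idx chi = (p, q).
Proof.
case=> e le; have [eM es et] := le.
have e1 : e 1%g = false by have := eM 1%g 1%g; rewrite mulg1; case: (e 1%g).
have repr_e : mx_repr W (fun x => ((-1) ^+ (e x))%:M : 'M[F]_1).
  split=> [|x y _ _]; first by rewrite e1.
  by rewrite eM signr_addb scalar_mxM.
pose rho : mx_representation F W 1 := MxRepresentation repr_e.
have irr : mx_irreducible rho by apply: mx_abs_irrW; apply: linear_mx_abs_irr.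
have := rsim_irr_comp_pchar (DecSocleType (regular_repr F [set: gT]%G)) (pchar_group R gT) irr.
set chi := irr_comp _ _ => sim; exists chi; first by case: sim => B E _ _; rewrite -E.
have E x : Defs.irr_char chi x = (-1) ^+ (e x).
  by rewrite /Defs.irr_char -(mxtrace_rsim sim) ?inE // mxtrace_scalar mulr1n.
have N1 : (-1 : F) != 1 by rewrite eq_sym -subr_eq0 opprK -[1 + 1]/(2%:R) pnatr_eq0.
by rewrite /lin_idx !E es et; case: (p); case: (q); rewrite ?expr0 ?expr1 ?N1 ?eqxx.
Qed.

(** The sign pairs parametrise the linear characters; pairs that are not realised contribute
    [lin_char] = 0 on the right. *)
Lemma sum_deg1 (Q : pred (bool * bool)) (G : bool * bool -> F) x :
  \sum_(chi | (irr_degree chi == 1%N) && Q (lin_idx chi)) G (lin_idx chi) * Defs.irr_char chi x =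
  \sum_(pq | Q pq) G pq * lin_char R s t pq.1 pq.2 x.
Proof.
rewrite (partition_big lin_idx Q) => [|chi /andP[]//].
apply: eq_bigr => pq Qpq /=.
have [ex|N] := pselect (lin_ex s t pq.1 pq.2).
  have [chi d1 E] := lin_ex_irr ex; rewrite -surjective_pairing in E.
  rewrite (big_pred1 chi) => [|chi'].
    by rewrite (irr_deg1 d1).2 E.
  apply/andP/eqP => [[/andP[/eqP d1' _] /eqP E']|->]; last by rewrite d1 E Qpq eqxx.
  by apply: irr_deg1_inj => // y; rewrite (irr_deg1 d1).2 (irr_deg1 d1').2 E E'.
rewrite (lin_char0 R x N) mulr0 big1 // => chi /andP[/andP[/eqP d1 _] /eqP E].
by case: N; rewrite -E; case: (irr_deg1 d1).
Qed.

Lemma irr_deg2 chi : (irr_degree chi == 1%N) = false -> irr_degree chi = 2.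
Proof. by case: (irr_deg chi) => ->. Qed.

Lemma sum_deg1_lin x :
  \sum_(chi | irr_degree chi == 1%N) Defs.irr_char chi x = sum_lin R s t x.
Proof.
transitivity (\sum_(pq | xpredT pq) 1 * lin_char R s t pq.1 pq.2 x); last first.
  by rewrite /sum_lin; apply: eq_bigr => pq _; rewrite mul1r.
rewrite -(sum_deg1 xpredT (fun _ => 1)).
by apply: eq_big => [chi|chi _]; rewrite ?andbT ?mul1r.
Qed.

Lemma sum_deg2 x :
  \sum_(chi | irr_degree chi != 1%N) Defs.irr_char chi x = chi2 R s t x.
Proof.
apply: (@mulIf _ 2%:R); first by rewrite pnatr_eq0.
rewrite /chi2 mulfVK ?pnatr_eq0 // -(reg_charE R x) -sum_deg1_lin.
rewrite [X in _ = X - _](bigID (fun chi => irr_degree chi == 1%N)) /=.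
have -> : \sum_(chi : Irr R gT | irr_degree chi == 1%N) (irr_degree chi)%:R * Defs.irr_char chi x =
  \sum_(chi : Irr R gT | irr_degree chi == 1%N) Defs.irr_char chi x.
  by apply: eq_bigr => chi /eqP->; rewrite mul1r.
rewrite addrAC subrr add0r mulr_suml; apply: eq_bigr => chi /negbTE /irr_deg2 ->.
by rewrite mulrC.
Qed.

Lemma fix_charE x i : i = 0%N \/ i = 1%N ->
  (#|[set w | (x * w * s_ i)%g == w]|)%:R =
  \sum_(pq : bool * bool) (-1) ^+ (if i == 0%N then pq.1 else pq.2) *
     lin_char R s t pq.1 pq.2 x.
Proof.
move=> i01; have sV : s_ i = ((s_ i)^-1)%g.
  by apply/eqP; rewrite eq_sym eq_invg_mul s_sq.
rewrite {1}sV fix_count -sV (bigID (fun chi => irr_degree chi == 1%N)) /=.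
rewrite [X in _ + X]big1 => [|chi /negbTE /irr_deg2 d2]; last first.
  by rewrite [X in _ * X](repr2_trace (socle_irr chi) d2) mulr0.
rewrite addr0.
rewrite -(sum_deg1 xpredT (fun pq => (-1) ^+ (if i == 0%N then pq.1 else pq.2))).
apply: eq_big => [chi|chi /eqP d1]; first by rewrite andbT.
rewrite mulrC; congr (_ * _); have [ex ->] := irr_deg1 d1.
case: ex => e le; rewrite (lin_charE R D _ le); have [_ es et] := le.
by case: i01 => -> /=; rewrite ?es ?et.
Qed.

Lemma fix_char_s x : (#|[set w | (x * w * s)%g == w]|)%:R = fix_char R s t x.
Proof.
rewrite (fix_charE x (or_introl erefl)) -(pair_bigA _ (fun p q : bool =>
  (-1) ^+ p * lin_char R s t p q x)) /= !big_bool /fix_char.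
rewrite /= !expr1 !expr0 !mulN1r !mul1r -opprD addrC.
by rewrite [lin_char R s t false true x + _]addrC [lin_char R s t true true x + _]addrC.
Qed.

Lemma fix_char_t x : (#|[set w | (x * w * t)%g == w]|)%:R = fix_char R t s x.
Proof.
rewrite (fix_charE x (or_intror erefl)) -(pair_bigA _ (fun p q : bool =>
  (-1) ^+ q * lin_char R s t p q x)) /= !big_bool /fix_char.
rewrite !(lin_char_swap _ D).
rewrite /= !expr1 !expr0 !mulN1r !mul1r; exact: fix_swap_identity.
Qed.

(** If all degrees were 1, then s t - t s would be 0 on every irreducible representation; hence s t
    = t s and zeta^2 = 1. *)
Lemma exists_deg2 : (2 < d)%N -> exists chi, irr_degree chi = 2.
Proof.
move=> d2; have [//|N] := pselect (exists chi, irr_degree chi = 2).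
have d1 chi : irr_degree chi = 1%N.
  by case: (irr_deg chi) => // c2; case: N; exists chi.
pose a : grpalg F gT := grpelt F (s * t)%g - grpelt F (t * s)%g.
have comm n (rho : mx_representation F W n) x y : n = 1%N -> rho (x * y)%g = rho (y * x)%g.
  move=> n1; move: rho; rewrite n1 => rho.
  by rewrite !reprM [rho x]mx11_scalar scalar_mxC.
have mxE1 n (rho : mx_representation F W n) g : grpalg_mx (map_repr idfun rho) (grpelt F g) = rho g.
  rewrite /grpalg_mx (bigD1 g) //= big1 => [|h hg]; last by rewrite ffunE (negbTE hg) scale0r.
  by rewrite ffunE eqxx scale1r addr0; apply/matrixP=> i j; rewrite !mxE.
have a0 : a = 0.
  apply: (irr_faithful (f := idfun)) => chi.
  have N1 : grpalg_mx (map_repr idfun (irr_repr chi)) a =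
     irr_repr chi (s * t)%g - irr_repr chi (t * s)%g.
    rewrite -!mxE1 /a /grpalg_mx -sumrB; apply: eq_bigr => g _.
    by rewrite !ffunE scalerBl.
  by rewrite N1 (comm _ (irr_repr chi) s t (d1 chi)) subrr.
have st : (s * t = t * s)%g.
  have := congr1 (fun f : grpalg F gT => f (s * t)%g) a0; rewrite !ffunE eqxx.
  by case: eqP => // _ /eqP; rewrite subr0 oner_eq0.
have := congr1 V st; rewrite (V_rot hzeta hs) V_M !(V_s hs) dih_mxM ?expr0 ?oner_eq0 //=.
rewrite expr1 mul1r => /dih_mx_inj.
have z0 : zeta != 0.
  apply/eqP=> z0; have := prim_expr_order hzeta.
  by rewrite z0 expr0n gtn_eqF ?(prim_order_gt0 hzeta) //= => /eqP; rewrite eq_sym oner_eq0.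
case=> //; first by rewrite invr_eq0.
move=> _ zV; have : zeta ^+ 2 == 1 by rewrite expr2 -{1}zV mulVf.
by rewrite -(prim_order_dvd hzeta) => /dvdn_leq; lia.
Qed.

End IrrDihedral.

(** * Partial fractions *)

Fact pow_ratio_mul (K : fieldType) (r a b p0 p1 : K) k : r != 0 -> (0 < k)%N ->
  a = r ^+ k.-1 * p1 -> p0 = r ^+ k * b -> a * b = r^-1 * p0 * p1.
Proof.
by case: k => // k r0 _ -> ->; rewrite exprS !mulrA mulVf // mul1r mulrAC.
Qed.

Fact pow_ratio_sq (K : fieldType) (r a b p0 p1 : K) k : r != 0 ->
  a = r ^+ k * p1 -> p0 = r ^+ k * b -> b = r * a -> a ^+ 2 = r^-1 * p0 * p1.
Proof.
move=> r0 E -> ->; rewrite expr2 {1}E [r ^+ k * (r * a)]mulrCA !mulrA mulVf //.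
by rewrite mul1r mulrAC.
Qed.

Fact ratio_sq (K : fieldType) (r p0 p1 : K) : r != 0 ->
  p1 = r * p0 -> p0 ^+ 2 = r^-1 * p0 * p1.
Proof. by move=> r0 ->; rewrite mulrACA mulVf // mul1r expr2. Qed.

Section PartialFractions.
Variables (F K : fieldType) (f : {rmorphism F -> K}) (X Y : K).
Variables (d : nat) (zeta : F).
Hypothesis hzeta : d.-primitive_root zeta.

Definition lin_den (i : nat) : K := X - f (zeta ^+ i) * Y.

Definition pfrac (a : nat -> F) : K := \sum_(i < d) f (a i) / lin_den i.

Hypotheses (X0 : X != 0) (Y0 : Y != 0) (den0 : forall i, lin_den i != 0).
Hypothesis pfrac_eq0 : forall a, pfrac a = 0 -> forall i, (i < d)%N -> a i = 0.

(** Term by term, X a_i - Y a_i zeta^i is a_i times the denominator. *)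
Lemma pfrac_shift a :
  X * pfrac a - Y * pfrac (fun i => a i * zeta ^+ i) = f (\sum_(i < d) a i).
Proof.
rewrite /pfrac !mulr_sumr -sumrB rmorph_sum; apply: eq_bigr => i _.
rewrite rmorphM !mulrA -mulrBl.
apply: (mulIf (den0 i)); rewrite mulfVK ?den0 //.
by rewrite /lin_den mulrBr; congr (_ - _); [rewrite mulrC | rewrite -mulrA mulrC -mulrA].
Qed.

Lemma pfrac_eq a b : pfrac a = pfrac b -> forall i, (i < d)%N -> a i = b i.
Proof.
move=> E i id; apply/eqP; rewrite -subr_eq0; apply/eqP.
apply: (@pfrac_eq0 (fun i => a i - b i)) => //.
rewrite /pfrac; under eq_bigr => j _ do rewrite rmorphB mulrBl.
by rewrite sumrB -!/(pfrac _) E subrr.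
Qed.

Lemma eq_pfrac a b : (forall i, a i = b i) -> pfrac a = pfrac b.
Proof. by move=> E; apply: eq_bigr => i _; rewrite E. Qed.

Lemma pfracZ z a : pfrac (fun i => z * a i) = f z * pfrac a.
Proof. by rewrite /pfrac mulr_sumr; apply: eq_bigr => i _; rewrite rmorphM mulrA. Qed.

Section Periodic.
Variable c : nat -> F.
Hypotheses (c_per : forall i, c (i + d)%N = c i) (c2 : forall i, c i.+2 = c i).

Lemma sum_shift (G : nat -> F) : G d = G 0%N ->
  \sum_(i < d) G i.+1 = \sum_(i < d) G i.
Proof.
move=> Gd; apply: (addrI (G 0%N)).
transitivity (\sum_(i < d.+1) G i); first by rewrite big_ord_recl.
by rewrite big_ord_recr /= Gd addrC.
Qed.

(** Shifting i by 2 preserves c and multiplies the terms by zeta^(2k), while the sum over a period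
    does not change. *)
Lemma char_sum_eq0 k : zeta ^+ (2 * k) != 1 -> \sum_(i < d) c i * zeta ^+ (k * i) = 0.
Proof.
move=> zk; pose G i := c i * zeta ^+ (k * i).
have Gper i : G (i + d)%N = G i.
  rewrite /G c_per; congr (_ * _).
  by rewrite mulnDr exprD (mulnC k d) (exprM _ d) (prim_expr_order hzeta) expr1n mulr1.
have E : \sum_(i < d) G i.+2 = \sum_(i < d) G i.
  rewrite (sum_shift (G := fun i => G i.+1)); first exact: (sum_shift (Gper 0%N)).
  exact: (Gper 1%N).
have : (zeta ^+ (2 * k) - 1) * \sum_(i < d) G i = 0.
  rewrite mulrBl mul1r -{2}E mulr_sumr -sumrB big1 // => i _.
  rewrite /G c2 mulrCA -exprD; apply/eqP; rewrite subr_eq0; apply/eqP.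
  by congr (_ * zeta ^+ _); lia.
by move/eqP; rewrite mulf_eq0 subr_eq0 (negbTE zk) => /eqP.
Qed.

Definition Pk (k : nat) : K := pfrac (fun i => c i * zeta ^+ (k * i)).

Lemma Pk_per k : Pk (k + d) = Pk k.
Proof.
apply: eq_pfrac => i; congr (_ * _).
by rewrite mulnDl exprD (exprM _ d) (prim_expr_order hzeta) expr1n mulr1.
Qed.

Lemma Pk_shift k : X * Pk k - Y * Pk k.+1 = f (\sum_(i < d) c i * zeta ^+ (k * i)).
Proof.
rewrite -(pfrac_shift (fun i => c i * zeta ^+ (k * i))); congr (_ - _ * _); apply: eq_pfrac => i.
by rewrite -mulrA -exprD mulSn addnC.
Qed.

Lemma PkS k : zeta ^+ (2 * k) != 1 -> Pk k.+1 = (X / Y) * Pk k.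
Proof.
move=> zk; have := Pk_shift k; rewrite char_sum_eq0 // rmorph0 => /eqP.
rewrite subr_eq0 => /eqP E; apply: (mulfI Y0).
by rewrite -E mulrA mulrCA mulfV ?Y0 // mulr1.
Qed.

Lemma zeta_neq1 k : (0 < k)%N -> (k < d)%N -> zeta ^+ k != 1.
Proof.
move=> k0 kd; rewrite -(prim_order_dvd hzeta); apply/negP=> /(dvdn_leq k0).
by rewrite leqNgt kd.
Qed.

(** The step from P_k to P_(k+1) is provided except where zeta^(2k) = 1, at k = 0 and, for d even,
    at k = d/2. This lemma climbs from 1 to the middle; [Pk_down] descends to the middle from d,
    where P_d = P_0. The powers of X/Y then combine to a constant in P_k P_(d-k). *)
Lemma Pk_up k : (0 < k)%N -> (2 * k <= d)%N -> Pk k = (X / Y) ^+ k.-1 * Pk 1.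
Proof.
elim: k => // -[_ _ _|k IH _ kd]; first by rewrite expr0 mul1r.
rewrite PkS; last by apply: zeta_neq1; lia.
by rewrite IH //; [rewrite mulrA -exprS | lia].
Qed.

Lemma Pk_down k : (2 * k < d)%N -> Pk 0 = (X / Y) ^+ k * Pk (d - k).
Proof.
elim: k => [|k IH] kd.
  by rewrite expr0 mul1r subn0 -[d in RHS]add0n Pk_per.
rewrite IH; last lia.
have -> : (d - k = (d - k.+1).+1)%N by lia.
rewrite PkS; first by rewrite mulrA -exprSr.
have -> : (2 * (d - k.+1) = (d - 2 * k.+1) + d)%N by lia.
rewrite exprD (prim_expr_order hzeta) mulr1; apply: zeta_neq1; lia.
Qed.

(* The square of D_x on each irreducible representation of degree 2 *)
Definition fval : K := (X / Y)^-1 * Pk 0 * Pk 1.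

Let XY0 : X / Y != 0. Proof. by rewrite mulf_neq0 ?invr_eq0 ?X0 ?Y0. Qed.

Lemma Pk_mul k : (0 < k)%N -> (2 * k < d)%N -> Pk k * Pk (d - k) = fval.
Proof. by move=> k0 kd; apply: (pow_ratio_mul XY0 k0 (Pk_up k0 (ltnW kd)) (Pk_down kd)). Qed.

Lemma Pk_mulN k : (0 < k)%N -> (k < d)%N -> zeta ^+ (2 * k) != 1 ->
  Pk k * Pk (d - k) = fval.
Proof.
move=> k0 kd zk; case: (ltngtP (2 * k) d) => [|k2|E]; first exact: Pk_mul.
  have k1 : (0 < d - k)%N by lia.
  have k3 : (2 * (d - k) < d)%N by lia.
  have := Pk_mul k1 k3; rewrite (_ : (d - (d - k))%N = k); last lia.
  by move=> <-; apply: mulrC.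
by rewrite E (prim_expr_order hzeta) eqxx in zk.
Qed.

Lemma XY_ratio (p q : K) : X * p = Y * q -> q = (X / Y) * p.
Proof.
by move=> E; apply: (mulfI Y0); rewrite -E mulrA mulrCA mulfV ?Y0 // mulr1.
Qed.

(** The hypothesis is the exceptional step at k = d/2; it joins the chain climbing from P_1 to the
    one descending from P_0. *)
Lemma fval_half : ~~ odd d -> X * Pk d./2 = Y * Pk d./2.+1 -> Pk d./2 ^+ 2 = fval.
Proof.
move=> nd E; have d0 := prim_order_gt0 hzeta.
have h0 : (0 < d./2)%N by lia.
have h1 : (2 * d./2 <= d)%N by lia.
have h2 : (2 * d./2.-1 < d)%N by lia.
have e2 := Pk_down h2; have dE : (d - d./2.-1)%N = d./2.+1 by lia.
rewrite dE in e2.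
exact: (pow_ratio_sq XY0 (Pk_up h0 h1) e2 (XY_ratio E)).
Qed.

Lemma fval_diag : X * Pk 0 = Y * Pk 1 -> Pk 0 ^+ 2 = fval.
Proof.
move=> E; exact: (ratio_sq XY0 (XY_ratio E)).
Qed.

Lemma Pk_eq0 k i : (i < d)%N -> Pk k = 0 -> c i = 0.
Proof.
move=> id /pfrac_eq0 /(_ i id) /eqP; rewrite mulf_eq0 => /orP[/eqP //|].
rewrite expf_eq0 => /andP[_ /eqP z0]; have := prim_expr_order hzeta.
by rewrite z0 expr0n gtn_eqF ?(prim_order_gt0 hzeta) //= => /eqP; rewrite eq_sym oner_eq0.
Qed.

Lemma fval_neq0 i : (i < d)%N -> c i != 0 -> fval != 0.
Proof.
move=> id ci; rewrite /fval !mulf_neq0 ?invr_eq0 ?X0 ?Y0 //;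
  by apply: contra ci => /eqP /(Pk_eq0 id) ->.
Qed.

End Periodic.
End PartialFractions.

(** * Independence of the partial fractions in C(X, Y) *)

Section RationalFunctions.
Variables (R : realType) (d : nat) (zeta : R[i]).
Hypothesis hzeta : d.-primitive_root zeta.
Local Notation F := (R[i]).
Local Notation K := (ratfun R).
Local Notation f := (ratfun_const R).
Local Notation X := (ratX R).
Local Notation Y := (ratY R).
Local Notation lin_den := (lin_den f X Y zeta).

Definition lin_poly (i : nat) : {mpoly F[2]} := 'X_0 - (zeta ^+ i)%:MP * 'X_1.

Lemma lin_denE i : lin_den i = @tofrac _ (lin_poly i).
Proof. by rewrite /lin_poly rmorphB rmorphM. Qed.

Definition pt (z w : F) : 'I_2 -> F := fun i => if i == 0 then z else w.

Lemma meval_lin_poly z w i : (lin_poly i).@[pt z w] = z - zeta ^+ i * w.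
Proof. by rewrite /lin_poly mevalB mevalM mevalC !mevalXU. Qed.

Lemma lin_poly_neq0 i : lin_poly i != 0.
Proof.
apply/eqP=> E; have := meval_lin_poly 1 0 i; rewrite E meval0 mulr0 subr0.
by move/eqP; rewrite eq_sym oner_eq0.
Qed.

Lemma lin_den_neq0 i : lin_den i != 0.
Proof. by rewrite lin_denE tofrac_eq0 lin_poly_neq0. Qed.

Lemma ratX_neq0 : X != 0.
Proof.
rewrite /ratX tofrac_eq0; apply/eqP=> E.
have := congr1 (meval (pt 1 0)) E; rewrite mevalXU meval0 => /eqP.
by rewrite oner_eq0.
Qed.

Lemma ratY_neq0 : Y != 0.
Proof.
rewrite /ratY tofrac_eq0; apply/eqP=> E.
have := congr1 (meval (pt 0 1)) E; rewrite mevalXU meval0 => /eqP.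
by rewrite oner_eq0.
Qed.

Lemma pfrac_eq0 a : pfrac f X Y d zeta a = 0 -> forall i, (i < d)%N -> a i = 0.
Proof.
move=> S0 m md; pose Q (i : 'I_d) : {mpoly F[2]} := \prod_(j | j != i) lin_poly j.
have E : \sum_(i < d) (a i)%:MP * Q i = 0.
  apply/eqP; rewrite -tofrac_eq0; apply/eqP.
  transitivity (pfrac f X Y d zeta a * \prod_(j < d) lin_den j); last by rewrite S0 mul0r.
  rewrite rmorph_sum mulr_suml; apply: eq_bigr => i _.
  rewrite rmorphM (bigD1 i) //= mulrA mulfVK ?lin_den_neq0 //; congr (_ * _).
  by rewrite /Q rmorph_prod; apply: eq_bigr => j _; rewrite lin_denE.
(* At the point (zeta^m, 1) the linear form of index m vanishes, and it divides all the products
   [Q i] but the m-th. *)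
have := congr1 (meval (pt (zeta ^+ m) 1)) E; rewrite meval0 raddf_sum /=.
rewrite (bigD1 (Ordinal md)) //= big1 ?addr0 => [|i im].
  rewrite mevalM mevalC rmorph_prod /= => /eqP; rewrite mulf_eq0 => /orP[/eqP //|].
  rewrite prodf_seq_eq0 => /hasP[j _ /andP[jm]].
  rewrite meval_lin_poly mulr1 subr_eq0 (eq_prim_root_expr hzeta).
  by rewrite !modn_small // => /eqP mj; case/eqP: jm; apply: val_inj.
rewrite mevalM /Q (bigD1 (Ordinal md)) 1?eq_sym //= mevalM meval_lin_poly.
by rewrite mulr1 subrr mul0r mulr0.
Qed.

End RationalFunctions.

(** * Modules of length at most two *)

Section KModules.
Variables (K : fieldType) (A : algType K).
Implicit Types (L M : lmodType A) (k l : K) (a : A).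

(** Modules are given over A alone; K acts on them through its image in A. *)
Definition sc L k (v : L) : L := k%:A *: v.

Section Basics.
Variable L : lmodType A.
Implicit Types (u v w : L) (S : {pred L}).

Lemma sc0 v : sc 0 v = 0. Proof. by rewrite /sc !scale0r. Qed.
Lemma scv0 k : sc k (0 : L) = 0. Proof. exact: scaler0. Qed.
Lemma sc1 v : sc 1 v = v. Proof. by rewrite /sc !scale1r. Qed.
Lemma scA k l v : sc k (sc l v) = sc (k * l) v.
Proof. by rewrite /sc scalerA -scalerAl mul1r scalerA. Qed.
Lemma scDl k l v : sc (k + l) v = sc k v + sc l v.
Proof. by rewrite /sc !scalerDl. Qed.
Lemma scDr k u v : sc k (u + v) = sc k u + sc k v. Proof. exact: scalerDr. Qed.
Lemma scN k v : sc (- k) v = - sc k v. Proof. by rewrite /sc !scaleNr. Qed.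
Lemma scvN k v : sc k (- v) = - sc k v. Proof. exact: scalerN. Qed.
Lemma scale_sc a k v : a *: sc k v = sc k (a *: v).
Proof. by rewrite /sc !scalerA -scalerAr -scalerAl mulr1 mul1r. Qed.
Lemma sc_scale a k v : (k *: a) *: v = sc k (a *: v).
Proof. by rewrite /sc scalerA -scalerAl mul1r. Qed.
Lemma sc_eq0 k v : k != 0 -> sc k v = 0 -> v = 0.
Proof. by move=> k0 E; rewrite -[v]sc1 -(mulVf k0) -scA E scv0. Qed.

Section Submodule.
Variable S : {pred L}.
Hypothesis Sc : GRing.submod_closed S.
Lemma smem0 : 0 \in S. Proof. by case: Sc. Qed.
Lemma smemD u v : u \in S -> v \in S -> u + v \in S.
Proof. by move=> uS vS; case: Sc => _ /(_ 1 _ _ uS vS); rewrite scale1r. Qed.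
Lemma smemZ a u : u \in S -> a *: u \in S.
Proof. by move=> uS; case: Sc => S0 /(_ a _ _ uS S0); rewrite addr0. Qed.
Lemma smemN u : u \in S -> - u \in S.
Proof. by rewrite -scaleN1r; apply: smemZ. Qed.
Lemma smem_sc k u : u \in S -> sc k u \in S. Proof. exact: smemZ. Qed.
Lemma smemB u v : u \in S -> v \in S -> u - v \in S.
Proof. by move=> uS vS; apply: smemD => //; apply: smemN. Qed.
End Submodule.

Definition line u : {pred L} := [pred v | `[< exists k, v = sc k u >]].

Lemma lineP u v : reflect (exists k, v = sc k u) (v \in line u).
Proof. exact: asboolP. Qed.

End Basics.

Definition zero_pred L : {pred L} := pred1 0.

Lemma zero_submod L : GRing.submod_closed (@zero_pred L).
Proof.
split=> [|a x y]; rewrite !inE // => /eqP-> /eqP->.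
by rewrite scaler0 addr0.
Qed.

Lemma full_submod L : GRing.submod_closed (predT : {pred L}).
Proof. by []. Qed.

Lemma eq_section_iso L M (S1 S1' S2 S2' : {pred M}) : S1 =i S2 -> S1' =i S2' ->
  section_iso L S1 S1' -> section_iso L S2 S2'.
Proof.
move=> E E' [f [flin fsurj fker]]; exists f; split.
- by move=> a x y; rewrite -!E'; apply: flin.
- by move=> z; have [x xS <-] := fsurj z; exists x; rewrite -?E'.
- by move=> x; rewrite -E' -E; apply: fker.
Qed.

Lemma section_isoE L M (S1 S1' S2 S2' : {pred M}) : S1 =i S2 -> S1' =i S2' ->
  `[< section_iso L S1 S1' >] = `[< section_iso L S2 S2' >].
Proof.
move=> E E'; apply/asboolP/asboolP; first exact: eq_section_iso.
by apply: eq_section_iso => x; rewrite ?E ?E'.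
Qed.

Lemma comp_mult_simple L M (m : nat) : simple_module M ->
  comp_mult L M m <-> m = `[< section_iso L (@zero_pred M) predT >].
Proof.
move=> [[x x0] sM]; split=> [[n [F [[F0 Fn Fs Fm] ->]]]|->]; last first.
  exists 1%N, (fun i => if i is 0 then @zero_pred M else predT); split; last first.
    by rewrite big_ord1.
  split=> // [[|i] _|i]; [exact: zero_submod | exact: full_submod |].
  rewrite ltnS leqn0 => /eqP->; split=> //; first by exists x; rewrite // inE.
  move=> N Ns _ _; case: (sM N Ns) => [N0|N1]; [left|right] => y; rewrite ?N1 // inE.
  by apply/idP/eqP => [/N0 //|->]; apply: smem0.
case: n F0 Fn Fs Fm => [|n] F0 Fn Fs Fm.
  by have := Fn x; rewrite F0 (negbTE x0).
have F1 y : y \in F 1%N.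
  have [_ [z zF zN] _] := Fm 0%N isT.
  case: (sM (F 1%N) (Fs _ _)) => // N0.
  by rewrite F0 (N0 _ zF) eqxx in zN.
case: n Fn Fs Fm => [|n] Fn Fs Fm.
  by rewrite big_ord1; congr nat_of_bool; apply: section_isoE => y; rewrite ?F0 ?F1 ?inE.
by have [_ [z _]] := Fm 1%N isT; rewrite F1.
Qed.

(* M has length two as soon as no proper nonzero submodule contains another. *)
Lemma comp_mult_length2 L M (m : nat) :
  (exists N : {pred M}, [/\ GRing.submod_closed N, exists2 x, x \in N & x != 0 &
     exists y, y \notin N]) ->
  (forall N N' : {pred M}, GRing.submod_closed N -> GRing.submod_closed N' ->
     {subset N <= N'} -> (exists2 x, x \in N & x != 0) -> (exists y, y \notin N') -> N =i N') ->
  comp_mult L M m <-> exists N : {pred M},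
    [/\ GRing.submod_closed N, exists2 x, x \in N & x != 0, exists y, y \notin N &
     m = (`[< section_iso L (@zero_pred M) N >] + `[< section_iso L N predT >])%N].
Proof.
move=> exN minN; split=> [[n [F [[F0 Fn Fs Fm] ->]]]|[N [Ns [x xN x0] [y yN] ->]]].
  have [N0 [N0s [x xN0 x0] [y yN0]]] := exN.
  case: n F0 Fn Fs Fm => [|n] F0 Fn Fs Fm; first by have := Fn x; rewrite F0 (negbTE x0).
  have [_ [z zF zN] mF] := Fm 0%N isT; rewrite F0 in zN.
  have [w wF] : exists w, w \notin F 1%N.
    have [//|aF] := pselect (exists w, w \notin F 1%N).
    have F1 v : v \in F 1%N by apply/negPn/negP => vF; apply: aF; exists v.
    have [v|v _|E|E] := mF N0 N0s; rewrite ?F1 //.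
    - by rewrite F0 => /eqP->; apply: smem0.
    - by have := E x; rewrite xN0 F0 (negbTE x0).
    by exists y; rewrite -E.
  exists (F 1%N); split; [exact: Fs | by exists z | by exists w|].
  case: n Fn Fs Fm => [|n] Fn Fs Fm; first by rewrite Fn in wF.
  have F2 v : v \in F 2.
    have [sF [z' zF' zN'] _] := Fm 1%N isT.
    have [//|nv] := boolP (v \in F 2).
    have E := minN (F 1%N) (F 2) (Fs 1%N isT) (Fs 2 isT) sF (ex_intro2 _ _ z zF zN)
      (ex_intro _ v nv).
    by rewrite E zF' in zN'.
  case: n Fn Fs Fm => [|n] Fn Fs Fm; last by have [_ [z' _]] := Fm 2 isT; rewrite F2.
  rewrite !big_ord_recl big_ord0 addn0; congr (_ + _)%N; congr nat_of_bool;
    apply: section_isoE => v;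
    by rewrite /= ?F0 ?F2 ?inE.
exists 2, (fun i => match i with 0 => @zero_pred M | 1 => N | _ => predT end); split; last first.
  by rewrite !big_ord_recl big_ord0 addn0.
split=> // [[|[|i]] _|[|[|i]]] //; [exact: zero_submod | move=> _ | move=> _].
  split=> [v|//|P Ps _ PN]; first by rewrite inE => /eqP->; apply: smem0.
    by exists x; rewrite // inE.
  have [[v vP v0]|nP] := pselect (exists2 v, v \in P & v != 0).
    right; apply: minN => //; first by exists v.
    by exists y.
  left=> v; rewrite inE; apply/idP/eqP => [vP|->]; last exact: smem0.
  by apply/eqP/negPn/negP => v0; apply: nP; exists v.
split=> [v //||P Ps NP _]; first by exists y.
have [[v vP]|nP] := pselect (exists v, v \notin P).
  left=> w; apply/esym; apply: minN => //; first by exists x.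
  by exists v.
right=> v; rewrite inE; apply/negPn/negP => vP; apply: nP; by exists v.
Qed.

End KModules.

(** * Modules of dimension one over an algebra with two generators *)

Section TwoOperators.
Variables (K : fieldType) (A : algType K) (dx dy : A).
Hypothesis genA : forall P : A -> Prop, P 1 ->
  (forall a b, P a -> P b -> P (a + b)) -> (forall (k : K) a, P a -> P (k *: a)) ->
  (forall a, P a -> P (dx * a)) -> (forall a, P a -> P (dy * a)) -> forall a, P a.
Implicit Types (L M : lmodType A) (k l : K) (a : A).

Definition eigen L (th et : K) (u : L) : Prop := dx *: u = sc th u /\ dy *: u = sc et u.

Definition type1 L (th et : K) : Prop := exists u : L,
  [/\ u != 0, eigen th et u & forall z, exists k, z = sc k u].

Lemma stable_submod L (S : {pred L}) : 0 \in S ->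
  {in S &, forall u v, u + v \in S} -> (forall k, {in S, forall u, sc k u \in S}) ->
  {in S, forall u, dx *: u \in S} -> {in S, forall u, dy *: u \in S} ->
  GRing.submod_closed S.
Proof.
move=> S0 SD SK Sx Sy.
have SA a : {in S, forall u, a *: u \in S}.
  move: a; apply: genA => [u|a b IHa IHb u|k a IHa u|a IHa u|a IHa u] uS.
  - by rewrite scale1r.
  - by rewrite scalerDl; apply: SD; [apply: IHa | apply: IHb].
  - by rewrite sc_scale; apply/SK/IHa.
  - by rewrite -scalerA; apply/Sx/IHa.
  - by rewrite -scalerA; apply/Sy/IHa.
by split=> // a u v uS vS; apply: SD => //; apply: SA.
Qed.

Lemma eigen_sc L th et (u : L) k : eigen th et u -> eigen th et (sc k u).
Proof. by case=> ex ey; split; rewrite scale_sc ?ex ?ey !scA mulrC. Qed.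

Lemma line_submod L th et (u : L) : eigen th et u -> GRing.submod_closed (line u).
Proof.
move=> eu; apply: stable_submod.
- by apply/lineP; exists 0; rewrite sc0.
- by move=> v w /lineP[k ->] /lineP[l ->]; apply/lineP; exists (k + l); rewrite scDl.
- by move=> l v /lineP[k ->]; apply/lineP; exists (l * k); rewrite scA.
- by move=> v /lineP[k ->]; apply/lineP; exists (th * k); rewrite (eigen_sc k eu).1 scA.
- by move=> v /lineP[k ->]; apply/lineP; exists (et * k); rewrite (eigen_sc k eu).2 scA.
Qed.

Lemma mem_line L (u : L) : u \in line u.
Proof. by apply/lineP; exists 1; rewrite sc1. Qed.

Lemma sc_inj0 L k (u : L) : u != 0 -> sc k u = 0 -> k = 0.
Proof. by move=> u0 E; apply/eqP; apply: contraNT u0 => k0; apply/eqP; apply: sc_eq0 E. Qed.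

Lemma sc_inj L k l (u : L) : u != 0 -> sc k u = sc l u -> k = l.
Proof.
move=> u0 E; apply/eqP; rewrite -subr_eq0; apply/eqP; apply: (sc_inj0 u0).
by rewrite scDl scN E subrr.
Qed.

Lemma simple_eigen L th et (u : L) : simple_module L -> u != 0 -> eigen th et u ->
  type1 L th et.
Proof.
move=> [_ sL] u0 eu; exists u; split=> // z.
case: (sL _ (line_submod eu)) => [S0|/(_ z) /lineP //].
by rewrite (S0 u (mem_line u)) eqxx in u0.
Qed.

Lemma type1_simple L th et : type1 L th et -> simple_module L.
Proof.
move=> [u [u0 eu span]]; split=> [|S Sc]; first by exists u.
have [[x xS x0]|N] := pselect (exists2 x, x \in S & x != 0); [right=> z|left=> x xS].
  have [k xE] := span x; have [l ->] := span z.
  have k0 : k != 0 by apply: contraNneq x0 => k0; rewrite xE k0 sc0.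
  by rewrite -[u]sc1 -(mulVf k0) -scA -xE !smem_sc.
by apply/eqP/negPn/negP=> x0; apply: N; exists x.
Qed.

Lemma type1_eigen L th et (z : L) : type1 L th et -> eigen th et z.
Proof. by move=> [u [_ eu /(_ z)[k ->]]]; apply: eigen_sc. Qed.

Lemma type1_inj L th et th' et' : type1 L th et -> type1 L th' et' ->
  th = th' /\ et = et'.
Proof.
move=> [u [u0 [ex ey] _]] /(@type1_eigen _ _ _ u) [ex' ey'].
by split; apply: (sc_inj u0); rewrite -?ex -?ey.
Qed.

(** The class of u is a basis of S'/S, on which the generators act by th and et, and these two
    scalars determine the section. No quotient is formed: the map to L is read off the coordinate
    [g] along u modulo S. *)
Lemma section_line M L (S S' : {pred M}) th et (u : M) :
  GRing.submod_closed S -> GRing.submod_closed S' -> {subset S <= S'} ->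
  u \in S' -> u \notin S -> (forall x, x \in S' -> exists k, x - sc k u \in S) ->
  dx *: u - sc th u \in S -> dy *: u - sc et u \in S ->
  section_iso L S S' <-> type1 L th et.
Proof.
move=> Sc Sc' sS uS' uS span ux uy; split.
  move=> [f [flin fsurj fker]].
  have f0 : f 0 = 0 by apply/(fker 0 (smem0 Sc')); apply: smem0.
  have fZ a x : x \in S' -> f (a *: x) = a *: f x.
    by move=> xS; rewrite -[a *: x]addr0 flin ?f0 ?addr0 // smem0.
  have fE x y : x \in S' -> y \in S' -> x - y \in S -> f x = f y.
    move=> xS yS xy; apply/eqP; rewrite -subr_eq0 -scaleN1r addrC -flin //.
    by apply/eqP/fker; rewrite scaleN1r addrC //; apply: smemB.
  have dS a k : a *: u - sc k u \in S -> a *: f u = sc k (f u).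
    by move=> uk; rewrite -[sc k _](fZ k%:A) // -(fZ a) //; apply: fE => //; apply: smemZ.
  exists (f u); split.
  - by apply/eqP=> /(fker _ uS'); apply/negP.
  - by split; apply: dS.
  move=> z; have [x xS' <-] := fsurj z; have [k xk] := span x xS'.
  by exists k; rewrite -[sc k _](fZ k%:A) //; apply: fE => //; apply: smem_sc.
move=> [v [v0 [vx vy] vspan]].
pose g x := xget 0 (fun k => x - sc k u \in S).
have gP x : x \in S' -> x - sc (g x) u \in S.
  by move=> /span; rewrite /g => ex; case: xgetP => // N; case: ex => k /N.
have guniq k l x : x - sc k u \in S -> x - sc l u \in S -> k = l.
  move=> kS lS; apply/eqP; rewrite -subr_eq0; apply: contraNT uS => kl.
  rewrite -[u]sc1 -(mulVf kl) -scA; apply: (smem_sc Sc); rewrite scDl scN.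
  have -> : sc k u - sc l u = (x - sc l u) - (x - sc k u).
    by rewrite opprB [RHS]addrC addrA subrK.
  exact: smemB.
have act a : exists2 k, a *: u - sc k u \in S & a *: v = sc k v.
  move: a; apply: genA.
  - by exists 1; rewrite ?scale1r ?sc1 // subrr smem0.
  - move=> a b [k ku kv] [l lu lv]; exists (k + l); rewrite !(scalerDl, scDl) ?kv ?lv //.
    by rewrite opprD addrACA smemD.
  - move=> k a [l lu lv]; exists (k * l); rewrite !sc_scale -scA ?lv //.
    by rewrite -scvN -scDr smem_sc.
  - move=> a [l lu lv]; exists (th * l); rewrite -scalerA ?lv ?scale_sc ?vx ?scA 1?mulrC //.
    rewrite (_ : _ - _ = dx *: (a *: u - sc l u) + sc l (dx *: u - sc th u)).
      by rewrite smemD // ?smemZ ?smem_sc.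
    by rewrite scalerBr scale_sc scDr scvN scA addrA subrK mulrC.
  - move=> a [l lu lv]; exists (et * l); rewrite -scalerA ?lv ?scale_sc ?vy ?scA 1?mulrC //.
    rewrite (_ : _ - _ = dy *: (a *: u - sc l u) + sc l (dy *: u - sc et u)).
      by rewrite smemD // ?smemZ ?smem_sc.
    by rewrite scalerBr scale_sc scDr scvN scA addrA subrK mulrC.
exists (fun x => sc (g x) v); split.
- move=> a x y xS yS; have [k ku kv] := act a.
  rewrite scale_sc kv scA -scDl; congr (sc _ v).
  have axy : a *: x + y \in S' by rewrite smemD // smemZ.
  apply: (guniq _ _ _ (gP _ axy)).
  rewrite (_ : _ - _ = a *: (x - sc (g x) u) + sc (g x) (a *: u - sc k u) + (y - sc (g y) u)).
    apply: (smemD Sc (smemD Sc _ _) (gP _ yS)); last exact: smem_sc.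
    by apply: smemZ => //; apply: gP.
  rewrite scalerBr scale_sc scDr scvN scA [X in _ = X + _]addrA subrK.
  by rewrite scDl opprD addrACA.
- move=> z; have [k ->] := vspan z; exists (sc k u); first exact: smem_sc.
  congr (sc _ v); apply: guniq (gP _ _) _; first exact: smem_sc.
  by rewrite subrr smem0.
move=> x xS; split=> [/(sc_inj0 v0) E|xS0].
  by have := gP x xS; rewrite E sc0 subr0.
by rewrite (guniq (g x) 0 x) ?sc0 ?subr0 // gP.
Qed.

End TwoOperators.

Fact cramer_l (K : fieldType) (a b c d x y : K) : a * d - b * c != 0 ->
  (x * d - y * c) / (a * d - b * c) * a + (a * y - b * x) / (a * d - b * c) * c = x.
Proof. by move=> D0; field. Qed.

Fact cramer_r (K : fieldType) (a b c d x y : K) : a * d - b * c != 0 ->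
  (x * d - y * c) / (a * d - b * c) * b + (a * y - b * x) / (a * d - b * c) * d = y.
Proof. by move=> D0; field. Qed.

Fact quot_coord (K : fieldType) (a b c d p q th : K) : a != 0 ->
  b * p = th * a -> a * q = th * b -> c * q + - (- th * d) = (d * p + th * c) / a * b.
Proof.
move=> a0 E1 E2; apply: (mulfI a0); rewrite mulNr opprK.
transitivity (c * (a * q) + d * (th * a)); first by ring.
by rewrite -E1 E2; field.
Qed.

(** * Modules of dimension two on which dx has trace zero *)

Section Planes.
Variables (K : fieldType) (A : algType K) (dx dy : A).
Hypothesis genA : forall P : A -> Prop, P 1 ->
  (forall a b, P a -> P b -> P (a + b)) -> (forall (k : K) a, P a -> P (k *: a)) ->
  (forall a, P a -> P (dx * a)) -> (forall a, P a -> P (dy * a)) -> forall a, P a.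
Implicit Types (L M : lmodType A) (k l : K) (a : A).
Local Notation type1 := (type1 dx dy).
Local Notation eigen := (eigen dx dy).

(* [dx] has matrix ((0, p), (q, 0)) on the basis (e1, e2), and [dy] acts as [rho dx]. *)
Record plane M (e1 e2 : M) (p q rho : K) : Prop := Plane {
  plane_span : forall v, exists k l, v = sc k e1 + sc l e2;
  plane_free : forall k l, sc k e1 + sc l e2 = 0 -> k = 0 /\ l = 0;
  plane_x1 : dx *: e1 = sc q e2;
  plane_x2 : dx *: e2 = sc p e1;
  plane_y : forall v : M, dy *: v = sc rho (dx *: v)
}.

Section OnePlane.
Variables (M : lmodType A) (e1 e2 : M) (p q rho : K).
Hypothesis HP : plane e1 e2 p q rho.

Lemma plane_uniq k l k' l' : sc k e1 + sc l e2 = sc k' e1 + sc l' e2 -> k = k' /\ l = l'.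
Proof.
move=> /eqP; rewrite -subr_eq0 opprD addrACA -!scN -!scDl => /eqP /(plane_free HP)[E1 E2].
by split; apply/eqP; rewrite -subr_eq0 ?E1 ?E2.
Qed.

Lemma plane_dx k l : dx *: (sc k e1 + sc l e2) = sc (l * p) e1 + sc (k * q) e2.
Proof. by rewrite scalerDr !scale_sc (plane_x1 HP) (plane_x2 HP) !scA addrC. Qed.

Lemma plane_dx2 (v : M) : dx *: (dx *: v) = sc (p * q) v.
Proof.
have [k [l ->]] := plane_span HP v; rewrite !plane_dx scDr !scA.
by congr (sc _ _ + sc _ _); ring.
Qed.

Lemma plane_eigen th (u : M) : dx *: u = sc th u -> eigen th (rho * th) u.
Proof. by move=> E; split=> //; rewrite (plane_y HP) E scA. Qed.

Lemma plane_basis (u w : M) : u != 0 -> w \notin line u ->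
  forall z, exists k l, z = sc k u + sc l w.
Proof.
move=> u0 wu z.
have [a [b uE]] := plane_span HP u; have [c [d wE]] := plane_span HP w.
have [x [y ->]] := plane_span HP z.
have D0 : a * d - b * c != 0.
  apply: contraNneq wu => /eqP; rewrite subr_eq0 => /eqP E; apply/lineP.
  have [a0|a0] := eqVneq a 0.
    have b0 : b != 0 by apply: contraNneq u0 => b0; rewrite uE a0 b0 !sc0 addr0.
    exists (d / b); rewrite wE uE scDr !scA a0 mulfVK // mulr0; congr (sc _ _ + _).
    by move: E; rewrite a0 mul0r => /esym/eqP; rewrite mulf_eq0 (negbTE b0) => /eqP.
  exists (c / a); rewrite wE uE scDr !scA mulfVK //; congr (_ + sc _ _).
  by apply: (mulfI a0); rewrite E mulrA [a * _]mulrC mulfVK // mulrC.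
exists ((x * d - y * c) / (a * d - b * c)), ((a * y - b * x) / (a * d - b * c)).
by rewrite uE wE !scDr !scA addrACA -!scDl cramer_l ?cramer_r.
Qed.

Lemma plane_submod_full (N : {pred M}) (u w : M) : GRing.submod_closed N ->
  u \in N -> w \in N -> u != 0 -> w \notin line u -> forall z, z \in N.
Proof.
move=> Nc uN wN u0 wu z; have [k [l ->]] := plane_basis u0 wu z.
by apply: smemD => //; apply: smem_sc.
Qed.

Lemma plane_submod_line (N : {pred M}) (u y : M) : GRing.submod_closed N ->
  u \in N -> u != 0 -> y \notin N -> N =i line u.
Proof.
move=> Nc uN u0 yN v; apply/idP/idP => [vN|/lineP[k ->]]; last exact: smem_sc.
by apply: contraNT yN => vu; apply: plane_submod_full vu _.
Qed.

Lemma plane_submod_eigen (N : {pred M}) (u y : M) : GRing.submod_closed N ->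
  u \in N -> u != 0 -> y \notin N -> exists2 th, th ^+ 2 = p * q & dx *: u = sc th u.
Proof.
move=> Nc uN u0 yN; have : dx *: u \in line u.
  by rewrite -(plane_submod_line Nc uN u0 yN) smemZ.
case/lineP=> th E; exists th => //.
by apply: (sc_inj u0); rewrite -plane_dx2 E scale_sc E scA expr2.
Qed.

(** As dx has trace 0, its eigenvalue on the quotient by the line of u is the opposite one. The case
    a = 0 is treated apart because the multiple of u is read off the first coordinate. *)
Lemma plane_quot th (u w : M) : u != 0 -> dx *: u = sc th u ->
  dx *: w - sc (- th) w \in line u.
Proof.
move=> u0; have [a [b uE]] := plane_span HP u; have [c [d ->]] := plane_span HP w.
rewrite uE plane_dx scDr !scA => /plane_uniq[E1 E2].
rewrite plane_dx scDr !scA opprD addrACA -!scN -!scDl.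
have [a0|a0] := eqVneq a 0.
  have b0 : b != 0 by apply: contraNneq u0 => b0; rewrite uE a0 b0 !sc0 addr0.
  have p0 : p = 0.
    by move/eqP: E1; rewrite a0 mulr0 mulf_eq0 (negbTE b0) => /eqP.
  have th0 : th = 0.
    by move/eqP: E2; rewrite a0 mul0r eq_sym mulf_eq0 (negbTE b0) orbF => /eqP.
  apply/lineP; exists (c * q / b); rewrite scDr !scA.
  by congr (sc _ _ + sc _ _); rewrite ?a0 ?p0 th0; field.
apply/lineP; exists ((d * p + th * c) / a); rewrite scDr !scA.
by congr (sc _ _ + sc _ _); [field | exact: quot_coord].
Qed.

Lemma plane_eigenvector th : th ^+ 2 = p * q -> exists2 u : M, u != 0 & dx *: u = sc th u.
Proof.
(* For q = 0 the vector th e1 + q e2 used below vanishes; e1 is then in the kernel of dx. *)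
move=> E; have [q0|q0] := eqVneq q 0.
  have th0 : th = 0 by apply/eqP; rewrite -[_ == _](expf_eq0 th 2) E q0 mulr0.
  exists e1; last by rewrite (plane_x1 HP) q0 th0 !sc0.
  apply/eqP=> e0; have := plane_free HP (k := 1) (l := 0).
  by rewrite sc1 sc0 addr0 => /(_ e0)[/eqP]; rewrite oner_eq0.
exists (sc th e1 + sc q e2).
  by apply/eqP=> /(plane_free HP)[_ /eqP]; rewrite (negbTE q0).
by rewrite plane_dx scDr !scA -expr2 E mulrC.
Qed.

Lemma plane_neq0 : exists x : M, x != 0.
Proof.
exists e1; apply/eqP=> e0; have := plane_free HP (k := 1) (l := 0).
by rewrite sc1 sc0 addr0 => /(_ e0)[/eqP]; rewrite oner_eq0.
Qed.

Lemma plane_proper (u : M) : exists w, w \notin line u.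
Proof.
have [//|N] := pselect (exists w, w \notin line u).
have {}N w : exists k, w = sc k u by apply/lineP/negPn/negP => h; apply: N; exists w.
have [k e1E] := N e1; have [l e2E] := N e2.
have := plane_free HP (k := l) (l := - k).
rewrite e1E e2E !scA -scDl mulNr [l * k]mulrC subrr sc0 => /(_ erefl)[l0 k0].
have := plane_free HP (k := 0) (l := 1).
by rewrite sc0 add0r e2E l0 sc0 scv0 => /(_ erefl)[_ /eqP]; rewrite oner_eq0.
Qed.

(** Any proper non-zero submodule is a line with eigenvalue th or -th, and the quotient carries the
    other one. The sum of the two indicators depends neither on the order nor on whether M is
    semisimple. *)
Lemma plane_mult_split L th (m : nat) : th ^+ 2 = p * q ->
  comp_mult L M m <->
  m = (`[< type1 L th (rho * th) >] + `[< type1 L (- th) (rho * - th) >])%N.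
Proof.
move=> thE.
have key (N : {pred M}) : GRing.submod_closed N -> (exists2 x, x \in N & x != 0) ->
    (exists y, y \notin N) ->
    (`[< section_iso L (@zero_pred _ _ M) N >] + `[< section_iso L N predT >])%N =
    (`[< type1 L th (rho * th) >] + `[< type1 L (- th) (rho * - th) >])%N.
  move=> Nc [u uN u0] [y yN]; have [th' thE' ux] := plane_submod_eigen Nc uN u0 yN.
  have [_ uy] := plane_eigen ux; have Nl := plane_submod_line Nc uN u0 yN.
  have z0 (x : M) : x = 0 -> x \in @zero_pred _ _ M by move=> ->; rewrite inE.
  have S1 : section_iso L (@zero_pred _ _ M) N <-> type1 L th' (rho * th').
    apply: (section_line genA L (zero_submod M) Nc (u := u)) => //.
    - by move=> x; rewrite inE => /eqP->; apply: smem0.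
    - move=> x; rewrite Nl => /lineP[k ->]; exists k; apply: z0; exact: subrr.
    - by apply: z0; rewrite ux subrr.
    - by apply: z0; rewrite uy subrr.
  have S2 : section_iso L N predT <-> type1 L (- th') (rho * - th').
    have dyq : dx *: y - sc (- th') y \in line u by apply: plane_quot.
    apply: (section_line genA L Nc (full_submod M) (u := y)) => //.
    - move=> x _; have yu : y \notin line u by rewrite -Nl.
      have [k [l ->]] := plane_basis u0 yu x; exists l.
      by rewrite addrK smem_sc.
    - by rewrite Nl.
    rewrite (plane_y HP) -scA -scvN -scDr Nl; apply: smem_sc dyq.
    exact: (line_submod genA (plane_eigen ux)).
  rewrite (asbool_equiv_eq S1) (asbool_equiv_eq S2).
  have : th' ^+ 2 == th ^+ 2 by rewrite thE thE'.
  by rewrite eqf_sqr => /orP[/eqP->|/eqP->] //; rewrite opprK addnC.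
rewrite comp_mult_length2.
- split=> [[N [Nc xN yN ->]]|->]; first exact: key.
  have [u u0 ux] := plane_eigenvector thE; have [y yu] := plane_proper u.
  have lc := line_submod genA (plane_eigen ux).
  exists (line u); split=> //; [by exists u; rewrite ?mem_line| by exists y|].
  by rewrite key //; [exists u; rewrite ?mem_line | exists y].
- have [u u0 ux] := plane_eigenvector thE; have [y yu] := plane_proper u.
  exists (line u); split; last by exists y.
    exact: (line_submod genA (plane_eigen ux)).
  by exists u; rewrite ?mem_line.
move=> N N' Nc Nc' NN' [x xN x0] [y yN'] v.
have yN : y \notin N by apply: contra yN'; apply: NN'.
by rewrite (plane_submod_line Nc xN x0 yN) (plane_submod_line Nc' (NN' _ xN) x0 yN').
Qed.

Hypothesis nonsq : forall th, th ^+ 2 != p * q.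

Lemma plane_simple : simple_module M.
Proof.
split=> [|S Sc]; first exact: plane_neq0.
have [[x xS x0]|N] := pselect (exists2 x, x \in S & x != 0); last first.
  by left=> x xS; apply/eqP/negPn/negP => x0; apply: N; exists x.
right=> y; apply/negPn/negP => yS.
by have [th /eqP] := plane_submod_eigen Sc xS x0 yS; rewrite (negbTE (nonsq th)).
Qed.

(** When p q has no square root, M and any simple L satisfying both relations have a basis of the
    form v, dx v, on which the generators act by the same matrices; so L and M are isomorphic. *)
Lemma plane_mult_simple L (m : nat) : simple_module L ->
  comp_mult L M m <-> m = `[< forall v : L, dx *: (dx *: v) = sc (p * q) v /\
                                dy *: v = sc rho (dx *: v) >].
Proof.
move=> sL; rewrite (comp_mult_simple _ _ plane_simple).
suff -> : `[< section_iso L (@zero_pred _ _ M) predT >] =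
  `[< forall v : L, dx *: (dx *: v) = sc (p * q) v /\ dy *: v = sc rho (dx *: v) >] by [].
apply/asboolP/asboolP.
  move=> [f [flin fsurj fker]] v; have [x _ <-] := fsurj v.
  have f0 : f 0 = 0 by apply/(fker 0) => //; rewrite inE.
  have fZ a y : f (a *: y) = a *: f y by rewrite -[a *: y]addr0 flin ?f0 ?addr0.
  split; first by rewrite -[sc _ (f x)](fZ (p * q)%:A) -!fZ plane_dx2.
  by rewrite -!fZ (plane_y HP); apply: fZ.
move=> acts; have [[v v0] simL] := sL.
have dxv : dx *: v \notin line v.
  apply/negP=> /lineP[th E]; have [E2 _] := acts v.
  case/eqP: (nonsq th); apply: (sc_inj v0); rewrite -E2 E scale_sc E scA expr2 //.
have q0 : q != 0.
  by apply/eqP=> q0; have := nonsq 0; rewrite q0 expr0n mulr0 eqxx.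
pose N : {pred L} := [pred z | `[< exists k l, z = sc k v + sc l (dx *: v) >]].
have Nc : GRing.submod_closed N.
  have xN z : z \in N -> dx *: z \in N.
    move=> /asboolP[k [l ->]]; apply/asboolP; exists (l * (p * q)), k.
    by rewrite scalerDr !scale_sc (acts v).1 scA addrC.
  have sN k z : z \in N -> sc k z \in N.
    by move=> /asboolP[k' [l' ->]]; apply/asboolP; exists (k * k'), (k * l'); rewrite scDr !scA.
  apply: (stable_submod genA) => //.
  - by apply/asboolP; exists 0, 0; rewrite !sc0 addr0.
  - move=> z z' /asboolP[k [l ->]] /asboolP[k' [l' ->]].
    by apply/asboolP; exists (k + k'), (l + l'); rewrite !scDl addrACA.
  - by move=> z zN; rewrite (acts z).2; apply/sN/xN.
have vN z : exists k l, z = sc k v + sc l (dx *: v).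
  case: (simL N Nc) => [N0|/(_ z)/asboolP //].
  have : v \in N by apply/asboolP; exists 1, 0; rewrite sc1 sc0 addr0.
  by move/N0/eqP; rewrite (negbTE v0).
have vfree k l : sc k v + sc l (dx *: v) = 0 -> k = 0 /\ l = 0.
  have [->|l0] := eqVneq l 0.
    by rewrite sc0 addr0 => /(sc_inj0 v0).
  move/eqP; rewrite addrC addr_eq0 => /eqP E; case/negP: dxv; apply/lineP.
  by exists (l^-1 * - k); rewrite -scA scN -E scA mulVf // sc1.
have co (x : M) : {kl : K * K | x = sc kl.1 e1 + sc kl.2 (dx *: e1)}.
  apply: cid; have [k [l ->]] := plane_span HP x; exists (k, l / q).
  by rewrite (plane_x1 HP) scA /= mulfVK.
have cofree k l k' l' : sc k e1 + sc l (dx *: e1) = sc k' e1 + sc l' (dx *: e1) ->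
    k = k' /\ l = l'.
  by rewrite (plane_x1 HP) !scA => /plane_uniq[-> /(mulIf q0)->].
pose g x := sc (sval (co x)).1 v + sc (sval (co x)).2 (dx *: v).
have gE k l : g (sc k e1 + sc l (dx *: e1)) = sc k v + sc l (dx *: v).
  by rewrite /g; case: (co _) => -[k' l'] /= /cofree[-> ->].
have gD x y : g (x + y) = g x + g y.
  have [[k l] /= ->] := co x; have [[k' l'] /= ->] := co y.
  by rewrite addrACA -!scDl !gE !scDl addrACA.
have gK k x : g (sc k x) = sc k (g x).
  by have [[k' l'] /= ->] := co x; rewrite scDr !scA !gE scDr !scA.
have gx x : g (dx *: x) = dx *: g x.
  have [[k l] /= ->] := co x; rewrite gE !scalerDr !scale_sc plane_dx2 (acts v).1.
  by rewrite !scA addrC gE addrC.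
have gA a x : g (a *: x) = a *: g x.
  move: a x; apply: genA => [x|a b IHa IHb x|k a IH x|a IH x|a IH x].
  - by rewrite !scale1r.
  - by rewrite !scalerDl gD IHa IHb.
  - by rewrite !sc_scale gK IH.
  - by rewrite -!scalerA gx IH.
  - by rewrite -!scalerA (plane_y HP) gK gx IH (acts _).2.
exists g; split=> [a x y _ _|z|x _]; first by rewrite gD gA.
  by have [k [l ->]] := vN z; exists (sc k e1 + sc l (dx *: e1)).
rewrite inE; have [[k l] /= ->] := co x; rewrite gE; split=> [/vfree[-> ->]|/eqP E].
  by rewrite !sc0 addr0.
have [-> ->] : k = 0 /\ l = 0 by apply: cofree; rewrite E !sc0 addr0.
by rewrite !sc0 addr0.
Qed.

End OnePlane.

Section Simple.
Hypothesis comA : forall a b : A, a * b = b * a.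

Lemma simple_ker L a : simple_module L ->
  (forall v : L, a *: v = 0) \/ (forall v : L, a *: v = 0 -> v = 0).
Proof.
move=> [_ sL]; pose S : {pred L} := [pred v | a *: v == 0].
have Sc : GRing.submod_closed S.
  split=> [|b u v]; rewrite !inE ?scaler0 // => /eqP u0 /eqP v0.
  by rewrite scalerDr scalerA comA -scalerA u0 v0 scaler0 addr0.
case: (sL S Sc) => E; [right=> v v0 | left=> v]; first by apply: E; rewrite inE v0.
by apply/eqP; have := E v; rewrite inE.
Qed.

(** By [simple_ker], each factor dx - th or dy - et is 0 or injective on L. If both are 0 for one
    pair, L is the corresponding module of dimension one. Otherwise an injective factor can be
    chosen for each pair; their product is injective and kills z L. The hypothesis ranges over all
    choices because the suitable one depends on L. *)
Lemma simple_kill L (ths : seq (K * K)) z : simple_module L ->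
  (forall w : K * K -> bool,
     (\prod_(p <- ths) (if w p then dx - p.1%:A else dy - p.2%:A)) * z = 0) ->
  (exists2 p, p \in ths & type1 L p.1 p.2) \/ forall v : L, z *: v = 0.
Proof.
move=> sL kill.
have [|N] := pselect (exists2 p, p \in ths & type1 L p.1 p.2); [by left | right].
have [[v0 v0n] _] := sL.
pose w (p : K * K) := `[< forall v : L, (dx - p.1%:A) *: v = 0 -> v = 0 >].
have inj p : p \in ths -> forall v : L,
    (if w p then dx - p.1%:A else dy - p.2%:A) *: v = 0 -> v = 0.
  move=> pt; rewrite /w; case: asboolP => // Nx.
  case: (simple_ker (dx - p.1%:A) sL) => // x0.
  case: (simple_ker (dy - p.2%:A) sL) => // y0; case: N; exists p => //.
  apply: (simple_eigen genA sL v0n); split; apply/eqP; rewrite -subr_eq0 /sc -scalerBl.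
    by rewrite x0.
  by rewrite y0.
have {}inj (r : seq (K * K)) : {subset r <= ths} -> forall v : L,
    (\prod_(p <- r) (if w p then dx - p.1%:A else dy - p.2%:A)) *: v = 0 -> v = 0.
  elim: r => [|p r IH] sr v; first by rewrite big_nil scale1r.
  rewrite big_cons -scalerA => /(inj p (sr p (mem_head _ _))); apply: IH.
  by move=> x xr; apply: sr; rewrite inE xr orbT.
by move=> v; apply: (inj ths) => //; rewrite scalerA kill scale0r.
Qed.

End Simple.
End Planes.

(** * The algebra generated by two commuting elements *)

Section GeneratedAlgebra.
Variables (K : fieldType) (aT : falgType K) (x y : aT).
Local Notation U := <<1 & [:: x; y]>>%AS.

Lemma memv_gen_x : x \in U.
Proof.
rewrite (subvP (sub_agenv _)) // (subvP (addvSr _ _)) //.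
by apply: memv_span; rewrite inE eqxx.
Qed.

Lemma memv_gen_y : y \in U.
Proof.
rewrite (subvP (sub_agenv _)) // (subvP (addvSr _ _)) //.
by apply: memv_span; rewrite !inE eqxx orbT.
Qed.

Definition gen_x : subvs_of U := Subvs memv_gen_x.
Definition gen_y : subvs_of U := Subvs memv_gen_y.

Lemma gen_one : vsval (1 : subvs_of U) = 1.
Proof.
apply/eqP; rewrite [_ == _](algid_eq1 U) (subvP (sub_agenv _)) //.
by rewrite (subvP (addvSl _ _)) ?memv_line.
Qed.

Lemma span_closed (Q : aT -> Prop) (X : seq aT) : Q 0 ->
  (forall u v, Q u -> Q v -> Q (u + v)) -> (forall k u, Q u -> Q (k *: u)) ->
  (forall u, u \in X -> Q u) -> forall v, v \in <<X>>%VS -> Q v.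
Proof.
move=> Q0 QD QZ QX v vX; rewrite (coord_span (X := in_tuple X) vX).
by elim/big_ind: _ => // i _; apply: QZ; apply: QX; rewrite mem_nth.
Qed.

(** The enveloping algebra is the sum of the powers, below the dimension of the algebra, of the span
    of 1, x and y; each power is reached by adding one factor on the left. *)
Lemma gen_ind (P : subvs_of U -> Prop) : P 1 ->
  (forall a b, P a -> P b -> P (a + b)) -> (forall (k : K) a, P a -> P (k *: a)) ->
  (forall a, P a -> P (gen_x * a)) -> (forall a, P a -> P (gen_y * a)) -> forall a, P a.
Proof.
move=> P1 PD PZ Px Py a0; pose Q v := exists2 a, vsval a = v & P a.
have Q0 : Q 0 by exists (0 *: 1); [rewrite scale0r | apply: PZ].
have Q1 : Q 1 by exists 1; rewrite ?gen_one.
have QD u v : Q u -> Q v -> Q (u + v).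
  by move=> [a <- Pa] [b <- Pb]; exists (a + b); last exact: PD.
have QZ k u : Q u -> Q (k *: u).
  by move=> [a <- Pa]; exists (k *: a); last exact: PZ.
have Qx u : Q u -> Q (x * u).
  by move=> [a <- Pa]; exists (gen_x * a); last exact: Px.
have Qy u : Q u -> Q (y * u).
  by move=> [a <- Pa]; exists (gen_y * a); last exact: Py.
pose V := (1 + <<[:: x; y]>>)%VS : {vspace aT}.
have QV u v : u \in V -> Q v -> Q (u * v).
  move=> /memv_addP[_ /vlineP[k ->] [w wS ->]] Qv; rewrite mulrDl; apply: (QD).
    by rewrite -scalerAl mul1r; apply: (QZ).
  move: w wS; apply: (span_closed (Q := fun w => Q (w * v))).
  - by rewrite mul0r.
  - by move=> w w' Qw Qw'; rewrite mulrDl; apply: (QD).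
  - by move=> l w Qw; rewrite -scalerAl; apply: QZ.
  - by move=> w; rewrite !inE => /orP[|] /eqP->; [apply: Qx | apply: Qy].
have QX n v : v \in (V ^+ n)%VS -> Q v.
  elim: n v => [|n IH] v; first by rewrite expv0 => /vlineP[k ->]; apply: QZ.
  rewrite expvSl unlock; move: v; apply: span_closed => // v.
  case/allpairsP=> -[u w] /= [uV wV ->]; apply: QV; first exact: vbasis_mem.
  exact: IH (vbasis_mem wV).
have : vsval a0 \in U by apply: subvsP.
rewrite -[_ \in U]/(_ \in (\sum_(i < \dim {:aT}) V ^+ i)%VS) => /memv_sumP[v vV E].
have : Q (vsval a0).
  by rewrite E; elim/big_ind: _ => // i _; apply: QX (vV i isT).
by case=> a /val_inj <-.
Qed.

Lemma gen_comm : x * y = y * x -> forall a b : subvs_of U, a * b = b * a.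
Proof.
move=> xy; have gxy : gen_x * gen_y = gen_y * gen_x by apply: val_inj.
have cD (c a b : subvs_of U) : c * a = a * c -> c * b = b * c -> c * (a + b) = (a + b) * c.
  by move=> ca cb; rewrite mulrDl mulrDr ca cb.
have cZ (c a : subvs_of U) (k : K) : c * a = a * c -> c * (k *: a) = (k *: a) * c.
  by move=> ca; rewrite -scalerAl -scalerAr ca.
have cM (c a b : subvs_of U) : c * a = a * c -> c * b = b * c -> c * (a * b) = (a * b) * c.
  by move=> ca cb; rewrite mulrA ca -mulrA cb mulrA.
have c1 (c : subvs_of U) : c * 1 = 1 * c by rewrite mulr1 mul1r.
have gen (c : subvs_of U) : c * gen_x = gen_x * c -> c * gen_y = gen_y * c ->
    forall b, c * b = b * c.
  by move=> cx cy; apply: gen_ind; auto.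
have cx := gen gen_x erefl gxy; have cy := gen gen_y (esym gxy) erefl.
by move=> a; apply: gen.
Qed.

End GeneratedAlgebra.

(** * Restrictions of matrix representations to the generated algebra *)

Section ResMod.
Variables (K : fieldType) (gT : finGroupType) (x y : grpalg K gT).

Section OneRep.
Variables (n : nat) (rho : mx_representation K [set: gT] n).
Local Notation M := (resmod [:: x; y] rho).
Local Notation U := <<1 & [:: x; y]>>%AS.

Lemma resmod_scaleE (a : subvs_of U) (v : M) : a *: v = grpalg_mx rho (vsval a) *m v.
Proof. by []. Qed.

Lemma grpalg_mxZ k (a : grpalg K gT) : grpalg_mx rho (k *: a) = k *: grpalg_mx rho a.
Proof.
rewrite /grpalg_mx scaler_sumr; apply: eq_bigr => g _.
by rewrite ffunE scalerA.
Qed.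

Lemma grpalg_mx_sum m (k : 'I_m -> K) (g : 'I_m -> gT) :
  grpalg_mx rho (\sum_i k i *: grpelt K (g i)) = \sum_i k i *: rho (g i).
Proof.
have mxE1 h : grpalg_mx rho (grpelt K h) = rho h.
  rewrite /grpalg_mx (bigD1 h) //= big1 => [|h' hh]; last first.
    by rewrite ffunE (negbTE hh) scale0r.
  by rewrite ffunE eqxx scale1r addr0.
have mx0 : grpalg_mx rho (0 : grpalg K gT) = 0.
  by rewrite -[0 in LHS](scale0r (grpelt K 1%g)) grpalg_mxZ scale0r.
elim/big_rec2: _ => [//|i A B _ <-]; by rewrite grpalg_mxD grpalg_mxZ mxE1.
Qed.

Lemma resmod_sc k (v : M) : sc (A := subvs_of U) k v = k *: (v : 'cV[K]_n).
Proof.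
rewrite /sc resmod_scaleE.
have -> : grpalg_mx rho (vsval (k%:A : subvs_of U)) = k *: 1%:M.
  rewrite -[vsval _]/(k *: vsval (1 : subvs_of U)) gen_one.
  by rewrite grpalg_mxZ grpalg_mx1.
by rewrite -scalemxAl mul1mx.
Qed.

End OneRep.

Lemma resmod_type1 n (rho : mx_representation K [set: gT] n) th et : n = 1%N ->
  grpalg_mx rho x = th%:M -> grpalg_mx rho y = et%:M ->
  type1 (gen_x x y) (gen_y x y) (resmod [:: x; y] rho) th et.
Proof.
move=> n1; move: rho; rewrite n1 => rho Ex Ey; exists (const_mx 1 : 'cV_1); split.
- by apply/eqP=> /matrixP/(_ 0 0)/eqP; rewrite !mxE oner_eq0.
- by split; rewrite resmod_scaleE resmod_sc /= ?Ex ?Ey mul_scalar_mx.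
move=> z; exists ((z : 'cV_1) 0 0); rewrite resmod_sc.
by apply/matrixP=> i j; rewrite !ord1 !mxE mulr1.
Qed.

Lemma resmod_plane n (rho : mx_representation K [set: gT] n)
    (P : 'M[K]_(n, 2)) (Q : 'M[K]_(2, n)) p q r : 
  P *m Q = 1%:M -> Q *m P = 1%:M ->
  Q *m grpalg_mx rho x *m P = \matrix_(i, j) (if i == j then 0 else if i == 0 then p else q) ->
  grpalg_mx rho y = r *: grpalg_mx rho x ->
  exists e1 e2 : resmod [:: x; y] rho, plane (gen_x x y) (gen_y x y) e1 e2 p q r.
Proof.
move=> PQ QP Ex Ey.
have coord (v : 'cV[K]_2) : v = v 0 0 *: delta_mx 0 0 + v 1 0 *: delta_mx 1 0.
  by apply/matrixP; apply: forall_ord2 => j; rewrite !mxE !ord1 /= ?(mulr1, mulr0, addr0, add0r).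
have ax : grpalg_mx rho x *m P = P *m \matrix_(i, j) (if i == j then 0 else if i == 0 then
  p else q).
  by rewrite -Ex !mulmxA PQ mul1mx.
exists (P *m delta_mx 0 0 : 'cV_n), (P *m delta_mx 1 0 : 'cV_n); split.
- move=> v; exists ((Q *m v) 0 0), ((Q *m v) 1 0).
  rewrite !resmod_sc; rewrite -[v in LHS]mul1mx -PQ -mulmxA [Q *m v in LHS]coord.
  by rewrite mulmxDr -!scalemxAr.
- move=> k l; rewrite !resmod_sc !scalemxAr -mulmxDr => /(congr1 (mulmx Q)).
  rewrite mulmxA QP mul1mx mulmx0 => /matrixP E.
  have := E 0 0; have := E 1 0; rewrite !mxE /=.
  by rewrite !(mulr1, mulr0, addr0, add0r).
- rewrite resmod_scaleE resmod_sc /= mulmxA ax -mulmxA scalemxAr; congr (_ *m _).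
  by apply/matrixP; apply: forall_ord2 => j;
    rewrite mulmx22E !mxE !ord1 /= ?(mulr1, mulr0, addr0, add0r, mul0r).
- rewrite resmod_scaleE resmod_sc /= mulmxA ax -mulmxA scalemxAr; congr (_ *m _).
  by apply/matrixP; apply: forall_ord2 => j;
    rewrite mulmx22E !mxE !ord1 /= ?(mulr1, mulr0, addr0, add0r, mul0r).
- by move=> v; rewrite resmod_sc !resmod_scaleE /= Ey scalemxAl.
Qed.

End ResMod.

Lemma type1_mult (K : fieldType) (A : algType K) (dx dy : A) 
  (genA : forall P : A -> Prop, P 1 ->
  (forall a b, P a -> P b -> P (a + b)) -> (forall (k : K) a, P a -> P (k *: a)) ->
  (forall a, P a -> P (dx * a)) -> (forall a, P a -> P (dy * a)) -> forall a, P a)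
  (L M : lmodType A) th et (m : nat) : type1 dx dy M th et ->
  comp_mult L M m <-> m = `[< type1 dx dy L th et >].
Proof.
move=> tM; rewrite (comp_mult_simple _ _ (type1_simple tM)).
have [u [u0 [ux uy] uspan]] := tM.
have z0 (x : M) : x = 0 -> x \in @zero_pred _ _ M by move=> ->; rewrite inE.
have E : section_iso L (@zero_pred _ _ M) predT <-> type1 dx dy L th et.
  apply: (section_line genA L (zero_submod M) (full_submod M) (u := u)) => //.
  - by move=> x _; have [k ->] := uspan x; exists k; apply: z0; apply: subrr.
  - by apply: z0; rewrite ux subrr.
  - by apply: z0; rewrite uy subrr.
by rewrite (_ : `[< type1 dx dy L th et >] = `[< section_iso L (@zero_pred _ _ M) predT >]) //;
   apply/asboolP/asboolP => /E.
Qed.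

Fact frac_mulA (K : fieldType) (a b e c : K) : a * b / e * c = a * (b * c) / e.
Proof. by rewrite mulrAC mulrA. Qed.

(** * Calogero-Moser cellular characters *)

Section Dunkl.
Variables (R : realType) (d : nat) (zeta : R[i]).
Variables (gT : finGroupType) (V : mx_representation R[i] [set: gT] 2).
Variable s_ : nat -> gT.
Hypotheses (hzeta : d.-primitive_root zeta) (hV : mx_faithful V)
  (hs : forall i : nat, V (s_ i) = refl_mx zeta i)
  (hW : <<[set s_ 0%N; s_ 1%N]>>%g = [set: gT]).
Local Notation F := (R[i]).
Local Notation W := [set: gT].
Local Notation s := (s_ 0%N).
Local Notation t := (s_ 1%N).
Variables (K : fieldType) (f : {rmorphism F -> K}) (X Y : K) (c : nat -> F).
Hypotheses (X0 : X != 0) (Y0 : Y != 0) (den0 : forall i, lin_den f X Y zeta i != 0).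
Hypothesis pfrac0 : forall a, pfrac f X Y d zeta a = 0 -> forall i, (i < d)%N -> a i = 0.
Hypotheses (c_per : forall i, c (i + d)%N = c i) (c2 : forall i, c i.+2 = c i).
Local Notation pfrac := (pfrac f X Y d zeta).
Local Notation Pk := (Pk f X Y d zeta c).
Local Notation fval := (fval f X Y d zeta c).

Definition dunkl_x : grpalg K gT :=
  - \sum_(i < d) (f (c i) / (X - f (zeta ^+ i) * Y)) *: grpelt K (s_ i).

Definition dunkl_y : grpalg K gT :=
  \sum_(i < d) (f (c i * zeta ^+ i) / (X - f (zeta ^+ i) * Y)) *: grpelt K (s_ i).

Lemma dunkl_xE : dunkl_x =
  \sum_(i < d) (- (f (c i) / (X - f (zeta ^+ i) * Y))) *: grpelt K (s_ i).
Proof. by rewrite /dunkl_x -sumrN; apply: eq_bigr => i _; rewrite scaleNr. Qed.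

Local Notation Res rho := (resmod [:: dunkl_x; dunkl_y] (map_repr f rho)).
Local Notation gx := (gen_x dunkl_x dunkl_y).
Local Notation gy := (gen_y dunkl_x dunkl_y).

Lemma repr1_mx n (rho : mx_representation F W n) m (a : 'I_m -> K) (i_ : 'I_m -> nat) : n = 1%N ->
  \sum_i a i *: map_repr f rho (s_ (i_ i)) = (\sum_i a i * f (\tr (rho (s_ (i_ i)))))%:M.
Proof.
move=> n1; move: rho; rewrite n1 => rho; rewrite raddf_sum; apply: eq_bigr => i _.
have E : map_mx f (rho (s_ (i_ i))) = (f (\tr (rho (s_ (i_ i)))))%:M.
  by rewrite {1}[rho _]mx11_scalar map_scalar_mx /mxtrace big_ord1.
by rewrite [X in _ *: X]E scale_scalar_mx.
Qed.

Lemma res_type1 n (rho : mx_representation F W n) : n = 1%N ->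
  type1 gx gy (Res rho) (- pfrac (fun i => c i * \tr (rho (s_ i))))
    (pfrac (fun i => c i * \tr (rho (s_ i)) * zeta ^+ i)).
Proof.
move=> n1; apply: (resmod_type1 n1).
  rewrite dunkl_xE grpalg_mx_sum (repr1_mx _ _ _ n1); congr _%:M.
  rewrite -sumrN; apply: eq_bigr => i _.
  by rewrite mulNr rmorphM mulrAC.
rewrite grpalg_mx_sum (repr1_mx _ _ _ n1); congr _%:M.
apply: eq_bigr => i _.
by rewrite [in RHS]mulrAC [in RHS]rmorphM [in RHS]mulrAC.
Qed.

Lemma sum_dih_mx (a : 'I_d -> K) (xi : F) :
  \sum_i a i *: map_mx f (dih_mx true (xi ^+ i)) = \matrix_(i, j)
    (if i == j then 0 else if i == 0 then \sum_k a k * f (xi ^+ k) else \sum_k a k * f (xi ^- k)).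
Proof.
apply/matrixP; apply: forall_ord2; apply: forall_ord2; rewrite !mxE summxE /=.
- by apply: big1 => i _; rewrite !mxE /= rmorph0 mulr0.
- by apply: eq_bigr => i _; rewrite !mxE.
- by apply: eq_bigr => i _; rewrite !mxE.
- by apply: big1 => i _; rewrite !mxE /= rmorph0 mulr0.
Qed.

(** In the model with xi = zeta^k, D_x is antidiagonal with entries -P_k and -P_(d-k), and D_y with
    entries P_(k+1) and P_(d-k+1). As xi^2 <> 1, [PkS] applies at k and at d - k and gives D_y =
    -(X/Y) D_x, while [Pk_mulN] gives the same product p q for all k. *)
Lemma res_plane n (rho : mx_representation F W n) : mx_irreducible rho -> n = 2 ->
  (2 < d)%N /\ exists (e1 e2 : Res rho) p q,
    p * q = fval /\ plane gx gy e1 e2 p q (- (X / Y)).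
Proof.
move=> irr n2; move: rho irr; rewrite n2 => rho irr.
have [xi [P [xid xi2 uP] Ps]] := repr_model2 hzeta hV hs hW irr.
have [k xiE] := prim_rootP hzeta xid.
have zk : zeta ^+ (2 * k) != 1 by rewrite mulnC exprM -xiE.
have k0 : (0 < k)%N by case: posnP zk => // ->; rewrite muln0 expr0 eqxx.
have kd := ltn_ord k.
have z1 : zeta ^+ d = 1 by apply: prim_expr_order.
have d2 : (2 < d)%N.
  rewrite ltnNge; apply: contra zk => d2.
  have -> : (2 * k = d)%N by lia.
  by rewrite z1.
have zk' : zeta ^+ (2 * (d - k)) != 1.
  apply: contra zk => /eqP E; rewrite -[X in _ == X](expr1n _ 2) -z1 -exprM.
  have -> : (d * 2 = 2 * (d - k) + 2 * k)%N by lia.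
  by rewrite exprD E mul1r.
split=> //; pose p := - Pk k; pose q := - Pk (d - k).
have repE (a : 'I_d -> K) : \sum_i a i *: map_repr f rho (s_ i) =
    map_mx f (invmx P) *m (\sum_i a i *: map_mx f (dih_mx true (xi ^+ i))) *m map_mx f P
    :> 'M_2.
  rewrite mulmx_sumr mulmx_suml; apply: eq_bigr => i _.
  have E : map_repr f rho (s_ i) = map_mx f (rho (s_ i)) :> 'M_2 by [].
  by rewrite [X in _ *: X = _]E Ps !map_mxM -scalemxAr -scalemxAl.
have xV (i : nat) : xi ^- i = zeta ^+ ((d - k) * i).
  apply: (mulfI (x := xi ^+ i)).
    by apply: expf_neq0; apply: contraNneq xi2 => x0; move: xid;
       rewrite x0 expr0n gtn_eqF //= => [/eqP|]; [rewrite eq_sym oner_eq0 | lia].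
  rewrite mulfV; last first.
    by apply: expf_neq0; apply: contraNneq xi2 => x0; move: xid;
       rewrite x0 expr0n gtn_eqF //= => [/eqP|]; [rewrite eq_sym oner_eq0 | lia].
  by rewrite xiE -exprM -exprD -mulnDl subnKC ?(ltnW kd) // exprM z1 expr1n.
have PP : map_mx f (invmx P) *m map_mx f P = 1%:M by rewrite -map_mxM mulVmx // map_mx1.
have PP' : map_mx f P *m map_mx f (invmx P) = 1%:M by rewrite -map_mxM mulmxV // map_mx1.
have Sx := etrans (congr1 _ dunkl_xE) (etrans (grpalg_mx_sum (map_repr f rho) _ _) (repE _)) :
  grpalg_mx (map_repr f rho) dunkl_x = _.
have Sy := etrans (grpalg_mx_sum (map_repr f rho) _ _) (repE _) : grpalg_mx (map_repr f
  rho) dunkl_y = _.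
have := @resmod_plane _ _ dunkl_x dunkl_y _ (map_repr f rho) _ _ p q (- (X / Y)) PP PP'.
case.
- rewrite Sx !mulmxA PP' mul1mx -mulmxA PP' mulmx1 sum_dih_mx.
  apply/matrixP=> i j; rewrite !mxE; case: (_ == j) => //; case: (_ == 0).
    rewrite /p -sumrN; apply: eq_bigr => l _.
    by rewrite mulNr xiE -exprM rmorphM mulrAC.
  rewrite /q -sumrN; apply: eq_bigr => l _.
  by rewrite mulNr xV rmorphM mulrAC.
- rewrite Sx Sy scalemxAl scalemxAr; congr (_ *m _ *m _).
  rewrite !sum_dih_mx; apply/matrixP=> i j; rewrite !mxE.
  have S1 := PkS hzeta X0 Y0 den0 c_per c2 zk.
  have S2 := PkS hzeta X0 Y0 den0 c_per c2 zk'.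
  case: (_ == j); first by rewrite mulr0.
  case: (_ == 0).
    transitivity (Pk k.+1).
      apply: eq_bigr => l _; rewrite [in RHS]mulSn [in RHS]exprD !rmorphM xiE -exprM.
      exact: frac_mulA.
    rewrite S1 mulNr -mulrN -sumrN; congr (_ * _); apply: eq_bigr => l _.
    by rewrite mulNr opprK xiE -exprM rmorphM mulrAC.
  transitivity (Pk (d - k).+1).
    apply: eq_bigr => l _; rewrite [in RHS]mulSn [in RHS]exprD !rmorphM xV.
    exact: frac_mulA.
  rewrite S2 mulNr -mulrN -sumrN; congr (_ * _); apply: eq_bigr => l _.
  by rewrite mulNr opprK xV rmorphM mulrAC.
move=> e1 [e2 pl]; exists e1, e2, p, q; split=> //.
by rewrite /p /q mulrNN; apply: (Pk_mulN hzeta X0 Y0 den0 c_per c2).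
Qed.

End Dunkl.

Fact neg_mul_left (K : pzRingType) (x y : K) : - x * y = -1 * (x * y).
Proof. by rewrite mulNr mulN1r. Qed.

Fact mul_expr0 (K : comPzRingType) (x y z : K) : x * y = y * (x * z ^+ 0).
Proof. by rewrite expr0 mulr1 mulrC. Qed.

Fact neg_ratio_cancel (K : fieldType) (x y u : K) : y != 0 -> - (x * u) = y * (- (x / y) * u).
Proof. by move=> y0; field. Qed.

(** * Eigenvalues of D_x and D_y on the linear characters *)

Section LinearEigenvalues.
Variables (R : realType) (d : nat) (zeta : R[i]).
Variables (gT : finGroupType) (V : mx_representation R[i] [set: gT] 2).
Variable s_ : nat -> gT.
Hypotheses (hzeta : d.-primitive_root zeta) (hV : mx_faithful V)
  (hs : forall i : nat, V (s_ i) = refl_mx zeta i)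
  (hW : <<[set s_ 0%N; s_ 1%N]>>%g = [set: gT]).
Local Notation F := (R[i]).
Local Notation s := (s_ 0%N).
Local Notation t := (s_ 1%N).
Variables (K : fieldType) (f : {rmorphism F -> K}) (X Y : K).
Variable cr : gT -> R.
Hypothesis hc : forall (i : nat) (w : gT), cr (s_ i ^ w)%g = cr (s_ i).
Local Notation c := (fun i : nat => (cr (s_ i))%:C%C : F).
Local Notation a := (cr s).
Local Notation b := (cr t).
Hypotheses (X0 : X != 0) (Y0 : Y != 0) (den0 : forall i, lin_den f X Y zeta i != 0).
Hypothesis pfrac0 : forall a, pfrac f X Y d zeta a = 0 -> forall i, (i < d)%N -> a i = 0.
Local Notation pfrac := (pfrac f X Y d zeta).
Local Notation Pk := (Pk f X Y d zeta c).
Local Notation fval := (fval f X Y d zeta c).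
Implicit Types (chi : Irr R gT).
Let D := matrix_dihedral hzeta hV hs hW.
Let d0 : (0 < d)%N := prim_order_gt0 hzeta.

Lemma cplx_per i : c (i + d)%N = c i.
Proof. by rewrite /= (s_per hzeta hV hs). Qed.

Lemma cplx2 i : c i.+2 = c i.
Proof. by rewrite /= (c_SS hzeta hV hs hW hc). Qed.

Definition wc chi (i : nat) : F := c i * Defs.irr_char chi (s_ i).

Definition thx chi : K := - pfrac (wc chi).
Definition thy chi : K := pfrac (fun i => wc chi i * zeta ^+ i).

Lemma irr1_s chi i : irr_degree chi = 1%N ->
  Defs.irr_char chi (s_ i) = (-1) ^+ (if odd i then (lin_idx s_ chi).2 else (lin_idx s_ chi).1).
Proof.
move=> d1; have [[e le] E] := irr_deg1 hzeta hV hs hW d1.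
have [eM es et] := le; rewrite E (lin_charE R D _ le); congr (_ ^+ _).
suff : e (s_ i) = (if odd i then (lin_idx s_ chi).2 else (lin_idx s_ chi).1) /\
       e (s_ i.+1) = (if odd i.+1 then (lin_idx s_ chi).2 else (lin_idx s_ chi).1).
  by case=> ->.
move: es et; move: (lin_idx s_ chi).1 (lin_idx s_ chi).2 => p q es et.
elim: i => [|i [I1 I2]]; first by split.
split=> //; rewrite (s_SS hzeta hV hs hW) /= negbK -I1 conjgE !eM.
have eV g : e g^-1%g = e g.
  have := eM g g^-1%g; rewrite mulgV; have := eM 1%g 1%g; rewrite mulg1.
  by case: (e 1%g) (e g) (e g^-1%g) => [] [] [].
by rewrite !eV addbCA addbb addbF.
Qed.

Lemma wcE chi i : irr_degree chi = 1%N -> wc chi i =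
  ((if odd i then (-1) ^+ (lin_idx s_ chi).2 * b else (-1) ^+ (lin_idx s_ chi).1 * a)%:C)%C.
Proof.
move=> d1; rewrite /wc (irr1_s i d1) (c_parity hzeta hV hs hW hc i).
by case: (odd i); rewrite [RHS]rmorphM rmorph_sign mulrC.
Qed.

Lemma wc_per chi i : wc chi (i + d) = wc chi i.
Proof. by rewrite /wc (s_per hzeta hV hs). Qed.

(** Two consecutive indices have different parities and contribute the weight. Adding the sum to its
    own shift pairs the indices for odd d as well, so twice the sum is d times the weight. *)
Lemma wc_sum chi : irr_degree chi = 1%N ->
  (\sum_(i < d) wc chi i == 0) = (wt a b (lin_idx s_ chi).1 (lin_idx s_ chi).2 == 0).
Proof.
move=> d1; pose w := ((wt a b (lin_idx s_ chi).1 (lin_idx s_ chi).2)%:C)%C : F.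
have E : \sum_(i < d) wc chi i + \sum_(i < d) wc chi i = d%:R * w.
  rewrite -{2}(sum_shift (G := wc chi)); last exact: (wc_per chi 0).
  rewrite -big_split; transitivity (\sum_(i < d) w); last first.
    by rewrite sumr_const card_ord mulr_natl.
  apply: eq_bigr => i _; rewrite /= !wcE // /w /wt -rmorphD /=.
  by case: (odd i) => //=; rewrite addrC.
have dn : (d%:R : F) != 0 by rewrite pnatr_eq0 -lt0n.
apply/eqP/eqP => S0.
  move/eqP: E; rewrite S0 addr0 eq_sym mulf_eq0 (negbTE dn) /= => /eqP.
  by rewrite /w => /(@complexI R).
move: E; rewrite /w S0 mulr0 -mulr2n => /eqP.
by rewrite mulrn_eq0 => /eqP.
Qed.

Lemma th_sum chi : X * thx chi + Y * thy chi = - f (\sum_(i < d) wc chi i).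
Proof. by rewrite -(pfrac_shift d den0) /thx mulrN opprB addrC. Qed.

Lemma th_wt chi : irr_degree chi = 1%N ->
  (X * thx chi + Y * thy chi == 0) = (wt a b (lin_idx s_ chi).1 (lin_idx s_ chi).2 == 0).
Proof. by move=> d1; rewrite th_sum oppr_eq0 fmorph_eq0 wc_sum. Qed.

Lemma thy_ratio chi : irr_degree chi = 1%N ->
  wt a b (lin_idx s_ chi).1 (lin_idx s_ chi).2 = 0 -> thy chi = - (X / Y) * thx chi.
Proof.
move=> d1 w0; have /eqP E : X * thx chi + Y * thy chi == 0 by rewrite th_wt // w0.
apply: (mulfI Y0); move/eqP: E; rewrite addrC addr_eq0 => /eqP->.
exact: neg_ratio_cancel.
Qed.

Lemma lin_idx_d1 chi : irr_degree chi = 1%N -> odd d -> (lin_idx s_ chi).1 = (lin_idx s_ chi).2.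
Proof.
move=> d1 od; have Ed := irr1_s d d1; rewrite od in Ed.
have per := s_per hzeta hV hs 0; rewrite add0n in per.
have : (-1) ^+ (lin_idx s_ chi).1 = (-1) ^+ (lin_idx s_ chi).2 :> F.
  exact: etrans (esym (irr1_s 0 d1)) (etrans (congr1 _ (esym per)) Ed).
move/eqP; rewrite -subr_eq0; move: (lin_idx s_ chi).1 (lin_idx s_ chi).2 => [] [] //=;
  by rewrite ?expr1 ?expr0 ?opprK -?opprD ?oppr_eq0 -[1 + 1]/(2%:R) pnatr_eq0.
Qed.

(** Equal signs make chi(s_i) constant, which leads to P_0. Different signs force d even and
    chi(s_i) = (-1)^(p+i) with -1 = zeta^(d/2), which leads to P_(d/2). *)
Lemma wc_Pk chi : irr_degree chi = 1%N -> exists k, [/\ k = 0%N \/ ~~ odd d /\ k = d./2 &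
  forall i, wc chi i = (-1) ^+ (lin_idx s_ chi).1 * (c i * zeta ^+ (k * i))].
Proof.
move=> d1; have [E|N] := eqVneq (lin_idx s_ chi).1 (lin_idx s_ chi).2.
  exists 0%N; split=> [|i]; first by left.
  by rewrite /wc (irr1_s i d1) -E if_same mul0n; apply: mul_expr0.
have nd : ~~ odd d by apply: contra N => od; rewrite lin_idx_d1.
exists d./2; split=> [|i]; first by right.
rewrite /wc (irr1_s i d1) exprM (zeta_half hzeta hV nd) mulrCA; congr (_ * _).
rewrite -(signr_odd _ i) -signr_addb; congr (_ ^+ _).
by move: N; move: (lin_idx s_ chi).1 (lin_idx s_ chi).2 => [] []; case: (odd i).
Qed.

(** The indices 0 and d/2 are those where X P_k = Y P_(k+1) can fail; weight 0 says that the sum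
    measuring the failure vanishes. *)
Lemma th_sq chi : irr_degree chi = 1%N ->
  wt a b (lin_idx s_ chi).1 (lin_idx s_ chi).2 = 0 -> thx chi ^+ 2 = fval.
Proof.
move=> d1 w0; have [k [kP wk]] := wc_Pk d1.
have S0 : \sum_(i < d) c i * zeta ^+ (k * i) = 0.
  have /eqP : \sum_(i < d) wc chi i == 0 by rewrite wc_sum // w0.
  rewrite (eq_bigr (fun i : 'I_d => (-1) ^+ (lin_idx s_ chi).1 * (c i * zeta ^+ (k * i)))).
    by rewrite -mulr_sumr => /eqP; rewrite mulf_eq0 signr_eq0 => /eqP.
  by move=> i _; exact: wk.
have XY : X * Pk k = Y * Pk k.+1.
  by apply/eqP; rewrite -subr_eq0 (Pk_shift d den0) S0 rmorph0.
have -> : thx chi = - (f ((-1) ^+ (lin_idx s_ chi).1) * Pk k).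
  by rewrite /thx; congr (- _); rewrite -pfracZ; apply: eq_pfrac.
rewrite sqrrN exprMn rmorph_sign sqrr_sign mul1r.
case: kP XY => [->|[nd ->]] XY; first exact: fval_diag.
by apply: (fval_half hzeta X0 Y0 den0 cplx_per cplx2 nd).
Qed.

(** Partial fractions are unique, so the eigenvalue of D_x determines the c_i chi(s_i) for i < d.
    The signed parameters are read at i = 0 and i = 1; for d = 1, oddness makes them equal. *)
Lemma th_eq chi chi' : irr_degree chi = 1%N -> irr_degree chi' = 1%N ->
  (thx chi = thx chi' /\ thy chi = thy chi') <->
  same_wt a b (lin_idx s_ chi).1 (lin_idx s_ chi).2 (lin_idx s_ chi').1 (lin_idx s_ chi').2.
Proof.
move=> d1 d1'; have W i := wcE i d1; have W' i := wcE i d1'.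
have O := lin_idx_d1 d1; have O' := lin_idx_d1 d1'.
move: W W' O O'; case: (lin_idx s_ chi) => p q; case: (lin_idx s_ chi') => p' q' /= W W' O O'.
split=> [[/oppr_inj E _]|/andP[/eqP Ea /eqP Eb]]; last first.
  have E i : wc chi i = wc chi' i by rewrite W W' Ea Eb.
  by split; [rewrite /thx; congr (- _) | ]; apply: eq_pfrac => i; rewrite E.
have {}E i : (i < d)%N -> wc chi i = wc chi' i by apply: (pfrac_eq pfrac0).
have E0 : (-1) ^+ p * a = (-1) ^+ p' * a.
  by apply: (@complexI R); have := E 0%N d0; rewrite W W'.
rewrite /same_wt E0 eqxx /=.
case: (ltnP 1 d) => d2.
  by have := E 1%N d2; rewrite W W' => /(@complexI R) ->.
have od : odd d by have -> : d = 1%N by lia.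
by rewrite -(O od) -(O' od) (c_odd hzeta hV hs hW hc od) E0.
Qed.

(** Multiplication by e_{1,1} negates every chi(s_i). When [thx chi] is a square root of [fval],
    this realises the other root by a linear character too. *)
Lemma lin_opp chi : irr_degree chi = 1%N -> exists2 chi', irr_degree chi' = 1%N &
  [/\ wt a b (lin_idx s_ chi').1 (lin_idx s_ chi').2 = - wt a b (lin_idx s_ chi).1 (lin_idx
    s_ chi).2,
   thx chi' = - thx chi & thy chi' = - thy chi].
Proof.
move=> d1; have W i := wcE i d1; have := (irr_deg1 hzeta hV hs hW d1).1.
move: W; case: (lin_idx s_ chi) => p q W [e le]; rewrite /= in W le.
have [e' le'] := lin_ex_diag hzeta hV hs hW true.
have le2 := is_linD le le'; rewrite !addbT in le2.
have [chi' d1' idx'] := lin_ex_irr R (ex_intro _ _ le2).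
have w' i : wc chi' i = - wc chi i.
  by rewrite (wcE i d1') idx' W -rmorphN /=; case: (odd i); rewrite signrN mulNr.
exists chi' => //; rewrite idx' /= /wt !signrN !mulNr opprD; split=> //.
  rewrite /thx opprK; transitivity (- (f (-1) * pfrac (wc chi))).
    by rewrite -pfracZ; congr (- _); apply: eq_pfrac => i; rewrite w' mulN1r.
  by rewrite rmorphN1 mulN1r opprK.
rewrite /thy; transitivity (f (-1) * thy chi).
  rewrite -pfracZ; apply: eq_pfrac => i; rewrite w'; exact: neg_mul_left.
by rewrite rmorphN1 mulN1r.
Qed.

Lemma fval_eq0 : (a == 0) && (b == 0) = false -> fval != 0.
Proof.
move=> ab; have cC0 x : (x%:C)%C = 0 :> F -> x = 0 by move=> /(@complexI R).
have [a0|a0] := eqVneq a 0; last first.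
  apply: (fval_neq0 hzeta X0 Y0 pfrac0 d0).
  by apply: contra a0 => /eqP /cC0 ->.
have b0 : b != 0 by move: ab; rewrite a0 eqxx /= => ->.
case: (ltnP 1 d) => d2.
  apply: (fval_neq0 hzeta X0 Y0 pfrac0 d2).
  by apply: contra b0 => /eqP /cC0 ->.
have od : odd d by have -> : d = 1%N by lia.
by rewrite (c_odd hzeta hV hs hW hc od) a0 eqxx in b0.
Qed.

End LinearEigenvalues.

(* The one-dimensional module on which A acts through [psi] *)
Section CharMod.
Variables (K : fieldType) (A : algType K) (psi : A -> K).

Definition char_mod of psi 1 = 1 & {morph psi : x y / x * y} & {morph psi : x y / x + y}
  : Type := K.

Hypotheses (psi1 : psi 1 = 1) (psiM : {morph psi : x y / x * y})
  (psiD : {morph psi : x y / x + y}).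
Local Notation M := (char_mod psi1 psiM psiD).

HB.instance Definition _ := GRing.Zmodule.copy M K.

Definition char_mod_scale (a : A) (v : M) : M := psi a * (v : K).

Fact char_mod_scaleA a b v : char_mod_scale a (char_mod_scale b v) = char_mod_scale (a * b) v.
Proof. by rewrite /char_mod_scale psiM mulrA. Qed.

Fact char_mod_scale1 : left_id 1 char_mod_scale.
Proof. by move=> v; rewrite /char_mod_scale psi1 mul1r. Qed.

Fact char_mod_scaleDr : right_distributive char_mod_scale +%R.
Proof. by move=> a u v; apply: mulrDr. Qed.

Fact char_mod_scaleDl v : {morph char_mod_scale^~ v : a b / a + b}.
Proof. by move=> a b; rewrite /char_mod_scale psiD mulrDl. Qed.

HB.instance Definition _ := GRing.Zmodule_isLmodule.Build A M
  char_mod_scaleA char_mod_scale1 char_mod_scaleDr char_mod_scaleDl.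

Lemma char_mod_type1 (dx dy : A) : (forall k : K, psi k%:A = k) ->
  type1 dx dy M (psi dx) (psi dy).
Proof.
move=> psiK; exists (1 : K); split=> [||z]; first exact: (@oner_neq0 K).
  split; rewrite /sc -[LHS]/(psi _ * 1) -[RHS]/(psi _ * 1) psiK //.
by exists (z : K); rewrite /sc -[RHS]/(psi _ * 1) psiK mulr1.
Qed.

End CharMod.

(** The line of u is a predicate on M, not a module. The scalars by which A acts on u form a
    morphism psi from A to K, and [char_mod] is the module it defines. *)
Lemma eigen_type1 (K : fieldType) (A : algType K) (dx dy : A)
  (genA : forall P : A -> Prop, P 1 ->
  (forall a b, P a -> P b -> P (a + b)) -> (forall (k : K) a, P a -> P (k *: a)) ->
  (forall a, P a -> P (dx * a)) -> (forall a, P a -> P (dy * a)) -> forall a, P a)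
  (M : lmodType A) (u : M) th et : u != 0 -> eigen dx dy th et u ->
  exists L : lmodType A, type1 dx dy L th et.
Proof.
move=> u0 [ux uy].
have act a : exists k, a *: u = sc k u.
  move: a; apply: genA.
  - by exists 1; rewrite scale1r sc1.
  - by move=> a b [k E] [l E']; exists (k + l); rewrite scalerDl scDl E E'.
  - by move=> k a [l E]; exists (k * l); rewrite sc_scale E scA.
  - by move=> a [l E]; exists (th * l); rewrite -scalerA E scale_sc ux scA mulrC.
  - by move=> a [l E]; exists (et * l); rewrite -scalerA E scale_sc uy scA mulrC.
pose psi a := sval (cid (act a)).
have psiP a : a *: u = sc (psi a) u := svalP (cid (act a)).
have psiE a k : a *: u = sc k u -> psi a = k by rewrite psiP => /(sc_inj u0).
have psi1 : psi 1 = 1 by apply: psiE; rewrite scale1r sc1.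
have psiM : {morph psi : x y / x * y}.
  by move=> a b; apply: psiE; rewrite -scalerA (psiP b) scale_sc (psiP a) scA mulrC.
have psiD : {morph psi : x y / x + y}.
  by move=> a b; apply: psiE; rewrite scalerDl !psiP scDl.
exists (char_mod psi1 psiM psiD : lmodType A).
by rewrite -(psiE dx th ux) -(psiE dy et uy); apply: char_mod_type1 => k; apply: psiE.
Qed.

(** * Simple modules of Gau(W, c) and their multiplicities *)

Section CMCharacters.
Variables (R : realType) (d : nat) (zeta : R[i]).
Variables (gT : finGroupType) (V : mx_representation R[i] [set: gT] 2).
Variable s_ : nat -> gT.
Hypotheses (hzeta : d.-primitive_root zeta) (hV : mx_faithful V)
  (hs : forall i : nat, V (s_ i) = refl_mx zeta i)
  (hW : <<[set s_ 0%N; s_ 1%N]>>%g = [set: gT]).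
Local Notation F := (R[i]).
Local Notation s := (s_ 0%N).
Local Notation t := (s_ 1%N).
Variables (K : fieldType) (f : {rmorphism F -> K}) (X Y : K).
Variable cr : gT -> R.
Hypothesis hc : forall (i : nat) (w : gT), cr (s_ i ^ w)%g = cr (s_ i).
Local Notation c := (fun i : nat => (cr (s_ i))%:C%C : F).
Local Notation a := (cr s).
Local Notation b := (cr t).
Hypotheses (X0 : X != 0) (Y0 : Y != 0) (den0 : forall i, lin_den f X Y zeta i != 0).
Hypothesis pfrac0 : forall a, pfrac f X Y d zeta a = 0 -> forall i, (i < d)%N -> a i = 0.
Local Notation fval := (fval f X Y d zeta c).
Implicit Types (chi : Irr R gT).
Local Notation dkx := (dunkl_x d zeta s_ f X Y c).
Local Notation dky := (dunkl_y d zeta s_ f X Y c).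
Local Notation gx := (gen_x dkx dky).
Local Notation gy := (gen_y dkx dky).
Local Notation U := <<1 & [:: dkx; dky]>>%AS.
Local Notation res rho := (resmod [:: dkx; dky] (map_repr f rho)).
Local Notation Res chi := (res (irr_repr chi)).
Local Notation thx := (thx d zeta s_ f X Y cr).
Local Notation thy := (thy d zeta s_ f X Y cr).
Local Notation rho := (- (X / Y)).
Local Notation type1 := (type1 gx gy).
Let genA := @gen_ind _ _ dkx dky.
Let c_per := cplx_per hzeta hV hs cr.
Let c2 := cplx2 hzeta hV hs hW hc.
Implicit Types (L : lmodType (subvs_of U)).

Definition idx_wt chi : R := wt a b (lin_idx s_ chi).1 (lin_idx s_ chi).2.

Lemma res1 chi : irr_degree chi = 1%N -> type1 (Res chi) (thx chi) (thy chi).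
Proof. exact: (res_type1 d zeta s_ f X Y c (irr_repr chi)). Qed.

Lemma res2 chi : irr_degree chi = 2 -> (2 < d)%N /\ exists (e1 e2 : Res chi) p q,
    p * q = fval /\ plane gx gy e1 e2 p q rho.
Proof.
move=> d2; exact: (res_plane hzeta hV hs hW X0 Y0 den0 c_per c2 (socle_irr chi) d2).
Qed.

Lemma res2_act chi : irr_degree chi = 2 -> forall v : Res chi,
  gx *: (gx *: v) = sc fval v /\ gy *: v = sc rho (gx *: v).
Proof.
move=> d2 v; have [_ [e1 [e2 [p [q [E P]]]]]] := res2 d2.
by rewrite (plane_dx2 P) E (plane_y P).
Qed.

Lemma repr_acts0 n (sigma : mx_representation F [set: gT] n) (z : subvs_of U) :
  (forall v : res sigma, z *: v = 0) -> grpalg_mx (map_repr f sigma) (vsval z) = 0.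
Proof.
move=> z0; apply/matrixP=> i j; rewrite [RHS]mxE.
have /matrixP/(_ i 0) := z0 (delta_mx j 0 : 'cV_n).
by rewrite resmod_scaleE -colE !mxE.
Qed.

Lemma acts_faithful (z : subvs_of U) : (forall chi (v : Res chi), z *: v = 0) -> z = 0.
Proof.
move=> z0; apply: val_inj; apply: (irr_faithful (f := f)) => chi.
exact: (repr_acts0 (sigma := irr_repr chi)).
Qed.

(** By faithfulness it suffices that D_x and D_y commute on the irreducible representations: they
    are scalars in degree 1, and D_y is a multiple of D_x in degree 2. *)
Lemma Gau_comm (x y : subvs_of U) : x * y = y * x.
Proof.
apply: gen_comm.
suff E : gx * gy - gy * gx = 0.
  by have := congr1 vsval E; rewrite /= => /eqP; rewrite subr_eq0 => /eqP.
apply: acts_faithful => chi v; rewrite scalerBl -!scalerA.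
have [d1|d2] := irr_deg hzeta hV hs hW chi; last first.
  by rewrite (res2_act d2 v).2 (res2_act d2 (gx *: v)).2 scale_sc subrr.
have [ex ey] := type1_eigen v (res1 d1).
by rewrite ey ex !scale_sc ex ey !scA mulrC subrr.
Qed.

(** An element that is 0 in degree 2, multiplied by one factor vanishing on each linear character,
    is 0 on all irreducible representations, hence 0; [simple_kill] draws the consequence for L. *)
Lemma Gau_kill L (z : subvs_of U) : simple_module L ->
  (forall chi, irr_degree chi = 2 -> forall v : Res chi, z *: v = 0) ->
  (exists2 chi, irr_degree chi = 1%N & type1 L (thx chi) (thy chi)) \/
  forall v : L, z *: v = 0.
Proof.
move=> sL z2; pose ths := [seq (thx chi, thy chi) | chi <- enum (Irr R gT) & irr_degree chi == 1%N].
have [w||] := @simple_kill _ _ _ _ genA Gau_comm L ths z sL; last by right.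
  apply: acts_faithful => chi v; rewrite -scalerA.
  have [d1|d2] := irr_deg hzeta hV hs hW chi; last by rewrite z2 // scaler0.
  have : (thx chi, thy chi) \in ths.
    by apply/mapP; exists chi => //; rewrite mem_filter mem_enum d1 eqxx.
  move: (z *: v) => {}v; elim: ths => // p r IH; rewrite inE big_cons -scalerA.
  case/orP=> [/eqP E|/IH ->]; last exact: scaler0.
  have [ex ey] := type1_eigen (\prod_(j <- r) (if w j then gx - j.1%:A else gy - j.2%:A) *:
    v) (res1 d1).
  by rewrite -E; case: (w _); rewrite scalerBl ?ex ?ey subrr.
case=> x /mapP[chi]; rewrite mem_filter => /andP[/eqP d1 _] -> tL.
by left; exists chi.
Qed.

Definition is2 L : Prop := forall v : L,
  gx *: (gx *: v) = sc fval v /\ gy *: v = sc rho (gx *: v).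

(** Unless L comes from a linear character, [Gau_kill] transfers to it every relation valid in
    degree 2. Applied to z = 1, it shows that degree 2 occurs. *)
Lemma Gau_dich L : simple_module L ->
  (exists2 chi, irr_degree chi = 1%N & type1 L (thx chi) (thy chi)) \/
  [/\ is2 L, exists chi : Irr R gT, irr_degree chi = 2 &
      forall chi, irr_degree chi = 1%N -> idx_wt chi != 0].
Proof.
move=> sL.
have [//|N] := pselect (exists2 chi, irr_degree chi = 1%N & type1 L (thx chi) (thy chi));
  first by left.
have kill z : (forall chi, irr_degree chi = 2 -> forall v : Res chi, z *: v = 0) ->
    forall v : L, z *: v = 0.
  by move=> z2; case: (Gau_kill sL z2).
have L2 : is2 L.
  move=> v; split; apply/eqP; rewrite -subr_eq0.
    have <- : (gx * gx - fval%:A) *: v = gx *: (gx *: v) - sc fval v.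
      by rewrite scalerBl scalerA.
    apply/eqP; apply: kill => chi d2 u.
    by rewrite scalerBl -scalerA (res2_act d2 u).1 subrr.
  have <- : (gy - rho *: gx) *: v = gy *: v - sc rho (gx *: v).
    by rewrite scalerBl sc_scale.
  apply/eqP; apply: kill => chi d2 u.
  by rewrite scalerBl sc_scale (res2_act d2 u).2 subrr.
right; split=> //.
  have [//|N2] := pselect (exists chi : Irr R gT, irr_degree chi = 2).
  have [[v v0] _] := sL; case/eqP: v0; rewrite -[v]scale1r; apply: kill => chi d2.
  by case: N2; exists chi.
(* A linear character of weight 0 realises both square roots of [fval], the second through
   [lin_opp]. As D_x^2 = [fval] on L, one of them is an eigenvalue there, so L does come from a
   linear character. *)
move=> chi d1; apply/eqP=> w0; apply: N.
have E := th_sq hzeta hV hs hW hc X0 Y0 den0 d1 w0.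
have Ey := thy_ratio hzeta hV hs hW hc Y0 den0 d1 w0.
have [chi' d1' [w' Ex' Ey']] := lin_opp hzeta hV hs hW f X Y hc d1.
have eig (v : L) th : gx *: v = sc th v -> eigen gx gy th (rho * th) v.
  by move=> vx; split=> //; rewrite (L2 v).2 vx scA.
have [[v v0] _] := sL.
have [v1|v1] := eqVneq (gx *: v) (sc (thx chi) v).
  exists chi => //; rewrite Ey; apply: (simple_eigen genA sL v0); exact: eig.
exists chi' => //; rewrite Ey' Ex' Ey -mulrN.
apply: (simple_eigen genA sL (u := gx *: v - sc (thx chi) v)); first by rewrite subr_eq0.
apply: eig; rewrite scalerBr (L2 v).1 scale_sc -E.
by rewrite scN scDr scvN scA -expr2 opprB.
Qed.

Lemma mult1 L chi (m : nat) : irr_degree chi = 1%N ->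
  comp_mult L (Res chi) m <-> m = `[< type1 L (thx chi) (thy chi) >].
Proof. by move=> d1; apply: (type1_mult genA L _ (res1 d1)). Qed.

Definition pair_mult L th : nat := `[< type1 L th (rho * th) >] + `[< type1 L (- th) (rho *
  - th) >].

Lemma pair_multN L th : pair_mult L (- th) = pair_mult L th.
Proof. by rewrite /pair_mult opprK addnC. Qed.

(* The multiplicity of L is the same in all the representations of degree 2. *)
Definition m2P L (m2 : nat) : Prop :=
  [/\ forall chi m, irr_degree chi = 2 -> comp_mult L (Res chi) m <-> m = m2,
      forall th, th ^+ 2 = fval -> m2 = pair_mult L th
    & (forall th, th ^+ 2 != fval) -> m2 = `[< is2 L >]].

Lemma m2_ex L : simple_module L -> exists m2, m2P L m2.
Proof.
move=> sL; have [[th E]|N] := pselect (exists th, th ^+ 2 = fval).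
  exists (pair_mult L th); split.
  - move=> chi m d2; have [_ [e1 [e2 [p [q [E' P]]]]]] := res2 d2.
    by apply: (plane_mult_split genA P); rewrite E' E.
  - move=> th'; rewrite -E => /eqP; rewrite eqf_sqr => /orP[|] /eqP -> //.
    by rewrite pair_multN.
  - by move=> /(_ th); rewrite E eqxx.
have {}N th : th ^+ 2 != fval by apply/eqP=> E; apply: N; exists th.
exists `[< is2 L >]; split=> // [chi m d2|th /eqP]; last by rewrite (negbTE (N th)).
have [_ [e1 [e2 [p [q [E' P]]]]]] := res2 d2; rewrite -E' in N.
have := plane_mult_simple genA P N m sL; rewrite E'; exact.
Qed.

Definition cm_sum L (m2 : nat) w : F :=
  \sum_(chi : Irr R gT | irr_degree chi == 1%N) (`[< type1 L (thx chi) (thy chi) >] : nat)%:R *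
      Defs.irr_char chi w + m2%:R * chi2 R s t w.

(** The definition of [CM_cellular] with C(V) replaced by a field K, and X, Y by elements of K
    subject to the hypotheses of the section. *)
Definition CM_gen (gamma : gT -> F) : Prop :=
  exists L (mult : Irr R gT -> nat),
    [/\ simple_module L, forall chi, comp_mult L (Res chi) (mult chi)
      & gamma = fun w => \sum_chi (mult chi)%:R * Defs.irr_char chi w].

Lemma CM_genE gamma : CM_gen gamma <-> exists L m2,
  [/\ simple_module L, m2P L m2 & gamma = cm_sum L m2].
Proof.
have sumE L m2 (mult : Irr R gT -> nat) w :
    (forall chi, irr_degree chi = 1%N -> mult chi = `[< type1 L (thx chi) (thy chi) >]) ->
    (forall chi, irr_degree chi = 2 -> mult chi = m2) ->
    \sum_chi (mult chi)%:R * Defs.irr_char chi w = cm_sum L m2 w.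
  move=> M1 M2; rewrite (bigID (fun chi => irr_degree chi == 1%N)) /=; congr (_ + _).
    by apply: eq_bigr => chi /eqP d1; rewrite M1.
  rewrite -(sum_deg2 hzeta hV hs hW) mulr_sumr; apply: eq_bigr => chi d1.
  rewrite M2 //; exact: (irr_deg2 hzeta hV hs hW (negbTE d1)).
split=> [[L [mult [sL M ->]]]|[L [m2 [sL mP ->]]]].
  have [m2 mP] := m2_ex sL; exists L, m2; split=> //; apply/funext=> w.
  apply: sumE => chi dc; first by have := (mult1 L (mult chi) dc).1 (M chi).
  by have [H _ _] := mP; have := (H chi (mult chi) dc).1 (M chi).
pose mult chi := if irr_degree chi == 1%N then (`[< type1 L (thx chi) (thy chi) >] : nat) else m2.
exists L, mult; split=> // [chi|].
  have [d1|d2] := irr_deg hzeta hV hs hW chi.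
    by apply/(mult1 L _ d1); rewrite /mult d1 eqxx.
  by have [H _ _] := mP; apply/(H chi _ d2); rewrite /mult d2.
apply/funext=> w; apply/esym; apply: sumE => chi dc; by rewrite /mult dc.
Qed.

Lemma type1_deg1 L chi0 chi : irr_degree chi0 = 1%N -> irr_degree chi = 1%N ->
  type1 L (thx chi0) (thy chi0) ->
  `[< type1 L (thx chi) (thy chi) >] =
  same_wt a b (lin_idx s_ chi0).1 (lin_idx s_ chi0).2 (lin_idx s_ chi).1 (lin_idx s_ chi).2.
Proof.
move=> d0 d1 t0; have H := th_eq hzeta hV hs hW hc X0 Y0 pfrac0 d0 d1.
apply/asboolP/idP => [/(type1_inj t0) /H //|/H [Ex Ey]].
by rewrite -Ex -Ey.
Qed.

Lemma sum_type1 L chi0 w : irr_degree chi0 = 1%N -> type1 L (thx chi0) (thy chi0) ->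
  \sum_(chi : Irr R gT | irr_degree chi == 1%N) (`[< type1 L (thx chi) (thy chi) >] : nat)%:R *
      Defs.irr_char chi w =
  lin_block s t a b (lin_idx s_ chi0).1 (lin_idx s_ chi0).2 w.
Proof.
move=> d0 t0; set p := (lin_idx s_ chi0).1; set q := (lin_idx s_ chi0).2.
have S := sum_deg1 hzeta hV hs hW xpredT (fun pq => (same_wt a b p q pq.1 pq.2)%:R) w.
rewrite /lin_block [RHS]big_mkcond /=.
transitivity (\sum_(pq : bool * bool | xpredT pq) (same_wt a b p q pq.1 pq.2)%:R * lin_char
  R s t pq.1 pq.2 w); last first.
  by apply: eq_bigr => pq _; case: ifP; rewrite ?mul1r ?mul0r.
rewrite -S; apply: eq_big => [chi|chi /eqP d1]; first by rewrite andbT.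
by rewrite (type1_deg1 d0 d1 t0).
Qed.

Lemma opp_eq_self (x : K) : (- x == x) = (x == 0).
Proof.
have n2 : (2%:R : K) != 0 by rewrite -(rmorph_nat f) fmorph_eq0 pnatr_eq0.
rewrite eq_sym -subr_eq0 opprK -mulr2n -mulr_natl mulf_eq0 (negbTE n2) //.
Qed.

(** X times th plus Y times rho th is 0, whereas by [th_wt] a non-zero weight makes X [thx chi0] + Y
    [thy chi0] non-zero. *)
Lemma type1_not_ratio L chi0 th : irr_degree chi0 = 1%N -> idx_wt chi0 != 0 ->
  type1 L (thx chi0) (thy chi0) -> ~ type1 L th (rho * th).
Proof.
move=> d1 w0 t0 /(type1_inj t0)[Ex Ey]; case/negP: w0.
rewrite /idx_wt -(th_wt hzeta hV hs hW hc den0 d1) Ey -Ex.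
by rewrite -(neg_ratio_cancel X (thx chi0) Y0) subrr.
Qed.

Lemma m2_wt L m2 chi0 : irr_degree chi0 = 1%N -> idx_wt chi0 != 0 ->
  type1 L (thx chi0) (thy chi0) -> m2P L m2 -> m2 = 0%N.
Proof.
move=> d1 w0 t0 [_ M1 M2]; have N := type1_not_ratio d1 w0 t0.
have [[th E]|Nsq] := pselect (exists th, th ^+ 2 = fval).
  by rewrite (M1 th E) /pair_mult !asboolF.
rewrite M2 => [|th]; last by apply/eqP=> E; apply: Nsq; exists th.
rewrite asboolF // => L2; have [u [u0 [ux uy] span]] := t0.
apply: (N (thx chi0)); exists u; split=> //; split=> //.
by rewrite (L2 u).2 ux scA.
Qed.

(** The composition factors in degree 2 belong to [thx chi0] and its opposite. L is the first, and
    also the second if they coincide, that is if they are 0. This occurs for c = 0, where the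
    multiplicity 2 gives reg = sum_lin + 2 chi2. *)
Lemma m2_wt0 L m2 chi0 : irr_degree chi0 = 1%N -> idx_wt chi0 = 0 ->
  type1 L (thx chi0) (thy chi0) -> m2P L m2 -> m2 = (1 + (thx chi0 == 0%R))%N.
Proof.
move=> d1 w0 t0 [_ M1 _].
have E := th_sq hzeta hV hs hW hc X0 Y0 den0 d1 w0.
have Ey := thy_ratio hzeta hV hs hW hc Y0 den0 d1 w0.
rewrite Ey in t0; rewrite (M1 _ E) /pair_mult asboolT //; congr (_ + nat_of_bool _)%N.
apply/asboolP/idP => [/(type1_inj t0)[/esym/eqP]|/eqP th0]; first by rewrite opp_eq_self.
by rewrite th0 oppr0 -th0.
Qed.

(** If [fval] has a square root, D_x has an eigenvector in L for one of two distinct roots, so L is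
    exactly one of the two factors in degree 2. *)
Lemma m2_is2 L m2 : simple_module L -> is2 L -> fval != 0 -> m2P L m2 -> m2 = 1%N.
Proof.
move=> sL L2 f0 [_ M1 M2].
have [[th E]|Nsq] := pselect (exists th, th ^+ 2 = fval); last first.
  by rewrite M2 ?asboolT // => th; apply/eqP=> E; apply: Nsq; exists th.
have th0 : th != 0 by apply: contraNneq f0 => th0; rewrite -E th0 expr0n.
have eig (v : L) k : gx *: v = sc k v -> eigen gx gy k (rho * k) v.
  by move=> vx; split=> //; rewrite (L2 v).2 vx scA.
have one k : k != 0 -> type1 L k (rho * k) -> pair_mult L k = 1%N.
  move=> k0 tk; rewrite /pair_mult asboolT // asboolF // => /(type1_inj tk)[/esym/eqP].
  by rewrite opp_eq_self (negbTE k0).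
rewrite (M1 th E); have [[v v0] _] := sL.
have [v1|v1] := eqVneq (gx *: v) (sc th v).
  by apply: one => //; apply: (simple_eigen genA sL v0); apply: eig.
rewrite -pair_multN; apply: one; first by rewrite oppr_eq0.
apply: (simple_eigen genA sL (u := gx *: v - sc th v)); first by rewrite subr_eq0.
apply: eig; rewrite scalerBr (L2 v).1 scale_sc -E.
by rewrite scN scDr scvN scA -expr2 opprB.
Qed.

Lemma wt0_neq0 p q : (a == 0) && (b == 0) = false -> wt a b p q = 0 -> a != 0 /\ b != 0.
Proof.
rewrite /wt => ab /eqP; have [a0|a0] := eqVneq a 0; have [b0|b0] := eqVneq b 0.
- by rewrite a0 b0 eqxx in ab.
- by rewrite a0 mulr0 add0r mulf_eq0 signr_eq0 (negbTE b0).
- by rewrite b0 mulr0 addr0 mulf_eq0 signr_eq0 (negbTE a0).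
- by split.
Qed.

Lemma wt_zero p q : a = 0 -> b = 0 -> wt a b p q = 0.
Proof. by rewrite /wt => -> ->; rewrite !mulr0 addr0. Qed.

Lemma lin_block_zero p q w : a = 0 -> b = 0 -> lin_block s t a b p q w = sum_lin R s t w.
Proof.
move=> a0 b0; rewrite /lin_block /sum_lin; apply: eq_bigl => pq.
by rewrite /same_wt a0 b0 !mulr0 eqxx.
Qed.

Lemma thx_eq0 chi : a = 0 -> b = 0 -> irr_degree chi = 1%N -> thx chi = 0.
Proof.
move=> a0 b0 d1; have W i : wc s_ cr chi i = 0.
  rewrite (wcE hzeta hV hs hW hc i d1) a0 b0.
  move: (lin_idx s_ chi) => [p q] /=; case: (odd i); by rewrite mulr0.
rewrite -[thx chi]/(- pfrac f X Y d zeta (wc s_ cr chi)) /pfrac big1 ?oppr0 // => i _.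
by rewrite W rmorph0 mul0r.
Qed.

Lemma cm_sum_zero L m2 chi0 : irr_degree chi0 = 1%N ->
  type1 L (thx chi0) (thy chi0) -> m2P L m2 -> a = 0 -> b = 0 ->
  cm_sum L m2 = @reg_char R gT.
Proof.
move=> d1 t0 mP a0 b0; apply/funext=> w; rewrite /cm_sum (sum_type1 w d1 t0).
rewrite (m2_wt0 d1 (wt_zero _ _ a0 b0) t0 mP).
rewrite thx_eq0 // eqxx /chi2 mulrC mulfVK ?pnatr_eq0 //.
by rewrite (lin_block_zero _ _ _ a0 b0) addrC subrK.
Qed.

Lemma cm_sum_wt L m2 chi0 : irr_degree chi0 = 1%N -> idx_wt chi0 != 0 ->
  type1 L (thx chi0) (thy chi0) -> m2P L m2 ->
  cm_sum L m2 = lin_block s t a b (lin_idx s_ chi0).1 (lin_idx s_ chi0).2.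
Proof.
move=> d1 w0 t0 mP; apply/funext=> w.
rewrite /cm_sum (sum_type1 w d1 t0).
by rewrite (m2_wt d1 w0 t0 mP) mul0r addr0.
Qed.

Lemma cm_sum_wt0 L m2 chi0 : irr_degree chi0 = 1%N -> idx_wt chi0 = 0 ->
  (a == 0) && (b == 0) = false -> type1 L (thx chi0) (thy chi0) -> m2P L m2 ->
  cm_sum L m2 = fun w => lin_char R s t (lin_idx s_ chi0).1 (lin_idx s_ chi0).2 w + chi2 R s t w.
Proof.
move=> d1 w0 ab t0 mP; apply/funext=> w.
rewrite /cm_sum (sum_type1 w d1 t0).
have [a0 b0] := wt0_neq0 ab w0.
rewrite (lin_block_neq0 _ _ _ _ a0 b0) (m2_wt0 d1 w0 t0 mP).
have th0 : thx chi0 != 0.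
  have := fval_eq0 hzeta hV hs hW hc X0 Y0 pfrac0 ab.
  by rewrite -(th_sq hzeta hV hs hW hc X0 Y0 den0 d1 w0) expf_eq0.
by rewrite (negbTE th0) mul1r.
Qed.

Lemma cm_sum_is2 L m2 : simple_module L -> is2 L ->
  (forall chi, irr_degree chi = 1%N -> idx_wt chi != 0) -> m2P L m2 ->
  (a == 0) && (b == 0) = false -> cm_sum L m2 = chi2 R s t.
Proof.
move=> sL L2 wn mP ab; apply/funext=> w; rewrite /cm_sum.
rewrite (m2_is2 sL L2 (fval_eq0 hzeta hV hs hW hc X0 Y0 pfrac0 ab) mP) mul1r.
rewrite big1 ?add0r // => chi /eqP d1; rewrite asboolF ?mul0r // => t1.
have [[v v0] _] := sL.
have [ex ey] := type1_eigen v t1.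
apply: (type1_not_ratio d1 (wn _ d1) t1 (th := thx chi)).
apply: (simple_eigen genA sL v0); split=> //.
by rewrite (L2 v).2 ex scA.
Qed.

(** A representation of degree 2 serves if its restriction stays simple; otherwise the module
    attached to one of its eigenvectors does. *)
Lemma type2_exists : (2 < d)%N -> exists L, simple_module L /\ is2 L.
Proof.
move=> d2; have [chi dc] := exists_deg2 hzeta hV hs hW d2.
have act := res2_act dc.
have [_ [e1 [e2 [p [q [E P]]]]]] := res2 dc.
have [[th thE]|N] := pselect (exists th, th ^+ 2 = p * q); last first.
  exists (Res chi); split=> //; apply: (plane_simple P) => th; apply/eqP=> E'.
  by apply: N; exists th.
have [u u0 ux] := plane_eigenvector P thE.
have [L tL] := eigen_type1 genA u0 (plane_eigen P ux).
exists L; split; first exact: type1_simple tL.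
move=> v; have [ex ey] := type1_eigen v tL.
by rewrite ex ey scale_sc ex !scA -expr2 thE E.
Qed.

Lemma CM_genP gamma : CM_gen gamma <-> cellular_char d s t a b gamma.
Proof.
rewrite (CM_genE).
have res_ex chi0 : irr_degree chi0 = 1%N -> exists L m2,
    [/\ simple_module L, type1 L (thx chi0) (thy chi0) & m2P L m2].
  move=> d1; have t1 := res1 d1; have sL := type1_simple t1.
  have [m2 mP] := m2_ex sL.
  by exists (Res chi0), m2.
have triv := lin_ex_irr R (lin_ex_diag hzeta hV hs hW false).
rewrite /cellular_char; case ab : ((a == 0) && (b == 0)).
  have /andP[/eqP a0 /eqP b0] := ab.
  split=> [[L [m2 [sL mP ->]]]|->].
    have [[chi0 d1 t0]|[_ _ wn]] := Gau_dich sL.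
      exact: cm_sum_zero t0 mP a0 b0.
    (* For c = 0 the trivial character has weight 0, which rules out this branch. *)
    have [chi0 d1 _] := triv; have := wn chi0 d1.
    by rewrite /idx_wt (wt_zero _ _ a0 b0) eqxx.
  have [chi0 d1 _] := triv; have [L [m2 [sL t0 mP]]] := res_ex chi0 d1.
  by exists L, m2; split=> //; rewrite (cm_sum_zero d1 t0 mP a0 b0).
split=> [[L [m2 [sL mP ->]]]|].
  have [[chi0 d1 t0]|[L2 [chi d2] wn]] := Gau_dich sL.
    have [ex _] := irr_deg1 hzeta hV hs hW d1.
    have [w0|w0] := eqVneq (idx_wt chi0) 0.
      apply: Or32; exists (lin_idx s_ chi0).1, (lin_idx s_ chi0).2; split=> //.
      exact: cm_sum_wt0 w0 ab t0 mP.
    apply: Or31; exists (lin_idx s_ chi0).1, (lin_idx s_ chi0).2; split=> //.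
    exact: cm_sum_wt w0 t0 mP.
  apply: Or33; split.
  - exact: (res2 d2).1.
  - move=> p q /(lin_ex_irr R)[chi1 d1 E]; have := wn chi1 d1.
    by rewrite /idx_wt E.
  exact: cm_sum_is2 L2 wn mP ab.
case=> [[p [q [/(lin_ex_irr R)[chi0 d1 E] w0 ->]]]|[p [q [/(lin_ex_irr R)[chi0 d1 E] w0
  ->]]]|[d2 wn ->]].
- have [L [m2 [sL t0 mP]]] := res_ex chi0 d1.
  exists L, m2; split=> //; rewrite (cm_sum_wt d1 _ t0 mP) ?E //.
  by rewrite /idx_wt E.
- have [L [m2 [sL t0 mP]]] := res_ex chi0 d1.
  exists L, m2; split=> //; rewrite (cm_sum_wt0 d1 _ ab t0 mP) ?E //.
  by rewrite /idx_wt E.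
have [L [sL L2]] := type2_exists d2.
have [m2 mP] := m2_ex sL.
exists L, m2; split=> //; rewrite (cm_sum_is2 sL L2 _ mP ab) // => chi d1.
by apply: wn; case: (irr_deg1 hzeta hV hs hW d1).
Qed.

End CMCharacters.

Theorem mainTheorem4 (R : realType) (d : nat) (zeta : R[i])
    (* W = gT, the finite group <s, t> of 2 x 2 matrices, with s_ i the
       element whose matrix is s_i *)
    (gT : finGroupType) (V : mx_representation R[i] [set: gT] 2)
    (s_ : nat -> gT)
    (hzeta : d.-primitive_root zeta)
    (hV : mx_faithful V)
    (hs : forall i : nat, V (s_ i) = refl_mx zeta i)
    (hW : <<[set s_ 0%N; s_ 1%N]>>%g = [set: gT])
    (* c : Ref(W) -> R, constant on conjugacy classes; only its values at the
       reflections s_ i are used *)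
    (c : gT -> R)
    (hc : forall (i : nat) (w : gT), c (s_ i ^ w)%g = c (s_ i))
    (* the Hecke algebra, its bar involution and its Kazhdan-Lusztig basis *)
    (H : algType (expring R)) (T : gT -> H)
    (hT : is_Hecke_algebra [set s_ 0%N; s_ 1%N] c T)
    (bar : {rmorphism H -> H}) (hbar : is_bar_involution T bar)
    (C : gT -> H) (hC : is_KL_basis T bar C) :
  CM_cellular d zeta s_ (fun w => (c w)%:C%C) = KL_cellular T C.
Proof.
have D := matrix_dihedral hzeta hV hs hW.
apply/funext=> gamma; apply/propext.
have den0 := lin_den_neq0 zeta.
have CM := CM_genP hzeta hV hs hW (f := ratfun_const R) hc (ratX_neq0 R) (ratY_neq0 R)
  den0 (pfrac_eq0 hzeta) gamma.
(* [CM_gen] for the rational functions is convertible to [CM_cellular]. *)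
apply: (iff_trans CM); apply: iff_sym.
apply: (KL_cellular_charE hbar hC D hT).
- exact: (c_odd hzeta hV hs hW hc).
- exact: (fix_char_s hzeta hV hs hW).
- exact: (fix_char_t hzeta hV hs hW).
- by move=> nd p q; apply: (lin_ex_even hzeta hV hs hW).
- exact: (lin_ex_diag hzeta hV hs hW).
Qed.
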